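(* Let $\Gamma$ be a convex co-compact Schottky group with limit set $\Lambda_\Gamma\subset\mathbb{R}$, let $\delta\in(0,1)$ be the Hausdorff dimension of $\Lambda_\Gamma$ (equivalently, the critical exponent of the Poincaré series of $\Gamma$), and let $\mu$ be the Patterson-Sullivan measure of $\Gamma$. Suppose that $\delta>\frac12$. Then there exists a constant $C=C(\Gamma)>0$ such that the Fourier transform $\widehat{\mu}(\xi)=\int e^{-2\pi i\xi x}\,d\mu(x)$ satisfies $$|\widehat{\mu}(\xi)|\le C\,|\xi|^{-\frac{\delta(2\delta-1)}{(2\delta+1)(3-\delta)}}\qquad\text{for all }\xi\in\mathbb{R}\text{ with }|\xi|\ge 1.$$
   Context: Let $\mathbb{H}^2=\{z\in\mathbb{C}:\mathrm{Im}\,z>0\}$, $\partial\mathbb{H}^2=\mathbb{R}\cup\{\infty\}$, $\overline{\mathbb{H}^2}=\mathbb{H}^2\cup\partial\mathbb{H}^2$. Real $2\times 2$ matrices of determinant one (modulo sign) act on $\overline{\mathbb{H}^2}$ by $\gamma(z)=\frac{az+b}{cz+d}$. Convex co-compact Schottky group: let $r\ge2$, and let $D_1,\dots,D_{2r}\subset\overline{\mathbb{H}^2}$ be pairwise disjoint closed half-disks centred on the real line, $D_a=\{z\in\mathbb{H}^2\cup\mathbb{R}:|z-x_a|\le\rho_a\}$ with $x_a\in\mathbb{R}$, $\rho_a>0$. Put $\mathcal{A}=\{1,\dots,2r\}$, $\overline{a}=a-r$ if $a>r$ and $\overline{a}=a+r$ otherwise. Let $\gamma_a\in\mathrm{SL}_2(\mathbb{R})$,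 $a\in\mathcal{A}$, satisfy $\gamma_a(\overline{\mathbb{H}^2}\setminus D_{\overline{a}}^\circ)=D_a$ and $\gamma_{\overline{a}}=\gamma_a^{-1}$, where $A^\circ$ denotes the interior (relative to $\overline{\mathbb{H}^2}$). Then $\Gamma$ is the (free) group generated by $\gamma_1,\dots,\gamma_r$, viewed in $\mathrm{PSL}_2(\mathbb{R})$. The limit set $\Lambda_\Gamma$ is the minimal non-empty closed $\Gamma$-invariant subset of $\mathbb{R}\cup\{\infty\}$; it is a compact subset of $\mathbb{R}$ contained in $\bigcup_a (D_a\cap\mathbb{R})$. The Patterson-Sullivan measure $\mu$ (centred at $i$) is the unique Borel probability measure with support $\Lambda_\Gamma$ such that for every bounded Borel function $f$ and every $\gamma\in\Gamma$, $$\int_{\Lambda_\Gamma}f\,d\mu=\int_{\Lambda_\Gamma}f(\gamma(x))\,|\gamma'(x)|_{\mathbb{S}^1}^\delta\,d\mu(x),\qquad |\gamma'(x)|_{\mathbb{S}^1}=\frac{1+x^2}{1+\gamma(x)^2}|\gamma'(x)|.$$ *)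

(* Defs.v *)
From HB Require Import structures.
From mathcomp Require Import all_boot all_order all_algebra.
From mathcomp Require Import all_classical all_reals all_analysis.
From mathcomp Require Import complex.
Set Implicit Arguments.
Unset Strict Implicit.
Unset Printing Implicit Defensive.
Import Order.TTheory GRing.Theory Num.Theory.
Import numFieldNormedType.Exports.
Local Open Scope classical_set_scope.
Local Open Scope ring_scope.
Local Open Scope complex_scope.

(* Only meaningful away from the pole of g; see [moeb_ext]. *)
Definition moeb (F : fieldType) (g : 'M[F]_2) (z : F) : F :=
  (g 0 0 * z + g 0 1) / (g 1 0 * z + g 1 1).

(* [None] is the point at infinity. *)
Definition moeb_ext (F : fieldType) (g : 'M[F]_2) (z : option F) : option F :=
  match z with
  | Some z => if g 1 0 * z + g 1 1 == 0 then None else Some (moeb g z)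
  | None => if g 1 0 == 0 then None else Some (g 0 0 / g 1 0)
  end.

(* It is the regular module R[i]^o that carries the topology of the complex
   plane. *)
Notation riemann_sphere R := (one_point_compactification (R[i]^o)).

Definition moebC (R : realType) (g : 'M[R]_2) :
    riemann_sphere R -> riemann_sphere R :=
  moeb_ext (map_mx (real_complex R) g).

Definition closed_H2 (R : realType) : set (riemann_sphere R) :=
  [set z | if z is Some w then 0 <= complex.Im w else True].

Definition half_disk (R : realType) (x rho : R) : set (riemann_sphere R) :=
  [set z | if z is Some w then 0 <= complex.Im w /\ `|w - x%:C| <= rho%:C
           else False].

Definition interior_H2 (R : realType) (A : set (riemann_sphere R)) :
    set (riemann_sphere R) :=
  @interior (subspace (@closed_H2 R)) A.

(* Letters 1, ..., 2r are the elements of 'I_(r + r), counted from 0; this is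
   the involution a |-> a + r or a - r. *)
Definition bar_letter (r : nat) (a : 'I_(r + r)) : 'I_(r + r) :=
  match fintype.split a with inl j => rshift r j | inr j => lshift r j end.

Definition subgroup_closed (R : realType) (G : set 'M[R]_2) : Prop :=
  [/\ G 1%:M, forall g h, G g -> G h -> G (g *m h)
    & forall g, G g -> G (invmx g)].

(* The group is represented by a set of matrices of determinant one, namely the
   subgroup of SL_2(R) generated by the gamma_a. The notions below only involve
   the transformations defined by these matrices, i.e. their classes modulo
   sign. *)
Definition schottky_group (R : realType) (Gamma : set 'M[R]_2) : Prop :=
  exists (r : nat) (x rho : 'I_(r + r) -> R) (gamma : 'I_(r + r) -> 'M[R]_2),
  [/\ (2 <= r)%N,
      (forall a, 0 < rho a),
      trivIset setT (fun a => half_disk (x a) (rho a)),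
      (forall a, [/\ \det (gamma a) = 1,
         moebC (gamma a) @`
           (@closed_H2 R `\`
             interior_H2 (half_disk (x (bar_letter a)) (rho (bar_letter a))))
         = half_disk (x a) (rho a)
       & gamma (bar_letter a) = invmx (gamma a)])
    & Gamma = smallest (@subgroup_closed R)
                [set gamma (lshift r i) | i in [set: 'I_r]]].

(* The boundary of the hyperbolic plane is the one-point compactification of the
   real line. For a Schottky group this intersection is itself non-empty, hence
   the least non-empty closed invariant set. *)
Definition limit_set (R : realType) (Gamma : set 'M[R]_2) :
    set (one_point_compactification R) :=
  \bigcap_(K in [set K : set (one_point_compactification R) |
      [/\ K !=set0, closed K
        & forall g, Gamma g -> moeb_ext g @` K `<=` K]]) K.

(* For a Schottky group the limit set does not contain infinity, and nothing is
   lost by viewing it in the real line. *)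
Definition limit_setR (R : realType) (Gamma : set 'M[R]_2) : set R :=
  [set x | limit_set Gamma (Some x)].

(* The value 0 is thrown in so that the empty set has diameter 0. *)
Definition diameter (R : realType) (A : set R) : \bar R :=
  ereal_sup ([set 0%E] `|`
    [set (`|p.1 - p.2|)%:E | p in A `*` A]).

Definition hausdorff_premeasure (R : realType) (s eps : R) (A : set R) :
    \bar R :=
  ereal_inf [set (\sum_(0 <= i <oo) poweR (diameter (U i)) s)%E |
    U in [set U : nat -> set R |
      A `<=` \bigcup_i U i /\ forall i, (diameter (U i) <= eps%:E)%E]].

Definition hausdorff_measure (R : realType) (s : R) (A : set R) : \bar R :=
  ereal_sup [set hausdorff_premeasure s eps A | eps in [set eps : R | 0 < eps]].

Definition hausdorff_dim (R : realType) (A : set R) : \bar R :=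
  ereal_inf [set s%:E | s in [set s : R | 0 < s /\ hausdorff_measure s A = 0%E]].

Definition measure_support (R : realType)
    (mu : {measure set (measurableTypeR R) -> \bar R}) : set R :=
  [set x | forall U : set R, open U -> U x -> (0 < mu U)%E].

Definition circle_derivative (R : realType) (g : 'M[R]_2) (x : R) : R :=
  (1 + x ^+ 2) / (1 + moeb g x ^+ 2) * `|derive1 (moeb g) x|.

(* [moeb g] has no pole on the limit set, which is invariant and contained in the
   real line. *)
Definition patterson_sullivan (R : realType) (Gamma : set 'M[R]_2) (delta : R)
    (mu : probability (measurableTypeR R) R) : Prop :=
  measure_support mu = limit_setR Gamma /\
  forall f : measurableTypeR R -> R,
    measurable_fun setT f -> (exists M : R, forall x, `|f x| <= M) ->
    forall g, Gamma g ->
    (\int[mu]_(x in limit_setR Gamma) (f x)%:E =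
     \int[mu]_(x in limit_setR Gamma)
        (f (moeb g x) * circle_derivative g x `^ delta)%:E)%E.

Definition expi (R : realType) (t : R) : R[i] := cos t +i* sin t.

Definition complex_integral (R : realType)
    (mu : {measure set (measurableTypeR R) -> \bar R})
    (f : R -> R[i]) : R[i] :=
  (\int[mu]_x complex.Re (f x)) +i* (\int[mu]_x complex.Im (f x)).

Definition fourier_transform (R : realType)
    (mu : {measure set (measurableTypeR R) -> \bar R}) (xi : R) : R[i] :=
  complex_integral mu (fun x => expi (- (2 * pi * xi * x))).

(* Main.v *)
Require Import Defs.
From mathcomp Require Import all_boot all_order all_algebra.
From mathcomp Require Import all_classical all_reals all_analysis.
From mathcomp Require Import complex.
From mathcomp Require Import measurable_realfun zify ring lra.
Import Order.TTheory GRing.Theory Num.Theory.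
Import numFieldNormedType.Exports.
Local Open Scope classical_set_scope.
Local Open Scope ring_scope.
Local Open Scope complex_scope.
Set Implicit Arguments.
Unset Strict Implicit.
Unset Printing Implicit Defensive.

(** Decay of the Fourier transform of a Patterson-Sullivan measure.

    Let mu be the measure, W a large parameter and tau = W / |xi|. The tree of
    reduced words is cut at the words w whose action contracts to size tau;
    the corresponding cylinders partition the limit set, and conformality
    turns the integral of a wave of frequency xi into the integral over mu of
    a sum S over these words of waves, with amplitude |w'|^delta (about
    tau^delta) and phase xi w(x) (of slope about W). By Cauchy-Schwarz it is
    enough to bound the integral over mu of |S|^2, which is a double sum over
    pairs of words.

    Frostman's bound mu(B(y, r)) <= C r^delta allows one to replace mu by
    Lebesgue measure at the scale 1 / W, up to a factor W^(1 - delta): at that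
    scale the supremum of |S|^2 is controlled by means, by a Sobolev
    inequality. Then only Lebesgue integrals of pairs of words remain. The
    derivative of a Moebius map with pole p is a constant times (x - p)^-2, so
    the difference of the phases of two words is governed by the distance d of
    their poles, and van der Corput's lemma bounds the integral of the pair by
    tau^(2 delta) (W d)^(-1/2).

    It remains to count poles. The lower left entry of g h^-1 is, up to sign,
    the product of those of g and h and of the distance of the poles of g and
    h; being bounded below for g <> h in the group, it separates the poles of
    distinct words of size tau by about tau. Each of them carries mu-mass at
    least about tau^delta in its tau-neighbourhood, as the inverse of the word
    contracts towards it. Hence at most about (r / tau)^delta poles lie in a
    ball of radius r > tau, and since delta > 1/2 the sum over the words v <>
    w of tau^delta |p_w - p_v|^(-1/2) is bounded. Altogether, for W >= 1,

      |mu^(xi)|^2 <= C W^(1 - delta) (tau^delta + W^(-1/2)),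

    and tau = |xi|^(-1 / (2 delta + 1)) makes both terms equal. This gives the
    exponent delta (2 delta - 1) / (2 (2 delta + 1)), and 2 < 3 - delta.

    The group enters through ping-pong on the real line only (record
    [pingpong]) and the measure through a positive functional
    ([conformal_density]). The main estimates are [van_der_corput],
    [pair_bound], [energy_sup], [pole_sep], [frostman], [pole_count],
    [riesz_sum], [disk_energy] and [wave_decay]; [limit_setR_back] and
    [limit_setR_inv] locate the limit set, by exhibiting a closed invariant
    set of points with reduced itineraries. *)

(** * Calculus on intervals *)

Section calculus.
Context {R : realType}.
Implicit Types (f g h P : R -> R) (x y a b : R).

Lemma der_eq f x a b : is_derive x 1 f a -> a = b -> is_derive x 1 f b.
Proof. by move=> ? <-. Qed.

Lemma der_cst (c x : R) : is_derive x 1 (fun=> c) (0 : R).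
Proof. exact: is_derive_cst. Qed.

Lemma der_id x : is_derive x 1 (fun y : R => y) (1 : R).
Proof. exact: is_derive_id. Qed.

Lemma derD f g x a b : is_derive x 1 f a -> is_derive x 1 g b ->
  is_derive x 1 (fun y => f y + g y) (a + b).
Proof. by move=> df dg; exact: (is_deriveD (f := f) (g := g)). Qed.

Lemma derB f g x a b : is_derive x 1 f a -> is_derive x 1 g b ->
  is_derive x 1 (fun y => f y - g y) (a - b).
Proof. by move=> df dg; exact: (is_deriveB (f := f) (g := g)). Qed.

Lemma derM f g x a b : is_derive x 1 f a -> is_derive x 1 g b ->
  is_derive x 1 (fun y => f y * g y) (a * g x + f x * b).
Proof.
move=> df dg; have H := is_deriveM df dg; apply: (der_eq H).
by rewrite /GRing.scale /= addrC (mulrC a).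
Qed.

Lemma derZ c f x a : is_derive x 1 f a ->
  is_derive x 1 (fun y => c * f y) (c * a).
Proof.
move=> df; apply: (der_eq (derM (der_cst c x) df)).
by rewrite mul0r add0r.
Qed.

Lemma derV f x a : f x != 0 -> is_derive x 1 f a ->
  is_derive x 1 (fun y => (f y)^-1) (- a / f x ^+ 2).
Proof.
move=> fx df; apply: (der_eq (is_deriveV fx df)).
by rewrite /GRing.scale /= !mulNr mulrC.
Qed.

Lemma der_comp f g x a b : is_derive (g x) 1 f a -> is_derive x 1 g b ->
  is_derive x 1 (fun y => f (g y)) (a * b).
Proof. exact: is_derive1_comp. Qed.

Lemma der_sin f x a : is_derive x 1 f a ->
  is_derive x 1 (fun y => sin (f y)) (cos (f x) * a).
Proof. by move=> df; apply: (der_comp (f := sin)) df; exact: is_derive_sin. Qed.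

Lemma der_cos f x a : is_derive x 1 f a ->
  is_derive x 1 (fun y => cos (f y)) (- sin (f x) * a).
Proof. by move=> df; apply: (der_comp (f := cos)) df; exact: is_derive_cos. Qed.

Lemma der_sum (I : eqType) (s : seq I) (f : I -> R -> R) (d : I -> R) x :
  {in s, forall i, is_derive x 1 (f i) (d i)} ->
  is_derive x 1 (fun y => \sum_(i <- s) f i y) (\sum_(i <- s) d i).
Proof.
elim: s => [|i s IH] df.
  rewrite big_nil (_ : (fun _ => _) = fun=> 0); first exact: der_cst.
  by apply/funext => y; rewrite big_nil.
rewrite big_cons (_ : (fun _ => _) = fun y => f i y + \sum_(j <- s) f j y).
  apply: derD; first by apply: df; rewrite mem_head.
  by apply: IH => j js; apply: df; rewrite in_cons js orbT.
by apply/funext => y; rewrite big_cons.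
Qed.

Lemma der_continuous f x a : is_derive x 1 f a -> {for x, continuous f}.
Proof.
by move=> df; apply/differentiable_continuous/derivable1_diffP; case: df.
Qed.

Lemma der_within f (d : R -> R) u v :
  (forall x, u <= x <= v -> is_derive x 1 f (d x)) ->
  {within `[u, v], continuous f}.
Proof.
move=> df; apply: derivable_within_continuous => x; rewrite in_itv /= => xuv.
by case: (df x xuv).
Qed.

(** The form of the mean value theorem used throughout: a derivative bounded by
    that of a comparison function. Unlike a bound by a constant it loses nothing
    when the comparison function is monotone with a large derivative. *)
Lemma mean_value_ineq f g (f' g' : R -> R) u v : u <= v ->
  (forall x, u <= x <= v -> is_derive x 1 f (f' x)) ->
  (forall x, u <= x <= v -> is_derive x 1 g (g' x)) ->
  (forall x, u <= x <= v -> `|f' x| <= g' x) ->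
  `|f v - f u| <= g v - g u.
Proof.
move=> uv df dg fg.
have key (e : R) : `|e| = 1 -> e * (f v - f u) <= g v - g u.
  move=> e1.
  have dh x : u <= x <= v ->
      is_derive x 1 (fun y => g y - e * f y) (g' x - e * f' x).
    by move=> xuv; apply: derB; [exact: dg | apply: derZ; exact: df].
  have := @MVT_segment R (fun y => g y - e * f y) (fun x => g' x - e * f' x) u v uv.
  case=> [x||c].
  - by rewrite in_itv /= => /andP[ux xv]; apply: dh; rewrite !ltW.
  - exact: der_within dh.
  - rewrite in_itv /= => cuv H.
    have : 0 <= g v - e * f v - (g u - e * f u).
      rewrite H mulr_ge0 ?subr_ge0//.
      rewrite (le_trans (ler_norm _))// normrM e1 mul1r; exact: fg.
    lra.
have := key 1 (normr1 _); have := key (-1) (normrN1 _).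
rewrite ler_norml mulN1r mul1r => ? ->; rewrite andbT; lra.
Qed.

(** The fundamental theorem of calculus wants an integrand that is continuous on
    the whole line, so the integrand is composed with the retraction of the line
    onto the interval. *)
Lemma primitive_exists f u v : u <= v ->
  (forall x, u <= x <= v -> {for x, continuous f}) ->
  exists P : R -> R, forall x, u <= x <= v -> is_derive x 1 P (f x).
Proof.
move=> uv cf.
pose cl y := (`|y - u| - `|y - v| + u + v) / 2.
have clP y : u <= cl y <= v.
  rewrite /cl; case: (ger0P (y - u)); case: (ger0P (y - v)); lra.
have cl_id y : u <= y <= v -> cl y = y.
  move=> /andP[? ?]; rewrite /cl ger0_norm ?subr_ge0// ler0_norm ?subr_le0//.
  lra.
have ccl : continuous cl.
  move=> y; rewrite /cl; apply: cvgM; last exact: cvg_cst.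
  apply: cvgD; last exact: cvg_cst.
  apply: cvgD; last exact: cvg_cst.
  apply: cvgB; apply: cvg_norm; apply: cvgB; try exact: cvg_cst; exact: cvg_id.
pose g := f \o cl.
have cg : continuous g.
  by move=> y; apply: continuous_comp; [exact: ccl | apply: cf; exact: clP].
pose P y := (\int[@lebesgue_measure R]_(t in [set` `[u - 1, y]]) g t)%R.
exists P => x xuv.
have := @continuous_FTC1_closed R g (u - 1) x (v + 1).
case.
- by case/andP: xuv; lra.
- apply: continuous_compact_integrable; first exact: segment_compact.
  by apply: continuous_subspaceT.
- by case/andP: xuv; lra.
- exact: cg.
- move=> dP eP; apply: DeriveDef; first exact: dP.
  by move: eP; rewrite derive1E /g /= cl_id.
Qed.

End calculus.

(** * Van der Corput's lemma *)

Section oscillatory.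
Context {R : realType}.
Implicit Types (P B t psi : R -> R) (x u v K m : R).

Lemma ler_normM_bound (a b c d : R) : `|a| <= c -> `|b| <= d -> `|a * b| <= c * d.
Proof. by move=> ac bd; rewrite normrM ler_pM. Qed.

(** Integration by parts: with W := B t / (s x + e) sin psi, the functions P and
    W / L have derivatives with the same oscillating term, and what is left in
    the derivative of P - W / L is dominated by that of a linear function plus a
    multiple of 1 / (s x + e), which is monotone. *)
Lemma nonstationary_pos P B B' t t' psi (s e L l K m : R) u v :
  u <= v -> 0 < L -> 0 < l ->
  (forall x, u <= x <= v -> is_derive x 1 P (B x * cos (psi x))) ->
  (forall x, u <= x <= v -> is_derive x 1 psi (L * (s * x + e) / t x)) ->
  (forall x, u <= x <= v -> is_derive x 1 B (B' x)) ->
  (forall x, u <= x <= v -> is_derive x 1 t (t' x)) ->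
  (forall x, u <= x <= v -> t x != 0) ->
  (forall x, u <= x <= v -> [/\ `|B x| <= m, `|B' x| <= m, `|t x| <= K & `|t' x| <= K]) ->
  (forall x, u <= x <= v -> l <= s * x + e) ->
  `|P v - P u| <= K * m * (3 + 2 * (v - u)) / (L * l).
Proof.
move=> uv L0 l0 dP dpsi dB dt t0 bnd ll.
have uu : u <= u <= v by rewrite lexx.
have vv : u <= v <= v by rewrite lexx uv.
have [m0 K0] : 0 <= m /\ 0 <= K.
  by have [h _ k _] := bnd u uu; split; [apply: le_trans h|apply: le_trans k].
pose E x := B x * t x; pose E' x := B' x * t x + B x * t' x.
pose V x := (s * x + e)^-1; pose V' x := - s / (s * x + e) ^+ 2.
have ellp x : u <= x <= v -> 0 < s * x + e by move=> /ll; exact: lt_le_trans.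
have Eb x : u <= x <= v -> `|E x| <= m * K.
  by move=> /bnd[b1 b2 b3 b4]; exact: ler_normM_bound.
have E'b x : u <= x <= v -> `|E' x| <= 2 * (K * m).
  move=> /bnd[b1 b2 b3 b4]; apply: le_trans (ler_normD _ _) _.
  have := ler_normM_bound b2 b3; have := ler_normM_bound b1 b4; lra.
have Vb x : u <= x <= v -> 0 < V x <= l^-1.
  by move=> xuv; rewrite /V invr_gt0 ellp// lef_pV2 ?posrE ?ellp ?ll.
have dE x : u <= x <= v -> is_derive x 1 E (E' x).
  by move=> xuv; apply: derM; [exact: dB | exact: dt].
have dl x : is_derive x 1 (fun y : R => s * y + e) s.
  apply: (der_eq (derD (derZ s (der_id x)) (der_cst e x))).
  by rewrite mulr1 addr0.
have dV x : u <= x <= v -> is_derive x 1 V (V' x).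
  by move=> xuv; apply: derV (dl x); rewrite gt_eqF// ellp.
pose W x := E x * V x * sin (psi x).
pose rem x := (E' x * V x + E x * V' x) * sin (psi x).
have dW x : u <= x <= v -> is_derive x 1 W (rem x + L * (B x * cos (psi x))).
  move=> xuv; apply: (der_eq (derM (derM (dE x xuv) (dV x xuv)) (der_sin (dpsi x xuv)))).
  rewrite /rem /E /V; congr (_ + _).
  have := ellp x xuv; have := t0 x xuv => h1 /lt0r_neq0 h2; field.
  by rewrite ?h1 ?h2.
pose F x := P x - L^-1 * W x.
have dF x : u <= x <= v -> is_derive x 1 F (- (L^-1 * rem x)).
  move=> xuv; apply: (der_eq (derB (dP x xuv) (derZ L^-1 (dW x xuv)))).
  have L0' := lt0r_neq0 L0; field; exact: L0'.
pose sg : R := if 0 <= s then 1 else -1.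
have sgs : sg * s = `|s|.
  by rewrite /sg; case: (ger0P s); rewrite ?mul1r ?mulN1r.
have sg1 : `|sg| = 1 by rewrite /sg; case: ifP; rewrite ?normrN1 ?normr1.
pose G x := 2 * (K * m) / (L * l) * x + - (sg * (K * m) / L) * V x.
have dG x : u <= x <= v ->
    is_derive x 1 G (2 * (K * m) / (L * l) * 1 + - (sg * (K * m) / L) * V' x).
  by move=> xuv; exact: (derD (derZ _ (der_id x)) (derZ _ (dV x xuv))).
have main : `|F v - F u| <= G v - G u.
  apply: mean_value_ineq uv dF dG _ => x xuv.
  rewrite normrN normrM ger0_norm ?invr_ge0 ?(ltW L0)//.
  have hV' : - (sg * (K * m) / L) * V' x = L^-1 * ((K * m) * `|V' x|).
    rewrite /V' normrM normrN -sgs normfV ger0_norm ?exprn_ge0 ?ltW ?ellp//.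
    by have := lt0r_neq0 L0; have := lt0r_neq0 (ellp x xuv) => h1 h2; field; rewrite ?h1 ?h2.
  have -> : 2 * (K * m) / (L * l) * 1 = L^-1 * (2 * (K * m) * l^-1).
    by have := lt0r_neq0 L0; have := lt0r_neq0 l0 => h1 h2; field; rewrite ?h1 ?h2.
  rewrite hV' -mulrDr ler_wpM2l ?invr_ge0 ?(ltW L0)//.
  rewrite /rem normrM -[leRHS]mulr1 ler_pM//; last first.
    by rewrite ler_norml sin_geN1 sin_le1.
  apply: le_trans (ler_normD _ _) _; apply: lerD.
    apply: ler_normM_bound (E'b x xuv) _.
    by have /andP[V0 Vl] := Vb x xuv; rewrite ger0_norm // ltW.
  by apply: ler_normM_bound => //; rewrite mulrC; exact: Eb.
have Wb x : u <= x <= v -> `|L^-1 * W x| <= K * m / (L * l).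
  move=> xuv; rewrite normrM ger0_norm ?invr_ge0 ?(ltW L0)// invfM.
  rewrite [leRHS]mulrCA ler_wpM2l ?invr_ge0 ?(ltW L0)//.
  rewrite /W -[leRHS]mulr1; apply: ler_normM_bound; last first.
    by rewrite ler_norml sin_geN1 sin_le1.
  apply: ler_normM_bound; first by rewrite mulrC; exact: Eb.
  by have /andP[V0 Vl] := Vb x xuv; rewrite ger0_norm // ltW.
have Gb : G v - G u <= K * m * (1 + 2 * (v - u)) / (L * l).
  have -> : G v - G u = K * m * (2 * (v - u)) / (L * l) + (K * m / L) * (sg * (V u - V v)).
    by rewrite /G; have := lt0r_neq0 L0; have := lt0r_neq0 l0 => h1 h2; field; rewrite ?h1 ?h2.
  have -> : K * m * (1 + 2 * (v - u)) / (L * l) =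
      K * m * (2 * (v - u)) / (L * l) + (K * m / L) * l^-1.
    by have := lt0r_neq0 L0; have := lt0r_neq0 l0 => h1 h2; field; rewrite ?h1 ?h2.
  rewrite lerD2l ler_wpM2l ?divr_ge0 ?mulr_ge0 ?(ltW L0)//.
  apply: le_trans (ler_norm _) _; rewrite normrM sg1 mul1r.
  have := Vb u uu; have := Vb v vv => /andP[a1 a2] /andP[a3 a4].
  by rewrite ler_norml; apply/andP; split; lra.
have -> : P v - P u = (F v - F u) + (L^-1 * W v - L^-1 * W u) by rewrite /F; ring.
apply: le_trans (ler_normD _ _) _.
have -> : K * m * (3 + 2 * (v - u)) / (L * l) =
  K * m * (1 + 2 * (v - u)) / (L * l) + (K * m / (L * l) + K * m / (L * l)).
  by have := lt0r_neq0 L0; have := lt0r_neq0 l0 => h1 h2; field; rewrite ?h1 ?h2.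
apply: lerD; first exact: le_trans main Gb.
by apply: le_trans (ler_normB _ _) _; apply: lerD; exact: Wb.
Qed.

Lemma nonstationary P B B' t t' psi (s e L l K m : R) u v :
  u <= v -> 0 < L -> 0 < l ->
  (forall x, u <= x <= v -> is_derive x 1 P (B x * cos (psi x))) ->
  (forall x, u <= x <= v -> is_derive x 1 psi (L * (s * x + e) / t x)) ->
  (forall x, u <= x <= v -> is_derive x 1 B (B' x)) ->
  (forall x, u <= x <= v -> is_derive x 1 t (t' x)) ->
  (forall x, u <= x <= v -> t x != 0) ->
  (forall x, u <= x <= v -> [/\ `|B x| <= m, `|B' x| <= m, `|t x| <= K & `|t' x| <= K]) ->
  (forall x, u <= x <= v -> l <= s * x + e) \/
    (forall x, u <= x <= v -> s * x + e <= - l) ->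
  `|P v - P u| <= K * m * (3 + 2 * (v - u)) / (L * l).
Proof.
move=> uv L0 l0 dP dpsi dB dt t0 bnd [ll|ll].
  exact: (nonstationary_pos uv L0 l0 dP dpsi dB dt t0 bnd ll).
apply: (@nonstationary_pos P B B' t t' (fun x => - psi x) (- s) (- e)) => //.
- by move=> x xuv; rewrite cosN; exact: dP.
- move=> x xuv; apply: (der_eq (is_deriveN (dpsi x xuv))); ring.
- by move=> x xuv; have := ll x xuv; lra.
Qed.

Lemma trivial_bound P B psi m u v : u <= v ->
  (forall x, u <= x <= v -> is_derive x 1 P (B x * cos (psi x))) ->
  (forall x, u <= x <= v -> `|B x| <= m) ->
  `|P v - P u| <= m * (v - u).
Proof.
move=> uv dP Bm; rewrite mulrBr.
apply: (mean_value_ineq uv dP (fun x _ => derZ m (der_id x))) => x xuv.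
by apply: ler_normM_bound; [exact: Bm | rewrite ler_norml cos_geN1 cos_le1].
Qed.

Let clamp u v x := if x <= u then u else if v <= x then v else x.

Let clampP u v x : u <= v -> u <= clamp u v x <= v.
Proof.
move=> uv; rewrite /clamp.
by case: (leP x u) => h1; case: (leP v x) => h2; rewrite ?lexx ?uv// !ltW.
Qed.

Let clamp_le u v x y : u <= v -> x <= y ->
  clamp u v x <= clamp u v y <= clamp u v x + (y - x).
Proof.
by move=> uv xy; rewrite /clamp; case: (leP x u) => h1; case: (leP v x) => h2;
  case: (leP y u) => h3; case: (leP v y) => h4; apply/andP; split; lra.
Qed.

(** Around the zero of the affine function s x + e, which is the only possible
    stationary point, the trivial bound is used on a window of radius
    (L sig)^(-1/2); on both sides of the window |s x + e| is at least
    (sig / L)^(1/2) and the phase is not stationary. A derivative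
    with a single simple zero, up to the smooth factor 1 / t, is what takes the
    place of the usual lower bound on the second derivative. *)
Lemma van_der_corput P B B' t t' psi (s e L sig K m : R) u v :
  u <= v -> 0 < L -> 0 < sig -> sig <= `|s| ->
  (forall x, u <= x <= v -> is_derive x 1 P (B x * cos (psi x))) ->
  (forall x, u <= x <= v -> is_derive x 1 psi (L * (s * x + e) / t x)) ->
  (forall x, u <= x <= v -> is_derive x 1 B (B' x)) ->
  (forall x, u <= x <= v -> is_derive x 1 t (t' x)) ->
  (forall x, u <= x <= v -> t x != 0) ->
  (forall x, u <= x <= v -> [/\ `|B x| <= m, `|B' x| <= m, `|t x| <= K & `|t' x| <= K]) ->
  `|P v - P u| <= 2 * m * (1 + K * (3 + 2 * (v - u))) / Num.sqrt (L * sig).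
Proof.
move=> uv L0 sig0 sigs dP dpsi dB dt t0 bnd.
have uu : u <= u <= v by rewrite lexx.
have [m0 K0] : 0 <= m /\ 0 <= K.
  by have [h _ k _] := bnd u uu; split; [apply: le_trans h|apply: le_trans k].
have s0 : s != 0 by rewrite -normr_gt0 (lt_le_trans sig0).
set q := Num.sqrt (L * sig); have q0 : 0 < q by rewrite sqrtr_gt0 mulr_gt0.
have q2 : q ^+ 2 = L * sig by rewrite sqr_sqrtr// ltW ?mulr_gt0.
pose x0 := - e / s; have ex0 x : s * x + e = s * (x - x0).
  by rewrite /x0; field.
have qi0 : 0 < q^-1 by rewrite invr_gt0.
(* [y1, y2] is the window of radius 1/q around the stationary point, cut at [u, v] *)
pose y1 := clamp u v (x0 - q^-1); pose y2 := clamp u v (x0 + q^-1).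
have [uy1 y1v] := andP (clampP (x0 - q^-1) uv).
have [uy2 y2v] := andP (clampP (x0 + q^-1) uv).
rewrite -/y1 -/y2 in uy1 y1v uy2 y2v.
have x0q : x0 - q^-1 <= x0 + q^-1 by lra.
have /andP[y12 y12q] := clamp_le uv x0q.
rewrite -/y1 -/y2 in y12 y12q.
have sub a b (ua : u <= a) (bv : b <= v) x : a <= x <= b -> u <= x <= v.
  by move=> /andP[ax xb]; rewrite (le_trans ua ax) (le_trans xb bv).
have far a b : u <= a -> a <= b -> b <= v ->
    (forall x, a <= x <= b -> x <= x0 - q^-1) \/ (forall x, a <= x <= b -> x0 + q^-1 <= x) ->
    `|P b - P a| <= K * m * (3 + 2 * (v - u)) / q.
  move=> ua ab bv H.
  have S := sub a b ua bv.
  have l0 : 0 < sig / q by rewrite divr_gt0.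
  have := @nonstationary P B B' t t' psi s e L (sig / q) K m a b ab L0 l0.
  have -> : L * (sig / q) = q by rewrite mulrA -q2 expr2 mulfK ?gt_eqF.
  move=> /(_ (fun x h => dP x (S x h)) (fun x h => dpsi x (S x h))
    (fun x h => dB x (S x h)) (fun x h => dt x (S x h)) (fun x h => t0 x (S x h))
    (fun x h => bnd x (S x h))) HH.
  apply: (@le_trans _ _ (K * m * (3 + 2 * (b - a)) / q)).
    apply: HH.
    have [sp|sn] := leP 0 s.
      rewrite (ger0_norm sp) in sigs; case: H => H; [right|left] => x /H xx0;
      rewrite ex0.
        rewrite -lerN2 opprK -mulrN; apply: ler_pM => //; rewrite ?(ltW sig0) ?(ltW qi0)//; lra.
      by apply: ler_pM => //; rewrite ?(ltW sig0) ?(ltW qi0)//; lra.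
    rewrite (ltr0_norm sn) in sigs; case: H => H; [left|right] => x /H xx0;
    rewrite ex0.
      rewrite -[leRHS]mulrNN; apply: ler_pM => //; rewrite ?(ltW sig0) ?(ltW qi0)//; lra.
    by rewrite -lerN2 opprK -mulNr; apply: ler_pM => //; rewrite ?(ltW sig0) ?(ltW qi0)//; lra.
  rewrite ler_wpM2r ?(ltW qi0)// ler_wpM2l ?mulr_ge0//; lra.
have b1 : `|P y1 - P u| <= K * m * (3 + 2 * (v - u)) / q.
  have [h|h] := leP (x0 - q^-1) u.
    rewrite /y1 /clamp h subrr normr0 divr_ge0 ?mulr_ge0 ?(ltW q0)//; lra.
  apply: far => //; left => x /andP[_ xy]; apply: le_trans xy _.
  by rewrite /y1 /clamp (leNgt _ u) h /=; case: (leP v (x0 - q^-1)).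
have b3 : `|P v - P y2| <= K * m * (3 + 2 * (v - u)) / q.
  have [h|h] := leP v (x0 + q^-1).
    have -> : y2 = v.
      rewrite /y2 /clamp h; case: (leP (x0 + q^-1) u) => // hu.
      by apply/eqP; rewrite eq_le uv (le_trans h hu).
    rewrite subrr normr0 divr_ge0 ?mulr_ge0 ?(ltW q0)//; lra.
  apply: far => //; right => x /andP[yx _]; apply: le_trans yx.
  by rewrite /y2 /clamp [v <= _]leNgt h /=; case: (leP (x0 + q^-1) u).
have b2 : `|P y2 - P y1| <= m * (2 / q).
  have S := sub y1 y2 uy1 y2v.
  apply: le_trans (@trivial_bound P B psi m y1 y2 y12 (fun x h => dP x (S x h)) _) _.
    by move=> x /S /bnd[].
  rewrite ler_wpM2l//; lra.
have -> : P v - P u = (P v - P y2) + (P y2 - P y1) + (P y1 - P u) by ring.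
apply: le_trans (ler_normD _ _) _; apply: le_trans (lerD (ler_normD _ _) (lexx _)) _.
have -> : 2 * m * (1 + K * (3 + 2 * (v - u))) / q =
  K * m * (3 + 2 * (v - u)) / q + m * (2 / q) + K * m * (3 + 2 * (v - u)) / q.
  by have := lt0r_neq0 q0 => h1; field; rewrite ?h1 ?h2.
by apply: lerD => //; apply: lerD.
Qed.

End oscillatory.

(** * Differences of two Moebius phases *)

Section phase_denominator.
Context {R : realType}.
Implicit Types g V S n : R.

Lemma phase_denom_le g V n1 n2 : 0 < g -> g <= n1 <= V -> g <= n2 <= V ->
  [/\ 0 < (n1 * n2) ^+ 2 / (n1 + n2), 0 <= n1 * n2 <= V ^+ 2,
      0 <= (n1 + n2)^-1 <= (2 * g)^-1
    & (n1 * n2) ^+ 2 / (n1 + n2) <= V ^+ 4 / (2 * g)].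
Proof.
move=> g0 /andP[h1 h2] /andP[h3 h4].
have a1 : 0 < n1 := lt_le_trans g0 h1; have a2 : 0 < n2 := lt_le_trans g0 h3.
have p1 : 0 < n1 * n2 by rewrite mulr_gt0.
have p2 : n1 * n2 <= V ^+ 2 by rewrite expr2 ler_pM // ltW.
have s0 : 0 < n1 + n2 by rewrite addr_gt0.
have s1 : (n1 + n2)^-1 <= (2 * g)^-1 by rewrite lef_pV2 ?posrE //; lra.
split.
- by rewrite divr_gt0 ?exprn_gt0.
- by rewrite ltW.
- by rewrite s1 andbT invr_ge0 ltW.
apply: ler_pM; rewrite ?invr_ge0 ?sqr_ge0 ?(ltW s0) //.
have -> : V ^+ 4 = (V ^+ 2) ^+ 2 by rewrite -exprM.
by rewrite ler_pXn2r ?nnegrE ?sqr_ge0 // ltW.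
Qed.

Lemma phase_denom_der g V S n1 n2 a1 a2 : 0 < g -> g <= n1 <= V -> g <= n2 <= V ->
  `|a1| <= S -> `|a2| <= S ->
  `|2 * (n1 * n2) * (a1 * n2 + n1 * a2) * (n1 + n2)^-1 +
    (n1 * n2) ^+ 2 * (- (a1 + a2) / (n1 + n2) ^+ 2)| <=
  4 * S * V ^+ 3 / (2 * g) + V ^+ 4 * (2 * S / (2 * g) ^+ 2).
Proof.
move=> g0 hn1 hn2 as1 as2.
have [_ /andP[p1 p2] /andP[s1 s2] _] := phase_denom_le g0 hn1 hn2.
have [n1V n2V] : `|n1| <= V /\ `|n2| <= V.
  by move: hn1 hn2 => /andP[? ?] /andP[? ?]; rewrite !ger0_norm; lra.
apply: le_trans (ler_normD _ _) _; apply: lerD; apply: ler_normM_bound.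
- have -> : 4 * S * V ^+ 3 = 2 * V ^+ 2 * (S * V + V * S) by ring.
  apply: ler_normM_bound; first by rewrite ger0_norm; lra.
  by apply: le_trans (ler_normD _ _) _; apply: lerD; apply: ler_normM_bound.
- by rewrite ger0_norm.
- have -> : V ^+ 4 = (V ^+ 2) ^+ 2 by rewrite -exprM.
  by rewrite ger0_norm ?sqr_ge0 // ler_pXn2r ?nnegrE ?sqr_ge0.
apply: ler_normM_bound.
  by rewrite normrN; apply: le_trans (ler_normD _ _) _; lra.
rewrite -!exprVn ger0_norm ?sqr_ge0 // ler_pXn2r ?nnegrE //.
exact: le_trans s2.
Qed.

(** The two alternatives of van der Corput's lemma. If the slopes of
    n1 = k1 s1 (x - p1) and n2 = k2 s2 (x - p2) are almost equal, then s1 = s2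
    and n2 - n1 is almost the constant s2 k1 (p1 - p2), whose size is at least
    |p1 - p2|. *)
Lemma phase_dichotomy M (k1 k2 s1 s2 p1 p2 u v : R) :
  1 <= M -> 1 <= k1 -> 1 <= k2 -> s1 = 1 \/ s1 = -1 -> s2 = 1 \/ s2 = -1 ->
  `|p1 - p2| <= M ->
  (forall x, u <= x <= v -> 0 <= s2 * (x - p2) <= M) ->
  let s := k2 * s2 - k1 * s1 in
  let ell x := k2 * (s2 * (x - p2)) - k1 * (s1 * (x - p1)) in
  `|p1 - p2| / (2 * M) <= `|s| \/
  ((forall x, u <= x <= v -> `|p1 - p2| / 2 <= ell x) \/
    (forall x, u <= x <= v -> ell x <= - (`|p1 - p2| / 2))).
Proof.
move=> M1 k11 k21 hs1 hs2 dM D2 s ell.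
have M0 : 0 < 2 * M by lra.
have [|flat] := leP (`|p1 - p2| / (2 * M)) `|s|; [by left | right].
have small : `|s| < 1.
  by apply: lt_le_trans flat _; rewrite ler_pdivrMr //; lra.
have s12 : s1 = s2.
  move: small; rewrite ltr_norml /s => /andP[a1 a2].
  by case: hs1 hs2 a1 a2 => -> [] -> // a1 a2; exfalso; lra.
have sgn x : u <= x <= v -> `|ell x - s2 * (k1 * (p1 - p2))| <= `|p1 - p2| / 2.
  move=> xuv; have -> : ell x - s2 * (k1 * (p1 - p2)) = s * (x - p2).
    by rewrite /ell /s s12; ring.
  have -> : `|p1 - p2| / 2 = `|p1 - p2| / (2 * M) * M by field; lra.
  apply: ler_normM_bound; first exact: ltW.
  have /andP[h1 h2] := D2 x xuv; rewrite ler_norml.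
  by case: hs2 h1 h2 => ->; lra.
have big : `|p1 - p2| <= `|s2 * (k1 * (p1 - p2))|.
  have k10 : 0 <= k1 by lra.
  rewrite !normrM (ger0_norm k10).
  have -> : `|s2| = 1 by case: hs2 => ->; rewrite ?normrN1 ?normr1.
  by rewrite mul1r ler_peMl.
move: big; case: (ger0P (s2 * _)) => _ big; [left|right] => x /sgn;
  rewrite ler_norml => /andP[? ?]; lra.
Qed.

End phase_denominator.

Section two_moebius_phases.
Context {R : realType}.
Variables (gp M S : R).
Hypotheses (gp0 : 0 < gp) (M1 : 1 <= M) (S1 : 1 <= S).

Definition phase_cst :=
  (S * M) ^+ 4 / (2 * gp) +
  (4 * S * (S * M) ^+ 3 / (2 * gp) + (S * M) ^+ 4 * (2 * S / (2 * gp) ^+ 2)).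

Definition pair_cst :=
  2 * (1 + phase_cst * (3 + 2 * M)) * Num.sqrt (2 * M) +
  (2 * (phase_cst * (3 + 2 * M)) + M).

Let hyps : [/\ 0 < gp, 1 <= M & 1 <= S]. Proof. by []. Qed.

Let SM0 : 0 < S * M. Proof. by have [? ? ?] := hyps; apply: mulr_gt0; lra. Qed.

Let phase_parts : [/\ 0 <= (S * M) ^+ 4 / (2 * gp),
  0 <= 4 * S * (S * M) ^+ 3 / (2 * gp) &
  0 <= (S * M) ^+ 4 * (2 * S / (2 * gp) ^+ 2)].
Proof.
have [? ? ?] := hyps.
have h4 : 0 <= (S * M) ^+ 4 by rewrite exprn_ge0 // ltW.
have h3 : 0 <= (S * M) ^+ 3 by rewrite exprn_ge0 // ltW.
split.
- by rewrite divr_ge0 //; lra.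
- by apply: divr_ge0; [apply: mulr_ge0 => //; lra | lra].
- by apply: mulr_ge0 => //; apply: divr_ge0; [lra | exact: sqr_ge0].
Qed.

Lemma phase_cst_ge0 : 0 <= phase_cst.
Proof. by have [? ? ?] := hyps; have [a b c] := phase_parts; rewrite /phase_cst; lra. Qed.

Lemma pair_cst_ge0 : 0 <= pair_cst.
Proof.
have [? ? ?] := hyps; have K0 := phase_cst_ge0.
have K3 : 0 <= phase_cst * (3 + 2 * M) by apply: mulr_ge0; lra.
by rewrite /pair_cst; apply: addr_ge0; [apply: mulr_ge0; [lra | exact: sqrtr_ge0] | lra].
Qed.

(** The phase of a product of two waves with Moebius phases has derivative
    W (1/n1^2 - 1/n2^2), with n1 and n2 affine and bounded away from 0. This is W
    times the affine function n2 - n1 divided by the positive function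
    (n1 n2)^2 / (n1 + n2), so [phase_dichotomy] tells which of the oscillatory
    estimates applies. *)
Lemma pair_bound (P B B' psi : R -> R) (k1 k2 s1 s2 p1 p2 W m u v : R) :
  u <= v -> 0 < W -> 1 <= k1 <= S -> 1 <= k2 <= S ->
  s1 = 1 \/ s1 = -1 -> s2 = 1 \/ s2 = -1 ->
  p1 != p2 -> `|p1 - p2| <= M ->
  (forall x, u <= x <= v -> gp <= s1 * (x - p1) <= M) ->
  (forall x, u <= x <= v -> gp <= s2 * (x - p2) <= M) ->
  (forall x, u <= x <= v -> is_derive x 1 P (B x * cos (psi x))) ->
  (forall x, u <= x <= v -> is_derive x 1 psi
    (W * ((k1 * (s1 * (x - p1))) ^- 2 - (k2 * (s2 * (x - p2))) ^- 2))) ->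
  (forall x, u <= x <= v -> is_derive x 1 B (B' x)) ->
  (forall x, u <= x <= v -> `|B x| <= m /\ `|B' x| <= m) ->
  `|P v - P u| <= pair_cst * m / Num.sqrt (W * `|p1 - p2|).
Proof.
have [gp0' M1' S1'] := hyps; have SM0' := SM0.
move=> uv W0 /andP[k11 k1S] /andP[k21 k2S] hs1 hs2 p12 dM D1 D2 dP dpsi dB Bm.
have uu : u <= u <= v by rewrite lexx.
have vv : u <= v <= v by rewrite lexx uv.
have m0 : 0 <= m by have [h _] := Bm u uu; exact: le_trans h.
have s1s : s1 * s1 = 1 by case: hs1 => ->; rewrite ?mulrNN mulr1.
have s2s : s2 * s2 = 1 by case: hs2 => ->; rewrite ?mulrNN mulr1.
set d := `|p1 - p2|; have d0 : 0 < d by rewrite normr_gt0 subr_eq0.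
have len : v - u <= M.
  have /andP[a1 a2] := D1 u uu; have /andP[a3 a4] := D1 v vv.
  by case: hs1 a1 a2 a3 a4 => ->; lra.
pose n1 x := k1 * (s1 * (x - p1)); pose n2 x := k2 * (s2 * (x - p2)).
have nb (k s p x : R) : 1 <= k -> k <= S -> gp <= s * (x - p) <= M ->
    gp <= k * (s * (x - p)) <= S * M.
  move=> h1 h2 /andP[h3 h4]; apply/andP; split.
    by rewrite -[leLHS]mul1r; apply: ler_pM => //; exact: ltW.
  apply: ler_pM => //; [exact: le_trans h1 | exact: le_trans (ltW gp0) h3].
have n1b x : u <= x <= v -> gp <= n1 x <= S * M by move=> /D1; exact: nb.
have n2b x : u <= x <= v -> gp <= n2 x <= S * M by move=> /D2; exact: nb.
pose t x := (n1 x * n2 x) ^+ 2 / (n1 x + n2 x).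
have dn (k s p x : R) : is_derive x 1 (fun y => k * (s * (y - p))) (k * s).
  apply: (der_eq (derZ k (derZ s (derB (der_id x) (der_cst p x))))).
  by rewrite subr0 mulr1.
pose T1' x := 2 * (n1 x * n2 x) * (k1 * s1 * n2 x + n1 x * (k2 * s2)).
pose T2' x := - (k1 * s1 + k2 * s2) / (n1 x + n2 x) ^+ 2.
pose t' x := T1' x * (n1 x + n2 x)^-1 + (n1 x * n2 x) ^+ 2 * T2' x.
have sum0 x : u <= x <= v -> 2 * gp <= n1 x + n2 x.
  by move=> xuv; have := n1b x xuv; have := n2b x xuv => /andP[? ?] /andP[? ?]; lra.
have dt x : u <= x <= v -> is_derive x 1 t (t' x).
  move=> xuv.
  have dn12 := derM (dn k1 s1 p1 x) (dn k2 s2 p2 x).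
  have s0 : n1 x + n2 x != 0 by rewrite gt_eqF //; have := sum0 x xuv; lra.
  have dsum := derV (f := fun y => n1 y + n2 y) s0 (derD (dn k1 s1 p1 x) (dn k2 s2 p2 x)).
  apply: (der_eq (derM (derM dn12 dn12) dsum)).
  by rewrite /t' /T1' /T2' -/(n1 x) -/(n2 x); congr (_ + _); congr (_ * _); ring.
have k10 : 0 < k1 by lra. have k20 : 0 < k2 by lra.
have tpos x : u <= x <= v -> t x != 0.
  move=> xuv; have [h1 _ _ _] := phase_denom_le gp0 (n1b x xuv) (n2b x xuv).
  by rewrite gt_eqF.
have K0 := phase_cst_ge0.
have [w1 w2 w3] := phase_parts.
have tb x : u <= x <= v -> `|t x| <= phase_cst.
  move=> xuv; have [h1 _ _ h2] := phase_denom_le gp0 (n1b x xuv) (n2b x xuv).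
  rewrite gtr0_norm //; apply: le_trans h2 _; by rewrite lerDl addr_ge0.
have ks (k s : R) : 1 <= k -> k <= S -> s = 1 \/ s = -1 -> `|k * s| <= S.
  by move=> ? ? [->|->]; rewrite ?mulr1 ?mulrN1 ?normrN ger0_norm; lra.
have ks1 := ks k1 s1 k11 k1S hs1; have ks2 := ks k2 s2 k21 k2S hs2.
have t'b x : u <= x <= v -> `|t' x| <= phase_cst.
  move=> xuv; apply: le_trans (phase_denom_der gp0 (n1b x xuv) (n2b x xuv) ks1 ks2) _.
  by rewrite lerDr.
pose s := k2 * s2 - k1 * s1; pose e := k1 * (s1 * p1) - k2 * (s2 * p2).
have ell x : s * x + e = n2 x - n1 x by rewrite /s /e /n1 /n2; ring.
have dpsi' x : u <= x <= v -> is_derive x 1 psi (W * (s * x + e) / t x).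
  move=> xuv; apply: (der_eq (dpsi x xuv)); rewrite ell -/(n1 x) -/(n2 x) /t.
  have /andP[h1 _] := n1b x xuv; have /andP[h2 _] := n2b x xuv.
  have a1 : n1 x != 0 by rewrite gt_eqF //; lra.
  have a2 : n2 x != 0 by rewrite gt_eqF //; lra.
  have a3 : n1 x + n2 x != 0 by rewrite gt_eqF //; lra.
  by field; rewrite a1 a2 a3.
have bnd x : u <= x <= v ->
    [/\ `|B x| <= m, `|B' x| <= m, `|t x| <= phase_cst & `|t' x| <= phase_cst].
  by move=> xuv; have [? ?] := Bm x xuv; split => //; [exact: tb | exact: t'b].
set q := Num.sqrt (W * d); have q0 : 0 < q by rewrite sqrtr_gt0 mulr_gt0.
have q2 : q * q = W * d by rewrite -expr2 sqr_sqrtr // ltW ?mulr_gt0.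
have lenK : phase_cst * (3 + 2 * (v - u)) <= phase_cst * (3 + 2 * M).
  by rewrite ler_wpM2l // lerD2l ler_wpM2l.
have LK0 : 0 <= phase_cst * (3 + 2 * M).
  by apply: mulr_ge0 => //; rewrite addr_ge0 // mulr_ge0 // (le_trans ler01).
set KM := phase_cst * (3 + 2 * M) in lenK LK0 *.
have -> : pair_cst * m / q = 2 * m * (1 + KM) * (Num.sqrt (2 * M) / q) +
    (2 * KM * m / q + M * m / q) by rewrite /pair_cst -/KM; ring.
have pa : 0 <= 2 * m * (1 + KM) * (Num.sqrt (2 * M) / q).
  apply: mulr_ge0; last by rewrite divr_ge0 ?sqrtr_ge0 ?(ltW q0).
  by apply: mulr_ge0; [apply: mulr_ge0 | apply: addr_ge0].
have M0 : 0 <= M := le_trans ler01 M1.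
have pb : 0 <= 2 * KM * m / q.
  by apply: divr_ge0; [apply: mulr_ge0 => //; apply: mulr_ge0 | exact: ltW].
have pc : 0 <= M * m / q by apply: divr_ge0; [apply: mulr_ge0 | exact: ltW].
have D2' x : u <= x <= v -> 0 <= s2 * (x - p2) <= M.
  by move=> /D2 /andP[h1 h2]; rewrite h2 (le_trans (ltW gp0)).
have [slope|flat] := phase_dichotomy M1 k11 k21 hs1 hs2 dM D2'.
  have sig0 : 0 < d / (2 * M) by rewrite divr_gt0 // mulr_gt0 // (lt_le_trans ltr01).
  have := van_der_corput uv W0 sig0 slope dP dpsi' dB dt tpos bnd.
  have -> : Num.sqrt (W * (d / (2 * M))) = q / Num.sqrt (2 * M).
    by rewrite mulrA sqrtrM ?sqrtrV //; rewrite mulr_ge0 // ltW.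
  move=> h; apply: (le_trans h); rewrite invf_div -[leLHS]addr0; apply: lerD; last exact: addr_ge0.
  rewrite ler_wpM2r ?divr_ge0 ?sqrtr_ge0 ?(ltW q0) //.
  by apply: ler_wpM2l; [exact: mulr_ge0 | rewrite lerD2l].
have flatb : `|P v - P u| <= KM * m * 2 / (W * d).
  have l0 : 0 < d / 2 by rewrite divr_gt0.
  have := nonstationary uv W0 l0 dP dpsi' dB dt tpos bnd.
  move=> h; apply: (le_trans (h _)).
    case: flat => flat; [left|right] => x xuv; rewrite ell; exact: flat.
  have -> : phase_cst * m * (3 + 2 * (v - u)) / (W * (d / 2)) =
    phase_cst * (3 + 2 * (v - u)) * (m * 2 / (W * d)).
    by field; rewrite !gt_eqF.
  have -> : KM * m * 2 / (W * d) = KM * (m * 2 / (W * d)) by ring.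
  by apply: ler_wpM2r => //; rewrite divr_ge0 ?mulr_ge0 ?(ltW W0) ?(ltW d0).
have triv : `|P v - P u| <= M * m.
  apply: le_trans (trivial_bound uv dP (fun x h => (Bm x h).1)) _.
  by rewrite mulrC ler_wpM2r.
have [q1'|q1'] := leP 1 q.
  apply: le_trans flatb _; rewrite -q2.
  have -> : KM * m * 2 / (q * q) = 2 * KM * m / q * q^-1.
    by field; rewrite gt_eqF.
  apply: (@le_trans _ _ (2 * KM * m / q)); first by rewrite ler_piMr // invf_le1.
  by apply: ler_wpDl => //; rewrite lerDl.
apply: le_trans triv _; apply: (@le_trans _ _ (M * m / q)).
  by rewrite ler_peMr ?mulr_ge0 // invf_ge1 // ltW.
by apply: ler_wpDl => //; rewrite lerDr.
Qed.

End two_moebius_phases.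

(** * A Sobolev inequality for trigonometric sums *)

Section trigonometric_sums.
Context {R : realType} {I : eqType}.
Implicit Types (s : seq I) (al ph : I -> R -> R).

Definition csum s al ph x := \sum_(i <- s) al i x * cos (ph i x) : R.
Definition ssum s al ph x := \sum_(i <- s) al i x * sin (ph i x) : R.
(** The squared modulus of the complex sum of al_i exp(i ph_i). *)
Definition energy s al ph x := csum s al ph x * csum s al ph x + ssum s al ph x * ssum s al ph x.

Lemma energyE s al ph x : energy s al ph x =
  \sum_(i <- s) \sum_(j <- s) al i x * al j x * cos (ph i x - ph j x).
Proof.
rewrite /energy /csum /ssum !mulr_suml -big_split /=; apply: eq_bigr => i _.
rewrite !mulr_sumr -big_split /=; apply: eq_bigr => j _.
by rewrite cosB; ring.
Qed.

Lemma energy_ge0 s al ph x : 0 <= energy s al ph x.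
Proof. by rewrite addr_ge0 // -expr2 sqr_ge0. Qed.

Let csum_le s al ph x (X : R) :
  \sum_(i <- s) `|al i x| <= X -> `|csum s al ph x| <= X.
Proof.
move=> h; apply: le_trans (ler_norm_sum _ _ _) _; apply: le_trans h.
apply: ler_sum => i _; rewrite normrM ler_piMr //.
by rewrite ler_norml cos_geN1 cos_le1.
Qed.

Let ssum_le s al ph x (X : R) :
  \sum_(i <- s) `|al i x| <= X -> `|ssum s al ph x| <= X.
Proof.
move=> h; apply: le_trans (ler_norm_sum _ _ _) _; apply: le_trans h.
apply: ler_sum => i _; rewrite normrM ler_piMr //.
by rewrite ler_norml sin_geN1 sin_le1.
Qed.

Let quad_bound (a b c d r t X W : R) : 0 <= W ->
  `|a| <= X -> `|b| <= X -> `|r| <= X -> `|t| <= X ->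
  `|2 * (a * (r - W * d) + b * (t + W * c))| <=
  W * ((a * a + b * b) + (c * c + d * d)) + 4 * X ^+ 2.
Proof.
move=> W0 aX bX rX tX.
have -> : 2 * (a * (r - W * d) + b * (t + W * c)) =
  W * (2 * (b * c - a * d)) + 2 * (a * r + b * t) by ring.
apply: le_trans (ler_normD _ _) _; apply: lerD.
  rewrite normrM (ger0_norm W0) ler_wpM2l // ler_norml.
  have h1 := sqr_ge0 (b - c); have h2 := sqr_ge0 (a + d).
  have h3 := sqr_ge0 (b + c); have h4 := sqr_ge0 (a - d).
  by rewrite sqrrD sqrrB in h1 h2 h3 h4; rewrite !expr2 in h1 h2 h3 h4; apply/andP; split; lra.
have -> : 4 * X ^+ 2 = 2 * (X * X + X * X) by ring.
apply: ler_normM_bound; first by rewrite ger0_norm.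
by apply: le_trans (ler_normD _ _) _; apply: lerD; apply: ler_normM_bound.
Qed.

(** A Sobolev inequality at the scale 1/W of the oscillations. Differentiating
    the phases multiplies the amplitudes by W B_i / A_i, so the derivative of the
    energy with amplitudes A is controlled by W times this energy and the energy
    with amplitudes B, which has the same shape. The energy at a point exceeds
    its mean by at most the integral of that derivative. *)
Lemma energy_sup s (A A' B ph dph : I -> R -> R) (P Q : R -> R) (W X u v : R) :
  u < v -> 0 <= W ->
  (forall x, u <= x <= v -> {in s, forall i, is_derive x 1 (A i) (A' i x)}) ->
  (forall x, u <= x <= v -> {in s, forall i, is_derive x 1 (ph i) (dph i x)}) ->
  (forall x, u <= x <= v -> {in s, forall i, A i x * dph i x = W * B i x}) ->
  (forall x, u <= x <= v -> \sum_(i <- s) `|A i x| <= X) ->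
  (forall x, u <= x <= v -> \sum_(i <- s) `|A' i x| <= X) ->
  (forall x, u <= x <= v -> is_derive x 1 P (energy s A ph x)) ->
  (forall x, u <= x <= v -> is_derive x 1 Q (energy s B ph x)) ->
  forall x, u <= x <= v -> energy s A ph x <=
    (P v - P u) / (v - u) + W * ((P v - P u) + (Q v - Q u)) + 4 * X ^+ 2 * (v - u).
Proof.
move=> uv W0 dA dph' AB AX A'X dP dQ x xuv.
pose H y := W * (P y + Q y) + 4 * X ^+ 2 * y.
pose H' y := W * (energy s A ph y + energy s B ph y) + 4 * X ^+ 2 * 1.
have dH y : u <= y <= v -> is_derive y 1 H (H' y).
  move=> yuv.
  exact: (derD (derZ W (derD (dP y yuv) (dQ y yuv))) (derZ (4 * X ^+ 2) (der_id y))).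
pose En' y := 2 * (csum s A ph y * (csum s A' ph y - W * ssum s B ph y) +
  ssum s A ph y * (ssum s A' ph y + W * csum s B ph y)).
have dE y : u <= y <= v -> is_derive y 1 (energy s A ph) (En' y).
  move=> yuv.
  have dc : is_derive y 1 (csum s A ph) (csum s A' ph y - W * ssum s B ph y).
    have : {in s, forall i, is_derive y 1 (fun z => A i z * cos (ph i z))
        (A' i y * cos (ph i y) - W * (B i y * sin (ph i y)))}.
      move=> i si; apply: (der_eq (derM (dA y yuv i si) (der_cos (dph' y yuv i si)))).
      by rewrite [W * _]mulrA -(AB y yuv i si); ring.
    by move/der_sum/der_eq; apply; rewrite sumrB mulr_sumr.
  have ds : is_derive y 1 (ssum s A ph) (ssum s A' ph y + W * csum s B ph y).
    have : {in s, forall i, is_derive y 1 (fun z => A i z * sin (ph i z))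
        (A' i y * sin (ph i y) + W * (B i y * cos (ph i y)))}.
      move=> i si; apply: (der_eq (derM (dA y yuv i si) (der_sin (dph' y yuv i si)))).
      by rewrite [W * _]mulrA -(AB y yuv i si); ring.
    by move/der_sum/der_eq; apply; rewrite big_split /= mulr_sumr.
  by apply: (der_eq (derD (derM dc dc) (derM ds ds))); rewrite /En'; ring.
have EH y : u <= y <= v -> `|En' y| <= H' y.
  move=> yuv; rewrite /H' mulr1; apply: quad_bound => //.
  - exact/csum_le/AX.
  - exact/ssum_le/AX.
  - exact/csum_le/A'X.
  - exact/ssum_le/A'X.
have sub a b (ua : u <= a) (bv : b <= v) y : a <= y <= b -> u <= y <= v.
  by move=> /andP[ay yb]; rewrite (le_trans ua ay) (le_trans yb bv).
have Hmon a b : u <= a -> a <= b -> b <= v -> H a <= H b.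
  move=> ua ab bv; rewrite -subr_ge0; apply: le_trans (normr_ge0 (En' a * 0 - En' a * 0)) _.
  have S := sub a b ua bv.
  apply: (mean_value_ineq ab (fun y _ => derZ (En' a) (der_cst 0 y))
    (fun y h => dH y (S y h))) => y /S h.
  by rewrite mulr0 normr0; apply: le_trans (normr_ge0 _) (EH y h).
have Hlip a b : u <= a -> a <= b -> b <= v ->
    `|energy s A ph b - energy s A ph a| <= H b - H a.
  move=> ua ab bv; have S := sub a b ua bv.
  exact: (mean_value_ineq ab (fun y h => dE y (S y h)) (fun y h => dH y (S y h))
    (fun y h => EH y (S y h))).
have [c /andP[uc cv] Pc] : exists2 c, u <= c <= v & P v - P u = energy s A ph c * (v - u).
  have [|| c cI ->] := @MVT R P (energy s A ph) u v uv.
  - by move=> y; rewrite in_itv /= => /andP[h1 h2]; apply: dP; rewrite !ltW.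
  - exact: der_within dP.
  by exists c => //; move: cI; rewrite in_itv /= => /andP[h1 h2]; rewrite !ltW.
have vu0 : v - u != 0 by rewrite subr_eq0 gt_eqF.
rewrite {1}Pc mulfK // -addrA -lerBlDl.
have -> : W * ((P v - P u) + (Q v - Q u)) + 4 * X ^+ 2 * (v - u) = H v - H u.
  by rewrite /H; ring.
have /andP[ux xv] := xuv.
apply: le_trans (ler_norm _) _; have [xc|cx] := leP x c.
  rewrite distrC; apply: le_trans (Hlip x c ux xc cv) _.
  by apply: lerB; [exact: Hmon | apply: Hmon => //; exact: le_trans xc cv].
apply: le_trans (Hlip c x uc (ltW cx) xv) _.
by apply: lerB; [exact: Hmon | apply: Hmon => //; exact: le_trans (ltW cx) xv].
Qed.

End trigonometric_sums.

(** * Moebius transformations and Schottky words *)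

Section moebius.
Context {F : fieldType}.
Implicit Types (g h : 'M[F]_2) (x : F).

Definition den g x := g 1 0 * x + g 1 1.
Definition num g x := g 0 0 * x + g 0 1.
Definition pole g := - g 1 1 / g 1 0.
Definition image_infty g := g 0 0 / g 1 0.

Lemma ord2 (i : 'I_2) : i = 0 \/ i = 1.
Proof. by case: i => [[|[|//]] H]; [left | right]; apply: val_inj. Qed.

Lemma mul2E g h i j : (g *m h) i j = g i 0 * h 0 j + g i 1 * h 1 j.
Proof.
rewrite mxE big_ord_recl big_ord1; congr (_ + g i _ * h _ j); exact: val_inj.
Qed.

Lemma det2E g : \det g = g 0 0 * g 1 1 - g 0 1 * g 1 0.
Proof.
rewrite (expand_det_row _ 0) big_ord_recl big_ord1 /cofactor !det_mx11 !mxE /=.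
rewrite expr0 mul1r expr1 mulN1r mulrN.
by congr (_ * g _ _ - g _ _ * g _ _); apply: val_inj.
Qed.

Lemma inv2 g : \det g = 1 ->
  [/\ invmx g 0 0 = g 1 1, invmx g 0 1 = - g 0 1,
      invmx g 1 0 = - g 1 0 & invmx g 1 1 = g 0 0].
Proof.
move=> dg; have ug : g \in unitmx by rewrite unitmxE dg unitr1.
pose h : 'M[F]_2 := \matrix_(i, j)
  (if i == j then if i == 0 then g 1 1 else g 0 0 else - g i j).
have gh : g *m h = 1%:M.
  move: dg; rewrite det2E => dg; apply/matrixP => i j.
  rewrite mul2E !mxE; case: (ord2 i) => ->; case: (ord2 j) => -> /=.
  - by rewrite mulrN dg.
  - by ring.
  - by ring.
  - by rewrite -dg; ring.
have -> : invmx g = h by rewrite -[LHS]mulmx1 -gh mulKmx.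
by rewrite !mxE.
Qed.

Lemma invmx_det1 g : \det g = 1 -> \det (invmx g) = 1.
Proof. by move=> dg; rewrite det_inv dg invr1. Qed.

Lemma unit_det1 g : \det g = 1 -> g \in unitmx.
Proof. by move=> dg; rewrite unitmxE dg unitr1. Qed.

Lemma invmxM g h : \det g = 1 -> \det h = 1 ->
  invmx (g *m h) = invmx h *m invmx g.
Proof.
move=> dg dh; have [ug uh] := (unit_det1 dg, unit_det1 dh).
have e : (g *m h) *m (invmx h *m invmx g) = 1%:M.
  by rewrite mulmxA -(mulmxA g) mulmxV // mulmx1 mulmxV.
by rewrite -[LHS]mulmx1 -e mulKmx // unitmx_mul ug.
Qed.

Lemma den_mul g h x : den h x != 0 ->
  den (g *m h) x = den g (moeb h x) * den h x.
Proof. by rewrite /den /moeb !mul2E => h0; field. Qed.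

Lemma num_mul g h x : den h x != 0 ->
  num (g *m h) x = num g (moeb h x) * den h x.
Proof. by rewrite /den /num /moeb !mul2E => h0; field. Qed.

Lemma moeb_mul g h x : den h x != 0 -> moeb (g *m h) x = moeb g (moeb h x).
Proof.
move=> h0; rewrite {1}/moeb -[_ + (g *m h) 0 1]/(num _ x) -[_ + (g *m h) 1 1]/(den _ x).
by rewrite num_mul // den_mul // -mulf_div divff ?mulr1.
Qed.

Lemma den1 x : den 1%:M x = 1.
Proof. by rewrite /den !mxE /= mul0r add0r. Qed.

Lemma moeb1 x : moeb 1%:M x = x.
Proof. by rewrite /moeb !mxE /= mul0r add0r divr1 mul1r addr0. Qed.

Lemma moebK g x : \det g = 1 -> den g x != 0 -> moeb (invmx g) (moeb g x) = x.
Proof.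
by move=> dg x0; rewrite -moeb_mul // mulVmx ?unit_det1 // moeb1.
Qed.

Lemma den_pole g x : g 1 0 != 0 -> den g x = g 1 0 * (x - pole g).
Proof. by rewrite /den /pole => c0; field. Qed.

Lemma moeb_image_infty g x : \det g = 1 -> g 1 0 != 0 -> den g x != 0 ->
  moeb g x - image_infty g = - (g 1 0 * den g x)^-1.
Proof.
rewrite det2E /moeb /image_infty -/(den g x) => dg c0 x0.
have -> : (g 1 0 * den g x)^-1 =
  (g 0 0 * g 1 1 - g 0 1 * g 1 0) / (g 1 0 * den g x) by rewrite dg div1r.
by rewrite /den in x0 *; field; rewrite x0 c0.
Qed.

Lemma pole_inv g : \det g = 1 -> pole g = image_infty (invmx g).
Proof.
by move=> /inv2 [e0 _ e2 _]; rewrite /pole /image_infty e0 e2 invrN mulNr mulrN.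
Qed.

Lemma image_infty_inv g : \det g = 1 -> image_infty g = pole (invmx g).
Proof. by move=> dg; rewrite pole_inv ?invmx_det1 // invmxK. Qed.

Lemma lower_left_mul g h : h 1 0 != 0 ->
  (g *m h) 1 0 = h 1 0 * den g (image_infty h).
Proof. by rewrite mul2E /den /image_infty => h0; field. Qed.

Lemma upper_left_mul g h : h 1 0 != 0 ->
  (g *m h) 0 0 = h 1 0 * num g (image_infty h).
Proof. by rewrite mul2E /num /image_infty => h0; field. Qed.

Lemma image_infty_mul g h : h 1 0 != 0 ->
  image_infty (g *m h) = moeb g (image_infty h).
Proof.
move=> h0; rewrite {1}/image_infty lower_left_mul // upper_left_mul //.
by rewrite -mulf_div divff // mul1r.
Qed.

(** The lower left entry of g h^-1 measures how far apart g and h send infinity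
    backwards: this identity is what makes the poles of distinct group elements
    separated. *)
Lemma lower_left_quot g h : \det h = 1 -> g 1 0 != 0 -> h 1 0 != 0 ->
  (g *m invmx h) 1 0 = g 1 0 * h 1 0 * (pole h - pole g) * -1.
Proof.
by move=> /inv2[e0 e1 e2 e3] g0 h0; rewrite mul2E e0 e2 /pole; field; rewrite g0 h0.
Qed.

End moebius.

Section schottky_words.
Context {R : realType}.

(** The ping-pong data of a Schottky group on the real line, with two
    constants: disks with distinct labels are at distance at least [gap], and all
    disks lie in [-bnd, bnd]. *)
Record pingpong := PingPong {
  letter :> finType;
  bar : letter -> letter;
  ctr : letter -> R;
  rad : letter -> R;
  gen : letter -> 'M[R]_2;
  gap : R;
  bnd : R;
  disk := fun a x => `|x - ctr a| <= rad a;
  some_letter : letter;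
  barK : involutive bar;
  third_letter : forall a b : letter, exists c : letter, c != a /\ c != b;
  det_gen : forall a, \det (gen a) = 1;
  gen_bar : forall a, gen (bar a) = invmx (gen a);
  gap_gt0 : 0 < gap;
  gap_le1 : gap <= 1;
  gap_rad : forall a, gap <= rad a;
  bnd_ge1 : 1 <= bnd;
  disk_gap : forall (a b : letter) x y, a != b -> disk a x -> disk b y -> gap <= `|x - y|;
  disk_bnd : forall a x, disk a x -> `|x| <= bnd;
  gen_infty : forall a, gen a 1 0 != 0 /\ disk a (image_infty (gen a));
  gen_disk : forall a x, ~~ disk (bar a) x ->
    den (gen a) x != 0 /\ disk a (moeb (gen a) x)
}.

Variable G : pingpong.
Implicit Types (a b : G) (u v w : seq G) (x y : R).

Lemma disk_disjoint a b x : a != b -> disk a x -> ~~ disk b x.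
Proof.
move=> ab ax; apply/negP => bx; have := disk_gap ab ax bx.
by rewrite subrr normr0 leNgt gap_gt0.
Qed.

Lemma bar_inj : injective (@bar G).
Proof. exact: inv_inj (@barK G). Qed.

(** The head of a word is its last letter, so that the children of a word in the
    tree of words are obtained by consing. *)
Fixpoint wmat w : 'M[R]_2 := if w is b :: u then wmat u *m gen b else 1%:M.

Definition reduced w := sorted (fun b a => b != bar a) w.

Definition winv w := rev (map (@bar G) w).

Lemma det_wmat w : \det (wmat w) = 1.
Proof. by elim: w => [|b u IH] /=; rewrite ?det1 // det_mulmx IH det_gen mulr1. Qed.

Lemma wmat_rcons w a : wmat (rcons w a) = gen a *m wmat w.
Proof.
elim: w => [|b u IH] /=; first by rewrite mul1mx mulmx1.
by rewrite IH mulmxA.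
Qed.

Lemma wmat_inv w : wmat (winv w) = invmx (wmat w).
Proof.
elim: w => [|b u IH]; first by rewrite /= invmx1.
rewrite /winv /= rev_cons wmat_rcons -/(winv u) IH gen_bar.
by rewrite invmxM ?det_wmat ?det_gen.
Qed.

Lemma winvK : involutive winv.
Proof. by move=> w; rewrite /winv map_rev revK mapK //; exact: barK. Qed.

Lemma reduced_inv w : reduced (winv w) = reduced w.
Proof.
rewrite /reduced /winv rev_sorted sorted_map; case: w => //= b u.
by apply: eq_path => x y /=; rewrite barK eq_sym.
Qed.

Lemma reduced_behead b u : reduced (b :: u) -> reduced u.
Proof. exact: path_sorted. Qed.

Lemma winv_cons b u : exists c v, winv (b :: u) = c :: v /\ last c v = bar b.
Proof.
rewrite /winv /= rev_cons; case: (rev _) => [|c v] /=.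
  by exists (bar b), [::].
by exists c, (rcons v (bar b)); rewrite last_rcons.
Qed.

(** Ping-pong: a reduced word maps the complement of one disk into another. *)
Lemma wmat_disk b u x : reduced (b :: u) -> ~~ disk (bar b) x ->
  den (wmat (b :: u)) x != 0 /\ disk (last b u) (moeb (wmat (b :: u)) x).
Proof.
elim: u b x => [|a u IH] b x.
  by move=> _ /gen_disk; rewrite /= mul1mx.
move=> /= /andP[ba ru] /gen_disk[d0 db].
have [d1 d2] := IH a (moeb (gen b) x) ru (disk_disjoint ba db).
split; first by rewrite den_mul // mulf_neq0.
by rewrite moeb_mul.
Qed.

Lemma wmat_infty b u : reduced (b :: u) ->
  wmat (b :: u) 1 0 != 0 /\ disk (last b u) (image_infty (wmat (b :: u))).
Proof.
have [c0 dc] := gen_infty b.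
case: u => [|a u]; first by rewrite /= mul1mx.
move=> /= /andP[ba ru].
have [d1 d2] := wmat_disk ru (disk_disjoint ba dc).
split; first by rewrite lower_left_mul // mulf_neq0.
by rewrite image_infty_mul.
Qed.

Lemma wmat_pole b u : reduced (b :: u) -> disk (bar b) (pole (wmat (b :: u))).
Proof.
move=> ru; rewrite pole_inv ?det_wmat // -wmat_inv.
have [c [v [e le]]] := winv_cons b u.
rewrite e -le; apply: (wmat_infty _).2.
by rewrite -e reduced_inv.
Qed.

Lemma far_point a : ~~ disk a (bnd G + 1).
Proof.
have b1 := bnd_ge1 G.
by apply/negP => /disk_bnd; rewrite ger0_norm; lra.
Qed.

Definition cmin := (2 * bnd G + 1)^-1.

Lemma cmin_gt0 : 0 < cmin.
Proof. by rewrite invr_gt0; have := bnd_ge1 G; lra. Qed.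

(** Compare the images of infinity and of a point near but outside the disks: both
    are in one disk, while their distance is 1 / (c^2 |x - p|) for the pole p. *)
Lemma wmat_lower_left b u : reduced (b :: u) -> cmin <= `|wmat (b :: u) 1 0|.
Proof.
move=> ru; set g := wmat _; have b1 := bnd_ge1 G.
have [c0 dq] := wmat_infty ru; have dp := wmat_pole ru.
have [d0 dx] := wmat_disk ru (far_point (bar b)).
have e := moeb_image_infty (det_wmat (b :: u)) c0 d0.
have h1 : `|moeb g (bnd G + 1) - image_infty g| <= 2 * bnd G.
  apply: le_trans (ler_normB _ _) _.
  have := disk_bnd dx; have := disk_bnd dq; rewrite -/g; lra.
have h2 : `|bnd G + 1 - pole g| <= 2 * bnd G + 1.
  apply: le_trans (ler_normB _ _) _.
  by have := disk_bnd dp; rewrite -/g [`|bnd G + 1|]ger0_norm; lra.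
rewrite -/g in e c0 d0.
move: h1; rewrite e normrN normfV den_pole // mulrA !normrM => h1.
have c0' : 0 < `|g 1 0| by rewrite normr_gt0.
have p0 : 0 < `|bnd G + 1 - pole g|.
  by rewrite normr_gt0; move: d0; rewrite den_pole // mulf_eq0 negb_or => /andP[].
rewrite /cmin -[leRHS]invrK lef_pV2 ?posrE ?invr_gt0 //; last by lra.
set k := `|g 1 0| in h1 c0' *; set p := `|_ - _| in h1 h2 p0.
have h3 : 1 <= 2 * bnd G * (k * k * p).
  by rewrite -ler_pdivrMr ?mulr_gt0 // div1r.
rewrite -(@ler_pM2r _ k) // mulVf ?gt_eqF //.
have h4 : 1 <= ((2 * bnd G + 1) * k) ^+ 2.
  apply: le_trans h3 _; have -> : ((2 * bnd G + 1) * k) ^+ 2 =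
    (2 * bnd G + 1) * ((k * k) * (2 * bnd G + 1)) by ring.
  apply: ler_pM => //.
  - lra.
  - by rewrite !mulr_ge0 // ltW.
  - lra.
  by rewrite ler_wpM2l // mulr_ge0 // ltW.
by rewrite -(@ler_pXn2r _ 2) ?nnegrE ?ler01 ?mulr_ge0 ?(ltW c0') ?expr1n //; lra.
Qed.

Definition csep := cmin ^+ 2 * gap G.

Lemma csep_gt0 : 0 < csep.
Proof. by rewrite mulr_gt0 ?exprn_gt0 ?cmin_gt0 ?gap_gt0. Qed.

Lemma csep_le : csep <= cmin.
Proof.
rewrite /csep expr2 -mulrA ger_pMr ?cmin_gt0 // mulr_ile1 ?gap_le1 //.
- exact/ltW/cmin_gt0.
- exact/ltW/gap_gt0.
- rewrite /cmin invf_le1; have := bnd_ge1 G; lra.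
Qed.

(** Discreteness of the group, in the form needed here: away from the identity
    the lower left entries are bounded below, because infinity is not in any
    disk. *)
Lemma quot_lower_left u v : reduced u -> reduced v -> u != v ->
  csep <= `|(wmat u *m invmx (wmat v)) 1 0|.
Proof.
elim: u v => [|b u IH] [|c v] //.
- move=> _ rv _; rewrite mul1mx; have [_ _ -> _] := inv2 (det_wmat (c :: v)).
  by rewrite normrN (le_trans csep_le) // wmat_lower_left.
- move=> ru _ _; rewrite [wmat [::]]/= invmx1 mulmx1.
  by rewrite (le_trans csep_le) // wmat_lower_left.
move=> ru rv uv; have [bc|bc] := eqVneq b c.
  subst c; rewrite /= invmxM ?det_wmat ?det_gen // mulmxA.
  rewrite -(mulmxA (wmat u)) mulmxV ?unit_det1 ?det_gen // mulmx1.
  apply: IH; rewrite ?(reduced_behead ru) ?(reduced_behead rv) //.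
  by apply: contra_neq uv => ->.
have [u0 _] := wmat_infty ru; have [v0 _] := wmat_infty rv.
rewrite lower_left_quot ?det_wmat // mulrN1 normrN !normrM /csep expr2.
apply: ler_pM; rewrite ?mulr_ge0 ?(ltW cmin_gt0) ?(ltW (gap_gt0 _)) //.
  by apply: ler_pM; rewrite ?(ltW cmin_gt0) ?wmat_lower_left.
have := disk_gap _ (wmat_pole rv) (wmat_pole ru); apply.
by rewrite (inj_eq bar_inj) eq_sym.
Qed.

(** The poles of two group elements of size tau are at distance at least
    about tau: this
    replaces the non-concentration estimates of the general theory. *)
Lemma pole_sep b u c v : reduced (b :: u) -> reduced (c :: v) -> b :: u != c :: v ->
  csep <= `|wmat (b :: u) 1 0| * `|wmat (c :: v) 1 0| *
          `|pole (wmat (b :: u)) - pole (wmat (c :: v))|.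
Proof.
move=> ru rv uv; have := quot_lower_left ru rv uv.
have [u0 _] := wmat_infty ru; have [v0 _] := wmat_infty rv.
by rewrite lower_left_quot ?det_wmat // mulrN1 normrN !normrM distrC.
Qed.

Lemma image_infty_sep b u c v :
  reduced (b :: u) -> reduced (c :: v) -> b :: u != c :: v ->
  csep <= `|wmat (b :: u) 1 0| * `|wmat (c :: v) 1 0| *
          `|image_infty (wmat (b :: u)) - image_infty (wmat (c :: v))|.
Proof.
move=> ru rv uv.
have [b' [u' [eu _]]] := winv_cons b u; have [c' [v' [ev _]]] := winv_cons c v.
have := @pole_sep b' u' c' v'; rewrite -eu -ev !reduced_inv => /(_ ru rv).
rewrite (inj_eq (inv_inj winvK)) => /(_ uv).
rewrite !wmat_inv !image_infty_inv ?det_wmat //.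
have [_ _ -> _] := inv2 (det_wmat (b :: u)).
by have [_ _ -> _] := inv2 (det_wmat (c :: v)); rewrite !normrN.
Qed.

Definition cmax := \sum_(a : G) `|gen a 1 0|.

(* [2 * bnd] bounds the distance between two points of the disks *)
Lemma wmat_child b a u : reduced (b :: a :: u) ->
  `|wmat (b :: a :: u) 1 0| <= cmax * (2 * bnd G) * `|wmat (a :: u) 1 0|.
Proof.
move=> ru; have ra := reduced_behead ru.
have [c0 dc] := gen_infty b; have [u0 _] := wmat_infty ra.
rewrite [wmat _]/= -/(wmat (a :: u)) lower_left_mul // den_pole //.
rewrite !normrM mulrA [leLHS]mulrC [leRHS]mulrC mulrC -!mulrA.
rewrite [`|gen b 1 0| * _]mulrCA ler_wpM2l //.
apply: ler_pM => //.
  by rewrite /cmax (bigD1 b) //= lerDl sumr_ge0.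
apply: le_trans (ler_normB _ _) _.
by have := disk_bnd dc; have := disk_bnd (wmat_pole ra); lra.
Qed.

End schottky_words.

Arguments pingpong : clear implicits.

(** * Stopping sections of the tree of words *)

Section stopping_tree.
Context {R : realType}.

Lemma separated_count (T : eqType) (s : seq T) (f : T -> R) (y ell t : R) :
  uniq s -> 0 < t -> 0 <= ell ->
  {in s, forall i, `|f i - y| <= ell} ->
  {in s &, forall i j, i != j -> t <= `|f i - f j|} ->
  (size s)%:R <= 2 * ell / t + 1.
Proof.
move=> us t0 ell0 fy fs.
pose h i := Num.truncn ((f i - y + ell) / t).
have h0 i : i \in s -> 0 <= (f i - y + ell) / t.
  by move=> /fy; rewrite ler_norml => /andP[? ?]; apply: divr_ge0; lra.
have hinj : {in s &, injective h}.
  move=> i j si sj hij; apply/eqP; case: eqP => // /eqP ij.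
  have := fs i j si sj ij; rewrite leNgt; suff -> : `|f i - f j| < t by [].
  have /andP[] := truncn_itv (h0 i si); have /andP[] := truncn_itv (h0 j sj).
  rewrite -/(h i) -/(h j) hij !ler_pdivlMr // !ltr_pdivrMr //.
  rewrite -(natr1 (h j)) mulrDl mul1r => a1 a2 a3 a4.
  by rewrite ltr_norml; apply/andP; split; lra.
have : (size (map h s) <= size (iota 0 (Num.truncn (2 * ell / t)).+1))%N.
  apply: uniq_leq_size; first by rewrite map_inj_in_uniq.
  move=> k /mapP[i si ->]; rewrite mem_iota add0n /= ltnS /h.
  apply: le_truncn; rewrite ler_pM2r ?invr_gt0 //.
  by have := fy i si; rewrite ler_norml => /andP[? ?]; lra.
rewrite size_map size_iota -(ler_nat R) => /le_trans; apply.
by rewrite -natr1 lerD2r truncn_le divr_ge0 ?mulr_ge0 // ltW.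
Qed.

Variable G : pingpong R.
Implicit Types (a b : G) (u v w : seq G).

Definition proper w := (w != [::]) && reduced w.

Variable tau : R.
Hypothesis tau01 : 0 < tau <= 1.

Let tau0 : 0 < tau. Proof. by case/andP: tau01. Qed.

(** Away from its pole, an element with lower left entry c has derivative of order
    c^-2, so a word is stopped once it contracts at least to size tau; it is live
    when none of its initial pieces is stopped. *)
Definition stopped w := 1 <= tau * (wmat w 1 0) ^+ 2.

Fixpoint live w := if w is b :: u then ~~ stopped w && live u else true.

Let live_drop w i : (i < size w)%N -> live w -> ~~ stopped (drop i w).
Proof.
elim: w i => // b u IH [|i] /=; first by move=> _ /andP[].
by rewrite ltnS => iu /andP[_]; exact: IH.
Qed.

Lemma drop_proper w i : reduced w -> (i < size w)%N -> proper (drop i w).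
Proof.
move=> rw iw; rewrite /proper -size_eq0 size_drop subn_eq0 -ltnNge iw /=.
elim: i w rw iw => [|i IH] [|b u] // /reduced_behead ru iu /=; exact: IH.
Qed.

Lemma properE w : proper w -> exists b u, w = b :: u /\ reduced (b :: u).
Proof. by case: w => // b u /andP[_ ru]; exists b, u. Qed.

(** Only finitely many reduced words have not contracted to size tau: their
    poles are separated and stay in a bounded interval. *)
Lemma live_bound : exists N, forall w, reduced w -> live w -> (size w <= N)%N.
Proof.
have c0 := csep_gt0 G; have b1 := bnd_ge1 G.
have t0 : 0 < csep G * tau by rewrite mulr_gt0.
exists (Num.truncn (2 * bnd G / (csep G * tau) + 1)) => w rw lw.
rewrite truncn_ge_nat; last by rewrite addr_ge0 ?divr_ge0 ?(ltW t0) //; lra.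
rewrite -{1}(size_iota 0 (size w)).
apply: (@separated_count _ _ (fun i => pole (wmat (drop i w))) 0); rewrite ?iota_uniq //.
- lra.
- move=> i; rewrite mem_iota add0n /= => iw; rewrite subr0.
  have [b [u [-> ru]]] := properE (drop_proper rw iw).
  exact: disk_bnd (wmat_pole ru).
move=> i j; rewrite !mem_iota !add0n /= => iw jw ij.
have wij : drop i w != drop j w.
  apply: contraNneq ij => /(congr1 size); rewrite !size_drop.
  move=> e; apply/eqP; rewrite -(subKn (ltnW iw)) e subKn //; exact: ltnW.
have := live_drop iw lw; have := live_drop jw lw.
have [b [u [eb ru]]] := properE (drop_proper rw iw).
have [c [v [ec rv]]] := properE (drop_proper rw jw).
rewrite eb ec in wij *.
have := pole_sep ru rv wij; set p := `|pole _ - _|.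
rewrite /stopped -!ltNge -(real_normK (num_real (wmat (b :: u) 1 0))).
rewrite -(real_normK (num_real (wmat (c :: v) 1 0))).
set x := `|wmat (b :: u) 1 0|; set y := `|wmat (c :: v) 1 0| => h1 h2 h3.
have x0 : 0 <= x by exact: normr_ge0.
have y0 : 0 <= y by exact: normr_ge0.
have xy : tau * (x * y) <= 1.
  have : x * y <= (x ^+ 2 + y ^+ 2) / 2 by have := sqr_ge0 (x - y); rewrite sqrrB; lra.
  rewrite -(ler_pM2l tau0); lra.
have p0 : 0 <= p by exact: normr_ge0.
rewrite mulrC; apply: (le_trans (ler_wpM2l (ltW tau0) h1)).
by rewrite mulrA -[leRHS]mul1r ler_wpM2r.
Qed.

(** By how much the square of the lower left entry can grow with one letter. *)
Definition kappa := (cmax G * (2 * bnd G)) ^+ 2.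

Definition tree_additive (Phi : seq G -> R) := forall a u, reduced (a :: u) ->
  Phi (a :: u) = \sum_(b | b != bar a) Phi (b :: a :: u).

Let good (L : seq (seq G)) := uniq L /\
  {in L, forall v, [/\ proper v, 1 <= tau * (wmat v 1 0) ^+ 2
    & tau * (wmat v 1 0) ^+ 2 <= kappa]}.

Let below w (L : seq (seq G)) := good L /\ {in L, forall v, suffix w v} /\
  forall Phi, tree_additive Phi -> Phi w = \sum_(v <- L) Phi v.

Let good_children u (cs : pred G) :
  (forall b, cs b -> exists L, below (b :: u) L) ->
  exists L, good L /\ {in L, forall v, suffix u v} /\
  forall Phi, tree_additive Phi ->
    \sum_(b | cs b) Phi (b :: u) = \sum_(v <- L) Phi v.
Proof.
move=> H.
have /choice[Lf HL] : forall b, exists L, cs b -> below (b :: u) L.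
  move=> b; have [/H[L ?]|] := boolP (cs b); first by exists L.
  by exists [::].
pose s := [seq b <- enum G | cs b].
have sE b : b \in s -> cs b by rewrite mem_filter => /andP[].
exists [seq v | b <- s, v <- Lf b]; split; [split|split].
- apply: allpairs_uniq_dep; first by rewrite filter_uniq ?enum_uniq.
    by move=> b /sE /HL[[]].
  move=> p q /allpairsPdep[b [v [sb vb ->]]] /allpairsPdep[c [v' [sc vc ->]]] /= vv'.
  have sbv := (HL b (sE b sb)).2.1 _ vb; have scv := (HL c (sE c sc)).2.1 _ vc.
  subst v'; suff -> : b = c by [].
  move: sbv scv; rewrite !suffixE /= => /eqP e1 /eqP e2.
  by move: e1; rewrite e2 => -[].
- by move=> _ /allpairsPdep[b [v [/sE sb vb ->]]]; exact: (HL b sb).1.2.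
- move=> _ /allpairsPdep[b [v [/sE sb vb ->]]].
  have := (HL b sb).2.1 _ vb; exact: (suffix_trans (suffix_cons _ _)).
- move=> Phi aP; rewrite big_allpairs_dep /= /s big_filter big_enum_cond /=.
  by apply: eq_bigr => b sb; exact: (HL b sb).2.2.
Qed.

Let wmat_letter a : tau * (wmat [:: a] 1 0) ^+ 2 <= kappa.
Proof.
have b1 := bnd_ge1 G; case/andP: tau01 => _ t1.
rewrite /= mul1mx /kappa -[leRHS]mul1r; apply: ler_pM; rewrite ?sqr_ge0 ?(ltW tau0) //.
rewrite -(real_normK (num_real (gen a 1 0))) ler_pXn2r ?nnegrE //; last first.
  by rewrite mulr_ge0 ?sumr_ge0 //; lra.
have ga : `|gen a 1 0| <= cmax G by rewrite /cmax (bigD1 a) //= lerDl sumr_ge0.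
apply: le_trans ga _; rewrite ler_peMr ?sumr_ge0 //; lra.
Qed.

Let leaf b u : reduced (b :: u) -> live u -> stopped (b :: u) ->
  below (b :: u) [:: b :: u].
Proof.
move=> ru lu st; split; last first.
  split; first by move=> v; rewrite inE => /eqP ->; exact: suffix_refl.
  by move=> Phi _; rewrite big_seq1.
split=> // v; rewrite inE => /eqP ->; split => //.
case: u ru lu {st} => [|a u] ru; first by move=> _; exact: wmat_letter.
case/andP; rewrite /stopped -ltNge => la _.
rewrite -(real_normK (num_real (wmat (b :: a :: u) 1 0))).
apply: (@le_trans _ _ (tau * (cmax G * (2 * bnd G) * `|wmat (a :: u) 1 0|) ^+ 2)).
  rewrite ler_pM2l // ler_pXn2r ?nnegrE // ?wmat_child //.
  by rewrite !mulr_ge0 ?sumr_ge0 //; have := bnd_ge1 G; lra.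
rewrite exprMn -/kappa real_normK ?num_real // mulrCA ger_pMr; last first.
  rewrite exprn_gt0 // mulr_gt0 //; last by have := bnd_ge1 G; lra.
  rewrite /cmax (bigD1 a) //= ltr_wpDr ?sumr_ge0 // normr_gt0.
  exact: (gen_infty a).1.
exact: ltW.
Qed.

Let subtree N : (forall w, reduced w -> live w -> (size w <= N)%N) ->
  forall n b u, reduced (b :: u) -> live u -> (N < size (b :: u) + n)%N ->
  exists L, below (b :: u) L.
Proof.
move=> HN; elim=> [|n IH] b u ru lu Nn; have [st|nst] := boolP (stopped (b :: u)).
- by exists [:: b :: u]; exact: leaf.
- have := HN _ ru; rewrite /= nst lu => /(_ isT).
  by move: Nn; rewrite addn0 ltnNge /= => /negPf ->.
- by exists [:: b :: u]; exact: leaf.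
have [|L [gL [sL aL]]] := @good_children (b :: u) (fun c => c != bar b).
  move=> c cb; apply: IH; first by rewrite /reduced /= cb.
    by rewrite /= nst.
  by move: Nn; rewrite /= !addSn addnS.
by exists L; split => //; split => // Phi aP; rewrite aP // aL.
Qed.

(** A section of the tree of words by those at which the derivative is first of
    size tau. Additive functions on the tree include any integral over the
    cylinders, so the last clause says that the cylinders of the section form a
    partition. *)
Lemma stopping_section : exists L : seq (seq G),
  [/\ uniq L,
      {in L, forall v, [/\ proper v, 1 <= tau * (wmat v 1 0) ^+ 2
        & tau * (wmat v 1 0) ^+ 2 <= kappa]}
    & forall Phi, tree_additive Phi ->
        \sum_a Phi [:: a] = \sum_(v <- L) Phi v].
Proof.
have [N HN] := live_bound.
have [|L [[uL gL] [_ aL]]] := @good_children [::] predT; last by exists L.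
by move=> b _; apply: (subtree HN (n := N)).
Qed.

End stopping_tree.

(** * Conformal densities *)

Section bounded_measurable.
Context {R : realType}.
Implicit Types (f g : R -> R) (p q : R -> bool).

Definition bmf f := measurable_fun setT f /\ exists M : R, forall x, `|f x| <= M.

Lemma bmf_cst (c : R) : bmf (fun=> c).
Proof. by split; [exact: measurable_cst | exists `|c|]. Qed.

Lemma bmfD f g : bmf f -> bmf g -> bmf (fun x => f x + g x).
Proof.
move=> [mf [M fM]] [mg [N gN]]; split; first exact: measurable_funD.
by exists (M + N) => x; rewrite (le_trans (ler_normD _ _)) ?lerD.
Qed.

Lemma bmfM f g : bmf f -> bmf g -> bmf (fun x => f x * g x).
Proof.
move=> [mf [M fM]] [mg [N gN]]; split; first exact: measurable_funM.
by exists (M * N) => x; rewrite normrM ler_pM.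
Qed.

Lemma bmfZ c f : bmf f -> bmf (fun x => c * f x).
Proof. exact/bmfM/bmf_cst. Qed.

Lemma bmf_sum (I : Type) (s : seq I) (F : I -> R -> R) :
  (forall i, bmf (F i)) -> bmf (fun x => \sum_(i <- s) F i x).
Proof.
move=> FI; elim: s => [|i s IH].
  by under eq_fun do rewrite big_nil; exact: bmf_cst.
by under eq_fun do rewrite big_cons; exact: bmfD.
Qed.

Lemma bmf_ind p : measurable_fun setT p -> bmf (fun x => (p x)%:R).
Proof.
move=> mp; split; last by exists 1 => x; case: (p x); rewrite ?normr1 ?normr0.
have -> : (fun x => (p x)%:R) = (fun x => if p x then 1 else 0 : R).
  by apply/funext => x; case: (p x).
by apply: measurable_fun_ifT => //; exact: measurable_cst.
Qed.

Lemma bmf_comp f g : bmf f -> measurable_fun setT g -> bmf (fun x => f (g x)).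
Proof.
move=> [mf [M fM]] mg; split; last by exists M.
exact: (measurableT_comp mf mg).
Qed.

Lemma bmf_cont f M : continuous f -> (forall x, `|f x| <= M) -> bmf f.
Proof. by move=> cf fM; split; [exact: continuous_measurable_fun | exists M]. Qed.

Lemma bmf_cos (s : R) : bmf (fun x => cos (s * x)).
Proof.
apply: (bmf_cont (M := 1)) => [x|x]; last by rewrite ler_norml cos_geN1 cos_le1.
apply: (continuous_comp (g := @cos R)); last exact: continuous_cos.
exact: mulrl_continuous.
Qed.

Lemma bmf_sin (s : R) : bmf (fun x => sin (s * x)).
Proof.
apply: (bmf_cont (M := 1)) => [x|x]; last by rewrite ler_norml sin_geN1 sin_le1.
apply: (continuous_comp (g := @sin R)); last exact: continuous_sin.
exact: mulrl_continuous.
Qed.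

Lemma measurable_inv : measurable_fun setT (fun x : R => x^-1).
Proof.
have -> : (fun x : R => x^-1) = (fun x => x * (x ^+ 2) `^ (-1)).
  apply/funext => x; rewrite powR_inv1 ?sqr_ge0 //.
  have [->|x0] := eqVneq x 0; first by rewrite invr0 mul0r.
  by field.
apply: measurable_funM; first exact: measurable_id.
by apply: (measurableT_comp (measurable_powR _)); exact: exprn_measurable.
Qed.

Lemma measurable_affine (a b : R) : measurable_fun setT (fun x : R => a * x + b).
Proof.
apply: measurable_funD; last exact: measurable_cst.
by apply: measurable_funM; [exact: measurable_cst | exact: measurable_id].
Qed.

Lemma measurable_moeb (g : 'M[R]_2) : measurable_fun setT (moeb g).
Proof.
apply: measurable_funM; first exact: measurable_affine.
by apply: (measurableT_comp measurable_inv); exact: measurable_affine.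
Qed.

Lemma measurable_dist (c r : R) : measurable_fun setT (fun x : R => `|x - c| <= r).
Proof.
apply: measurable_fun_ler; last exact: measurable_cst.
apply: (measurableT_comp (@normr_measurable _ setT)).
by apply: measurable_funB; [exact: measurable_id | exact: measurable_cst].
Qed.

End bounded_measurable.

Section weights.
Context {R : realType}.
Variable delta : R.
Hypothesis delta01 : 0 < delta < 1.
Implicit Types (g : 'M[R]_2).

Let delta0 : 0 <= delta. Proof. by case/andP: delta01 => /ltW. Qed.
Let delta1 : delta <= 1. Proof. by case/andP: delta01 => _ /ltW. Qed.

(** The derivative for the spherical metric, in a form without poles. *)
Definition sphder g x := (1 + x ^+ 2) / (num g x ^+ 2 + den g x ^+ 2).

Definition weight g x := sphder g x `^ delta.

Lemma sphder_le g x : \det g = 1 ->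
  0 < num g x ^+ 2 + den g x ^+ 2 /\
  0 <= sphder g x <= g 0 0 ^+ 2 + g 0 1 ^+ 2 + g 1 0 ^+ 2 + g 1 1 ^+ 2.
Proof.
rewrite det2E => dg; set S := _ + g 1 1 ^+ 2; set Q := num g x ^+ 2 + _.
have Q0 : 0 <= Q by rewrite addr_ge0 ?sqr_ge0.
have h : 1 + x ^+ 2 <= S * Q.
  have e1 : x = x * (g 0 0 * g 1 1 - g 0 1 * g 1 0) by rewrite dg mulr1.
  have e2 : x = g 1 1 * num g x - g 0 1 * den g x by rewrite {1}e1 /num /den; ring.
  have e3 : 1 = g 0 0 * den g x - g 1 0 * num g x by rewrite -dg /num /den; ring.
  have -> : 1 + x ^+ 2 = (g 0 0 * den g x - g 1 0 * num g x) ^+ 2 +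
      (g 1 1 * num g x - g 0 1 * den g x) ^+ 2 by rewrite -e2 -e3 expr1n.
  rewrite /S /Q -subr_ge0.
  move: (num g x) (den g x) => n d; set r := (X in 0 <= X).
  have -> : r = (g 1 1 * d + g 0 1 * n) ^+ 2 + (g 0 0 * n + g 1 0 * d) ^+ 2.
    by rewrite /r; ring.
  by rewrite addr_ge0 ?sqr_ge0.
have Q1 : 0 < Q.
  rewrite lt_neqAle Q0 andbT eq_sym; apply: contraTneq h => ->.
  by rewrite mulr0 -ltNge ltr_pwDl ?sqr_ge0.
split => //; rewrite /sphder -/Q divr_ge0 //=; last by rewrite addr_ge0 ?sqr_ge0.
by rewrite ler_pdivrMr.
Qed.

Lemma bmf_weight g : \det g = 1 -> bmf (weight g).
Proof.
move=> dg; set S := g 0 0 ^+ 2 + g 0 1 ^+ 2 + g 1 0 ^+ 2 + g 1 1 ^+ 2.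
split; last first.
  exists (S `^ delta) => x; rewrite ger0_norm ?powR_ge0 //.
  have [_ /andP[h0 h1]] := sphder_le x dg.
  by apply: ge0_ler_powR => //; rewrite nnegrE // (le_trans h0).
apply: (measurableT_comp (measurable_powR _)).
apply: measurable_funM.
  apply: measurable_funD; first exact: measurable_cst.
  exact: exprn_measurable.
apply: (measurableT_comp measurable_inv).
by apply: measurable_funD; apply: measurable_funX; exact: measurable_affine.
Qed.

Lemma weight_ge0 g x : 0 <= weight g x.
Proof. exact: powR_ge0. Qed.

Lemma sphderE g x : den g x != 0 ->
  sphder g x = (1 + x ^+ 2) / (den g x ^+ 2 * (1 + moeb g x ^+ 2)).
Proof.
move=> d0; rewrite /sphder /moeb -/(num g x) -/(den g x).
by congr (_ / _); field.
Qed.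

End weights.

(** What is used of the Patterson-Sullivan measure: a positive normalised
    functional on bounded Borel functions that only depends on the values on the
    limit set and transforms by the weights. *)
Record conformal_density (R : realType) (G : pingpong R) (delta : R) := ConformalDensity {
  lim : set R;
  integ : (R -> R) -> R;
  lim_disk : forall x, lim x -> exists a : G, disk a x;
  lim_back : forall x (a : G), lim x -> disk a x ->
    ~~ disk (bar a) (moeb (gen (bar a)) x);
  lim_wmat : forall (w : seq G) x, lim x ->
    den (wmat w) x != 0 /\ lim (moeb (wmat w) x);
  integ_lin : forall k f g, bmf f -> bmf g ->
    integ (fun x => k * f x + g x) = k * integ f + integ g;
  integ_le : forall f g, bmf f -> bmf g ->
    (forall x, lim x -> f x <= g x) -> integ f <= integ g;
  integ1 : integ (fun=> 1) = 1;
  integ_conformal : forall (w : seq G) f, bmf f ->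
    integ f = integ (fun x => f (moeb (wmat w) x) * weight delta (wmat w) x)
}.

Section conformal_density_theory.
Context {R : realType} {G : pingpong R} {delta : R}.
Variable D : conformal_density G delta.
Implicit Types (f g : R -> R) (a b : G) (u v w : seq G) (x y : R).

Local Notation E := (integ D).
Local Notation L := (lim D).

Lemma integ_eq f g : bmf f -> bmf g -> (forall x, L x -> f x = g x) -> E f = E g.
Proof.
move=> bf bg fg; apply/eqP; rewrite eq_le; apply/andP.
by split; apply: integ_le => // x Lx; rewrite fg.
Qed.

Lemma integ0 : E (fun=> 0) = 0.
Proof.
by have := integ_lin D (-1) (bmf_cst 1) (bmf_cst 1); rewrite integ1 mulr1 addNr.
Qed.

Lemma integZ k f : bmf f -> E (fun x => k * f x) = k * E f.
Proof.
move=> bf; have := integ_lin D k bf (bmf_cst 0); rewrite integ0 addr0 => <-.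
by congr (E _); apply/funext => x; rewrite addr0.
Qed.

Lemma integ_cst k : E (fun=> k) = k.
Proof.
rewrite -[in RHS](mulr1 k) -(integ1 D) -integZ; last exact: bmf_cst.
by rewrite mulr1.
Qed.

Lemma integD f g : bmf f -> bmf g -> E (fun x => f x + g x) = E f + E g.
Proof.
move=> bf bg; have := integ_lin D 1 bf bg; rewrite mul1r => <-.
by congr (E _); apply/funext => x; rewrite mul1r.
Qed.

Lemma integ_sum (I : Type) (s : seq I) (F : I -> R -> R) :
  (forall i, bmf (F i)) ->
  E (fun x => \sum_(i <- s) F i x) = \sum_(i <- s) E (F i).
Proof.
move=> FI; elim: s => [|i s IH].
  by under [in LHS]eq_fun do rewrite big_nil; rewrite big_nil integ0.
under [in LHS]eq_fun do rewrite big_cons.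
by rewrite big_cons integD ?IH //; exact: bmf_sum.
Qed.

Lemma integ_le_cst f c : bmf f -> (forall x, L x -> f x <= c) -> E f <= c.
Proof. by move=> bf f0; rewrite -[c]integ_cst; apply: integ_le => //; exact: bmf_cst. Qed.

End conformal_density_theory.

(** * Cylinders and bounded distortion *)

Section regularity.
Context {R : realType} {G : pingpong R} {delta : R}.
Hypothesis delta01 : 0 < delta < 1.
Implicit Types (f g : R -> R) (a b c : G) (u v w : seq G) (x y : R).

Let delta0 : 0 <= delta. Proof. by case/andP: delta01 => /ltW. Qed.
Let delta1 : delta <= 1. Proof. by case/andP: delta01 => _ /ltW. Qed.

(** [away w] is the domain on which [w] contracts, and [cyl w] is the image of
    that domain; on the limit set the [cyl w], for w in a section, form a
    partition. *)
Definition away w x := if w is b :: u then ~~ disk (bar b) x else true.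

Definition cyl w y :=
  if w is b :: u then ~~ disk (bar b) (moeb (invmx (wmat w)) y) else true.

Definition within (r y x : R) := `|x - y| <= r.

Lemma measurable_disk a : measurable_fun setT (@disk R G a : R -> bool).
Proof. exact: measurable_dist. Qed.

Lemma measurable_away w : measurable_fun setT (away w : R -> bool).
Proof.
case: w => [|b u]; first exact: measurable_cst.
by apply: measurable_neg; exact: measurable_disk.
Qed.

Lemma measurable_cyl w : measurable_fun setT (cyl w : R -> bool).
Proof.
case: w => [|b u]; first exact: measurable_cst.
apply: measurable_neg; apply: (measurableT_comp (measurable_disk (bar b))).
exact: measurable_moeb.
Qed.

Section density.
Variable D : conformal_density G delta.
Local Notation E := (integ D).
Local Notation Lim := (lim D).

Lemma lim_disk_unique x : Lim x ->
  exists a, disk a x /\ forall b, disk b x = (b == a).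
Proof.
move=> /lim_disk [a ax]; exists a; split => // b.
have [->//|ba] := eqVneq b a.
by apply/negbTE; apply: disk_disjoint ax; rewrite eq_sym.
Qed.

(** On the limit set the first letter of the itinerary is determined in two ways:
    by the disk, and by where the inverse generator sends the point. *)
Lemma disk_back b x : Lim x -> ~~ disk (bar b) (moeb (gen (bar b)) x) = disk b x.
Proof.
move=> Lx; have [bx|bx] := boolP (disk b x); first by rewrite (lim_back Lx bx).
by apply/negbTE; rewrite negbK; apply: (gen_disk _).2; rewrite barK.
Qed.

Lemma lim_inv w x : Lim x ->
  den (invmx (wmat w)) x != 0 /\ Lim (moeb (invmx (wmat w)) x).
Proof. by rewrite -wmat_inv; exact: lim_wmat. Qed.

Lemma cyl_child b u y : Lim y ->
  cyl (b :: u) y = disk b (moeb (invmx (wmat u)) y).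
Proof.
move=> Ly; have [d0 Lz] := lim_inv u Ly.
rewrite -disk_back // /cyl [wmat (b :: u)]/= invmxM ?det_wmat ?det_gen //.
by rewrite moeb_mul // gen_bar.
Qed.

Lemma cyl_additive y : Lim y -> tree_additive (fun w => (cyl w y)%:R : R).
Proof.
move=> Ly a u ru.
under eq_bigr do rewrite cyl_child //.
rewrite /cyl; have [_ Lz] := lim_inv (a :: u) Ly; move: (moeb _ y) Lz => z Lz.
have [c [cz cE]] := lim_disk_unique Lz; rewrite cE.
have [ca|ca] := eqVneq (bar a) c.
  rewrite big1 // => b; rewrite cE -ca => /negbTE bc.
  by rewrite bc.
rewrite (bigD1 c) /= ?cz; last by rewrite eq_sym.
by rewrite big1 ?addr0 // => b /andP[_ /negbTE bc]; rewrite cE bc.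
Qed.

Lemma cyl_letters y : Lim y -> \sum_a (cyl [:: a] y)%:R = 1 :> R.
Proof.
move=> Ly; have [c [cy cE]] := lim_disk_unique Ly.
rewrite (bigD1 c) //= big1 ?addr0; last first.
  move=> b /negbTE bc; have := cyl_child b [::] Ly.
  by rewrite /= invmx1 moeb1 cE bc => ->.
have := cyl_child c [::] Ly.
by rewrite /= invmx1 moeb1 cE eqxx => ->.
Qed.

Lemma integ_cyl w f : bmf f ->
  E (fun x => f x * (cyl w x)%:R) =
  E (fun x => f (moeb (wmat w) x) * (away w x)%:R * weight delta (wmat w) x).
Proof.
move=> bf; have bc := bmf_ind (measurable_cyl w).
have ba := bmf_ind (measurable_away w).
have bw := bmf_weight delta01 (det_wmat w).
have bg := bmf_comp bf (measurable_moeb (wmat w)).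
rewrite (integ_conformal D w); last exact: bmfM.
apply: integ_eq.
- apply: bmfM => //; apply: bmfM => //.
  exact: (bmf_comp bc (measurable_moeb (wmat w))).
- exact: (bmfM (bmfM bg ba) bw).
move=> x Lx; congr (_ * _ * _); case: w {bc ba bw bg} => // b u.
by rewrite /cyl moebK ?det_wmat //; exact: (lim_wmat (b :: u) Lx).1.
Qed.

(** The transfer operator identity: cut along a section and pull every piece back
    by its word. *)
Lemma integ_section (L : seq (seq G)) f :
  (forall Phi : seq G -> R, tree_additive Phi ->
    \sum_a Phi [:: a] = \sum_(v <- L) Phi v) -> bmf f ->
  E f = \sum_(w <- L)
    E (fun x => f (moeb (wmat w) x) * (away w x)%:R * weight delta (wmat w) x).
Proof.
move=> HL bf; under eq_bigr do rewrite -integ_cyl //.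
have bc w : bmf (fun x => f x * (cyl w x)%:R).
  exact: (bmfM bf (bmf_ind (measurable_cyl w))).
rewrite -integ_sum //; apply: integ_eq => //; first exact: bmf_sum.
move=> x Lx; rewrite -mulr_sumr -(HL _ (cyl_additive Lx)).
by rewrite cyl_letters ?mulr1.
Qed.

End density.

Definition hi := (1 + bnd G ^+ 2) / gap G ^+ 2.
Definition lo := (4 * bnd G ^+ 2 * (1 + bnd G ^+ 2))^-1.

Let b1 := bnd_ge1 G.
Let g0 := gap_gt0 G.
Let g1 := gap_le1 G.

Lemma bnd2_ge1 : 1 <= bnd G ^+ 2.
Proof. by rewrite expr_ge1 //; have := b1; lra. Qed.

Lemma hi_ge1 : 1 <= hi.
Proof.
rewrite /hi ler_pdivlMr ?exprn_gt0 // mul1r.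
have : gap G ^+ 2 <= 1 by rewrite expr_le1 // ltW.
have := bnd2_ge1; lra.
Qed.

Lemma lo_gt0 : 0 < lo.
Proof.
have b2 := bnd2_ge1; rewrite invr_gt0.
by apply: mulr_gt0; [apply: mulr_gt0|]; lra.
Qed.

Lemma lo_le1 : lo <= 1.
Proof.
have b2 := bnd2_ge1.
have h : 1 <= 4 * bnd G ^+ 2 * (1 + bnd G ^+ 2).
  by rewrite -[leLHS]mul1r; apply: ler_pM; lra.
by rewrite /lo invf_le1 // (lt_le_trans _ h).
Qed.

Lemma pole_dist b u c x : reduced (b :: u) -> c != bar b -> disk c x ->
  gap G <= `|x - pole (wmat (b :: u))| <= 2 * bnd G.
Proof.
move=> ru cb cx; have dp := wmat_pole ru.
rewrite (disk_gap cb cx dp) /=; apply: le_trans (ler_normB _ _) _.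
have := disk_bnd cx; have := disk_bnd dp; lra.
Qed.

Lemma image_dist b u c x : reduced (b :: u) -> c != bar b -> disk c x ->
  `|moeb (wmat (b :: u)) x - image_infty (wmat (b :: u))| <=
    ((wmat (b :: u) 1 0) ^+ 2 * gap G)^-1.
Proof.
move=> ru cb cx; have [c0 _] := wmat_infty ru.
have [d0 _] := wmat_disk ru (disk_disjoint cb cx).
rewrite moeb_image_infty ?det_wmat // normrN normfV.
have c2 : 0 < (wmat (b :: u) 1 0) ^+ 2 by rewrite exprn_even_gt0.
have h1 : 0 < (wmat (b :: u) 1 0) ^+ 2 * gap G by rewrite mulr_gt0.
have h2 : 0 < `|wmat (b :: u) 1 0 * den (wmat (b :: u)) x|.
  by rewrite normr_gt0 mulf_neq0.
rewrite lef_pV2 ?posrE //.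
rewrite den_pole // mulrA -expr2 normrM (gtr0_norm c2) ler_pM2l //.
by case/andP: (pole_dist ru cb cx).
Qed.

(** Bounded distortion: on these disks x stays away from the pole and its image
    is bounded, so the derivative is of order c^-2. *)
Lemma sphder_bounds b u c x : reduced (b :: u) -> c != bar b -> disk c x ->
  lo / (wmat (b :: u) 1 0) ^+ 2 <= sphder (wmat (b :: u)) x <=
  hi / (wmat (b :: u) 1 0) ^+ 2.
Proof.
move=> ru cb cx; have [c0 _] := wmat_infty ru.
have [d0 dm] := wmat_disk ru (disk_disjoint cb cx).
have /andP[p1 p2] := pole_dist ru cb cx.
have c2 : 0 < (wmat (b :: u) 1 0) ^+ 2 by rewrite exprn_even_gt0.
have x2 : x ^+ 2 <= bnd G ^+ 2.
  by rewrite -(real_normK (num_real x)) ler_pXn2r ?nnegrE ?(disk_bnd cx) //; have := b1; lra.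
have m2 : moeb (wmat (b :: u)) x ^+ 2 <= bnd G ^+ 2.
  by rewrite -(real_normK (num_real (moeb _ _))) ler_pXn2r ?nnegrE ?(disk_bnd dm) //; have := b1; lra.
rewrite sphderE // den_pole // exprMn.
have q0 : 0 < (x - pole (wmat (b :: u))) ^+ 2.
  by rewrite -(real_normK (num_real (x - _))) exprn_gt0 // (lt_le_trans g0).
have q1 : gap G ^+ 2 <= (x - pole (wmat (b :: u))) ^+ 2.
  by rewrite -(real_normK (num_real (x - _))) ler_pXn2r ?nnegrE // ltW.
have q2 : (x - pole (wmat (b :: u))) ^+ 2 <= 4 * bnd G ^+ 2.
  rewrite -(real_normK (num_real (x - _))).
  have -> : 4 * bnd G ^+ 2 = (2 * bnd G) ^+ 2 by ring.
  by rewrite ler_pXn2r ?nnegrE //; have := b1; lra.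
have x0 := sqr_ge0 x; have m0 := sqr_ge0 (moeb (wmat (b :: u)) x).
have bb := bnd2_ge1.
move: c2 x2 m2 q0 q1 q2 x0 m0 bb; set C2 := (wmat _ 1 0) ^+ 2.
set Q := (x - _) ^+ 2; set M := moeb _ _ ^+ 2; set X := x ^+ 2; set B := bnd G ^+ 2.
move=> c2 x2 m2 q0 q1 q2 x0 m0 bb.
have -> : (1 + X) / (C2 * Q * (1 + M)) = (1 + X) / (Q * (1 + M)) / C2.
  by field; rewrite ?gt_eqF //=; lra.
rewrite !ler_pM2r ?invr_gt0 // /lo /hi -/B.
have B0 : 0 < 4 * B * (1 + B) by apply: mulr_gt0; lra.
have Q0 : 0 < Q * (1 + M) by apply: mulr_gt0; lra.
have G0 : 0 < gap G ^+ 2 by exact: exprn_gt0.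
apply/andP; split.
  rewrite -[leLHS]mul1r; apply: ler_pM; rewrite ?invr_ge0 ?(ltW B0) //; first lra.
  by rewrite lef_pV2 ?posrE //; apply: ler_pM; lra.
apply: ler_pM; rewrite ?invr_ge0 ?(ltW Q0) //; [lra | lra |].
by rewrite lef_pV2 ?posrE // -[leLHS]mulr1; apply: ler_pM; lra.
Qed.

Lemma powR_le_mul (k t : R) : 1 <= k -> 0 <= t -> (k * t) `^ delta <= k * t `^ delta.
Proof.
move=> k1 t0; rewrite powRM //; last by rewrite (le_trans _ k1).
by rewrite ler_wpM2r ?powR_ge0 // ler1_powR.
Qed.

Lemma powR_ge_mul (k t : R) : 0 < k <= 1 -> 0 <= t -> k * t `^ delta <= (k * t) `^ delta.
Proof.
move=> /andP[k0 k1] t0; rewrite powRM //; last exact: ltW.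
by rewrite ler_wpM2r ?powR_ge0 // ger1_powR ?k0.
Qed.

Lemma weight_hi b u c x (t : R) : reduced (b :: u) -> c != bar b -> disk c x -> 0 < t ->
  1 <= t * (wmat (b :: u) 1 0) ^+ 2 -> weight delta (wmat (b :: u)) x <= hi * t `^ delta.
Proof.
move=> ru cb cx t0 tc; have /andP[_ h] := sphder_bounds ru cb cx.
have [c0 _] := wmat_infty ru.
have c2 : 0 < (wmat (b :: u) 1 0) ^+ 2 by rewrite exprn_even_gt0.
have [_ /andP[s0 _]] := sphder_le x (det_wmat (b :: u)).
apply: le_trans (powR_le_mul hi_ge1 (ltW t0)); apply: ge0_ler_powR => //.
  by rewrite nnegrE mulr_ge0 ?(ltW t0) // (le_trans _ hi_ge1).
apply: le_trans h _; rewrite ler_pM2l ?(lt_le_trans _ hi_ge1) //.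
by rewrite -[leLHS]mul1r ler_pdivrMr.
Qed.

Lemma weight_lo b u c x (t : R) : reduced (b :: u) -> c != bar b -> disk c x -> 0 <= t ->
  t * (wmat (b :: u) 1 0) ^+ 2 <= 1 -> lo * t `^ delta <= weight delta (wmat (b :: u)) x.
Proof.
move=> ru cb cx t0 tc; have /andP[h _] := sphder_bounds ru cb cx.
have [c0 _] := wmat_infty ru.
have c2 : 0 < (wmat (b :: u) 1 0) ^+ 2 by rewrite exprn_even_gt0.
have [_ /andP[s0 _]] := sphder_le x (det_wmat (b :: u)).
have l01 : 0 < lo <= 1 by rewrite lo_gt0 lo_le1.
apply: le_trans (powR_ge_mul l01 t0) _; apply: ge0_ler_powR => //.
  by rewrite nnegrE mulr_ge0 // ltW // lo_gt0.
apply: le_trans h; rewrite ler_pM2l ?lo_gt0 //.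
by rewrite -[leRHS]mul1r ler_pdivlMr.
Qed.

Definition mass_min := lo * ((1 + cmax G) ^+ 2)^-1 / #|G|%:R.

Lemma cmax_ge0 : 0 <= cmax G.
Proof. exact: sumr_ge0. Qed.

Lemma mass_min_gt0 : 0 < mass_min.
Proof.
have c0 := cmax_ge0.
rewrite !mulr_gt0 ?lo_gt0 ?invr_gt0 ?exprn_gt0 //; first by lra.
by rewrite ltr0n; apply/card_gt0P; exists (some_letter G).
Qed.

End regularity.

Arguments hi {R} G.
Arguments lo {R} G.
Arguments mass_min {R} G.
Arguments lo_gt0 {R} G.
Arguments lo_le1 {R} G.
Arguments hi_ge1 {R} G.
Arguments cmax_ge0 {R} G.
Arguments mass_min_gt0 {R} G.

(** * Regularity of the density and distribution of the poles *)

Section mass_bounds.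
Context {R : realType} {G : pingpong R} {delta : R}.
Hypothesis delta01 : 0 < delta < 1.
Variable D : conformal_density G delta.
Implicit Types (f g : R -> R) (a b c : G) (u v w : seq G) (x y : R).
Local Notation E := (integ D).
Local Notation Lim := (lim D).

Let delta0 : 0 <= delta. Proof. by case/andP: delta01 => /ltW. Qed.
Let delta1 : delta <= 1. Proof. by case/andP: delta01 => _ /ltW. Qed.
Let b1 := bnd_ge1 G.
Let g0 := gap_gt0 G.
Let g1 := gap_le1 G.

Let bmf_disk a : bmf (fun x => (disk a x)%:R : R).
Proof. exact: bmf_ind (measurable_disk a). Qed.

Let bmf_dist (y r : R) : bmf (fun x => (within r y x)%:R : R).
Proof. exact: bmf_ind (measurable_dist y r). Qed.

Let bmf_away w : bmf (fun x => (away w x)%:R : R).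
Proof. exact: bmf_ind (measurable_away w). Qed.

#[local] Hint Resolve bmf_cst bmf_disk bmf_dist bmf_away : core.

Let heavy_disk : exists a : G, (#|G|%:R)^-1 <= E (fun x => (disk a x)%:R).
Proof.
have n0 : 0 < #|G|%:R :> R.
  by rewrite ltr0n; apply/card_gt0P; exists (some_letter G).
apply: contrapT => /forallNP H.
have : \sum_a E (fun x => (@disk R G a x)%:R) < \sum_(a : G) (#|G|%:R)^-1.
  rewrite [ltRHS](bigD1 (some_letter G)) // [ltLHS](bigD1 (some_letter G)) //=.
  have K a : E (fun x => (disk a x)%:R) < (#|G|%:R)^-1.
    by rewrite ltNge; apply/negP; exact: H.
  by apply: ltr_leD; [exact: K | apply: ler_sum => a _; exact/ltW/K].
have -> : \sum_(a : G) (#|G|%:R)^-1 = 1 :> R.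
  by rewrite sumr_const -[LHS]mulr_natl divff ?gt_eqF.
rewrite -integ_sum // ltNge => /negP; apply.
rewrite -[leLHS](integ1 D); apply: integ_le; [exact: bmf_cst | exact: bmf_sum |].
move=> x Lx; have [a [ax _]] := lim_disk_unique Lx.
by rewrite (bigD1 a) //= ax lerDl sumr_ge0.
Qed.

(** A generator sends every disk but one into its own disk, with derivative bounded
    below: a definite proportion of the mass of each of those disks is found
    again in the disk of the generator. *)
Lemma gen_mass_transfer a c : c != bar a ->
  lo G * ((1 + cmax G) ^+ 2)^-1 * E (fun x => (disk c x)%:R) <= E (fun x => (disk a x)%:R).
Proof.
move=> ca; have c0 := cmax_ge0 G.
have d0 : 0 < (1 + cmax G) ^+ 2 by apply: exprn_gt0; lra.
have k1 : ((1 + cmax G) ^+ 2)^-1 <= 1.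
  by rewrite invf_le1 // exprn_ege1 //; lra.
rewrite [leRHS](integ_conformal D [:: a]) // -integZ //.
have bw := bmf_weight delta01 (det_wmat [:: a]).
apply: integ_le; [exact: bmfZ | |].
  exact: (bmfM (bmf_comp (bmf_disk a) (measurable_moeb _)) bw).
move=> x Lx; have [cx|] := boolP (disk c x); last first.
  by rewrite mulr0 mulr_ge0 ?weight_ge0 ?ler0n.
have ra : reduced [:: a] by [].
have [_ ax] := wmat_disk ra (disk_disjoint ca cx); rewrite /= in ax.
rewrite [wmat _]/= in ax *; rewrite ax mulr1 mul1r.
have tc : ((1 + cmax G) ^+ 2)^-1 * (wmat [:: a] 1 0) ^+ 2 <= 1.
  rewrite mulrC ler_pdivrMr // mul1r -(real_normK (num_real (wmat _ _ _))).
  rewrite ler_pXn2r ?nnegrE //; last by lra.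
  rewrite /= mul1mx; apply: (@le_trans _ _ (cmax G)); last by lra.
  by rewrite /cmax (bigD1 a) //= lerDl sumr_ge0.
apply: le_trans (weight_lo delta01 ra ca cx _ tc); last by rewrite invr_ge0 ltW.
by rewrite ler_pM2l ?lo_gt0 // ger1_powR // invr_gt0 d0.
Qed.

(** Some disk has mass at least 1 / #|G|, and the disk of a third letter, outside
    the excluded one, receives a part of it. *)
Lemma away_mass b u : mass_min G <= E (fun x => (away (b :: u) x)%:R).
Proof.
have [c hc] := heavy_disk.
have [a [ab ac]] := third_letter (bar b) (bar c).
have k0 : 0 <= lo G * ((1 + cmax G) ^+ 2)^-1.
  by rewrite mulr_ge0 ?(ltW (lo_gt0 _)) ?invr_ge0 ?sqr_ge0.
have ca : c != bar a by apply: contra_neq ac => ->; rewrite barK.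
apply: le_trans (ler_wpM2l k0 hc) _; apply: le_trans (gen_mass_transfer ca) _.
apply: integ_le => // x Lx; have [ax|] := boolP (disk a x); last by rewrite ler0n.
by rewrite /away (disk_disjoint ab ax).
Qed.

Section section_bounds.
Variables (tau : R) (L : seq (seq G)).
Hypothesis tau01 : 0 < tau <= 1.
Hypothesis uL : uniq L.
Hypothesis HL : {in L, forall v, [/\ proper v, 1 <= tau * (wmat v 1 0) ^+ 2
  & tau * (wmat v 1 0) ^+ 2 <= kappa G]}.

Let tau0 : 0 < tau. Proof. by case/andP: tau01. Qed.

Let c0 := csep_gt0 G.

Lemma kappa_gt0 : 0 < kappa G.
Proof.
rewrite /kappa exprn_gt0 // mulr_gt0 //; last by have := b1; lra.
rewrite /cmax (bigD1 (some_letter G)) //= ltr_wpDr ?sumr_ge0 // normr_gt0.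
exact: (gen_infty _).1.
Qed.

Let sep_arith (p q d : R) : tau * p ^+ 2 <= kappa G -> tau * q ^+ 2 <= kappa G ->
  0 <= d -> csep G <= `|p| * `|q| * d -> csep G * tau / kappa G <= d.
Proof.
rewrite -(real_normK (num_real p)) -(real_normK (num_real q)).
move: `|p| `|q| (normr_ge0 p) (normr_ge0 q) => x y x0 y0 hx hy d0 h.
have xy : tau * (x * y) <= kappa G.
  have : x * y <= (x ^+ 2 + y ^+ 2) / 2 by have := sqr_ge0 (x - y); rewrite sqrrB; lra.
  rewrite -(ler_pM2l tau0); lra.
rewrite ler_pdivrMr ?kappa_gt0 // mulrC; apply: le_trans (ler_wpM2l (ltW tau0) h) _.
by rewrite mulrA [leRHS]mulrC ler_wpM2r.
Qed.

Lemma pole_sep_section w v : w \in L -> v \in L -> w != v ->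
  csep G * tau / kappa G <= `|pole (wmat w) - pole (wmat v)|.
Proof.
move=> /HL[/properE[b [u [-> ru]]] _ h1] /HL[/properE[c [u' [-> rv]]] _ h2] uv.
exact: (sep_arith h1 h2 (normr_ge0 _) (pole_sep ru rv uv)).
Qed.

Lemma image_sep_section w v : w \in L -> v \in L -> w != v ->
  csep G * tau / kappa G <= `|image_infty (wmat w) - image_infty (wmat v)|.
Proof.
move=> /HL[/properE[b [u [-> ru]]] _ h1] /HL[/properE[c [u' [-> rv]]] _ h2] uv.
exact: (sep_arith h1 h2 (normr_ge0 _) (image_infty_sep ru rv uv)).
Qed.

Let sep0 : 0 < csep G * tau / kappa G.
Proof. exact: divr_gt0 (mulr_gt0 c0 tau0) kappa_gt0. Qed.

Lemma count_near (p : seq G -> R) (y r : R) : 0 <= r ->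
  {in L &, forall w v, w != v -> csep G * tau / kappa G <= `|p w - p v|} ->
  \sum_(w <- L) (within r y (p w))%:R <= 2 * (r / tau) * (kappa G / csep G) + 1 :> R.
Proof.
move=> r0 sp; rewrite -natr_sum -big_mkcond /= sum1_count -size_filter.
apply: le_trans (@separated_count _ _ _ p y r _ (filter_uniq _ uL) sep0 r0 _ _) _.
- by move=> w; rewrite mem_filter => /andP[].
- move=> w v; rewrite !mem_filter => /andP[_ wL] /andP[_ vL]; exact: sp.
have k0 := kappa_gt0; rewrite lerD2r le_eqVlt; apply/orP; left; apply/eqP.
by field; rewrite !gt_eqF //= ?c0 ?k0 ?tau0.
Qed.

End section_bounds.

Definition frostman_cst :=
  hi G * (2 * (1 + (gap G)^-1) * (kappa G / csep G) + 1).

Lemma frostman_cst_ge1 : 1 <= frostman_cst.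
Proof.
rewrite /frostman_cst -[leLHS]mulr1; apply: ler_pM => //; first exact: hi_ge1.
have gi : 0 < (gap G)^-1 by rewrite invr_gt0.
have kc : 0 < kappa G / csep G := divr_gt0 kappa_gt0 (csep_gt0 G).
by rewrite lerDr; apply: mulr_ge0; [lra | exact: ltW].
Qed.

(** Upper regularity: cut the limit set into cylinders of size r; boundedly many
    meet a given interval of length r because the images of infinity under the
    corresponding group elements are separated. *)
Lemma frostman (y r : R) : 0 < r ->
  E (fun x => (within r y x)%:R) <= frostman_cst * r `^ delta.
Proof.
move=> r0; have C1 := frostman_cst_ge1.
have [r1|r1] := leP 1 r.
  apply: (@le_trans _ _ 1).
    by apply: integ_le_cst => // x _; rewrite lern1 leq_b1.
  rewrite -[leLHS]mulr1; apply: ler_pM => //.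
  by have := ler_powR r1 delta0; rewrite powRr0.
have r01 : 0 < r <= 1 by rewrite r0 ltW.
have [L [uL HL aL]] := stopping_section G r01.
rewrite (integ_section delta01 D aL) //.
set M := hi G * r `^ delta.
have M0 : 0 <= M by rewrite mulr_ge0 ?powR_ge0 // (le_trans _ (hi_ge1 G)).
apply: (@le_trans _ _ (\sum_(w <- L) M *
    (within (r * (1 + (gap G)^-1)) y (image_infty (wmat w)))%:R)).
  rewrite big_seq [leRHS]big_seq; apply: ler_sum => w wL.
  have [/properE[b [u [-> ru]]] t1 t2] := HL _ wL.
  have bw := bmf_weight delta01 (det_wmat (b :: u)).
  apply: integ_le_cst.
    exact: (bmfM (bmfM (bmf_comp (bmf_dist y r) (measurable_moeb _)) (bmf_away _)) bw).
  move=> x Lx; have [c [cx cE]] := lim_disk_unique Lx.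
  rewrite /away cE; have [//|cb] := eqVneq (bar b) c; first by rewrite mulr0 mul0r mulr_ge0.
  rewrite mulr1; have {}cb : c != bar b by rewrite eq_sym.
  rewrite /within; case: (leP `|moeb _ x - y| r) => hx; last by rewrite mul0r mulr_ge0.
  have -> : `|image_infty (wmat (b :: u)) - y| <= r * (1 + (gap G)^-1).
    have := image_dist ru cb cx.
    have : ((wmat (b :: u) 1 0) ^+ 2 * gap G)^-1 <= r * (gap G)^-1.
      rewrite invfM ler_pM2r ?invr_gt0 //.
      have c2 : 0 < (wmat (b :: u) 1 0) ^+ 2 by rewrite exprn_even_gt0 // (wmat_infty ru).1.
      by rewrite -[leLHS]mul1r ler_pdivrMr.
    have -> : image_infty (wmat (b :: u)) - y =
      - (moeb (wmat (b :: u)) x - image_infty (wmat (b :: u))) +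
      (moeb (wmat (b :: u)) x - y) by ring.
    move=> h1 h2; apply: le_trans (ler_normD _ _) _; rewrite normrN mulrDr mulr1.
    by lra.
  by rewrite mul1r mulr1; exact: (weight_hi delta01 ru cb cx r0 t1).
rewrite -mulr_sumr /M /frostman_cst mulrAC ler_wpM2r ?powR_ge0 // ler_wpM2l //.
  by rewrite (le_trans _ (hi_ge1 G)).
apply: le_trans (count_near r01 uL y _ _) _.
- by rewrite mulr_ge0 ?addr_ge0 ?invr_ge0 ?(ltW g0) ?(ltW r0).
- by move=> w v; exact: image_sep_section r01 HL w v.
by rewrite [r * _]mulrC mulfK // gt_eqF.
Qed.

Definition count_cst :=
  (2 * (kappa G / csep G) / gap G + 1) * frostman_cst / gap G /
    (lo G / kappa G * mass_min G).

(** The inverse of a group element of size tau sends all disks but one into a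
    neighbourhood of the pole of radius about tau, with derivative about tau, and
    those disks carry a definite mass. *)
Lemma pole_mass tau b u : 0 < tau <= 1 -> reduced (b :: u) ->
  1 <= tau * (wmat (b :: u) 1 0) ^+ 2 -> tau * (wmat (b :: u) 1 0) ^+ 2 <= kappa G ->
  lo G / kappa G * mass_min G * tau `^ delta <=
    E (fun x => (within (tau / gap G) (pole (wmat (b :: u))) x)%:R).
Proof.
move=> /andP[t0 t1] ru h1 h2.
have k1 : 1 <= kappa G by exact: le_trans h1 h2.
have [c [v [ev lv]]] := winv_cons b u.
have rv : reduced (c :: v) by rewrite -ev reduced_inv.
have wv : wmat (c :: v) = invmx (wmat (b :: u)) by rewrite -ev wmat_inv.
have pv : pole (wmat (b :: u)) = image_infty (wmat (c :: v)).
  by rewrite wv pole_inv ?det_wmat.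
have e2 : (wmat (b :: u) 1 0) ^+ 2 = (wmat (c :: v) 1 0) ^+ 2.
  by rewrite wv; have [_ _ -> _] := inv2 (det_wmat (b :: u)); rewrite sqrrN.
rewrite e2 in h1 h2; rewrite pv.
have c2 : 0 < (wmat (c :: v) 1 0) ^+ 2 by rewrite exprn_even_gt0 // (wmat_infty rv).1.
have bw := bmf_weight delta01 (det_wmat (c :: v)).
rewrite (integ_conformal D (c :: v)) //.
apply: (@le_trans _ _ (lo G * (tau / kappa G) `^ delta * E (fun x => (away (c :: v) x)%:R))).
  apply: (@le_trans _ _ (lo G * (tau / kappa G) `^ delta * mass_min G)); last first.
    by rewrite ler_wpM2l ?away_mass // mulr_ge0 ?powR_ge0 // ltW // lo_gt0.
  rewrite mulrAC ler_pM2r ?mass_min_gt0 // -mulrA ler_pM2l ?lo_gt0 //.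
  rewrite (mulrC tau); apply: (powR_ge_mul delta01 _ (ltW t0)).
  by rewrite invr_gt0 invf_le1 ?k1 (lt_le_trans ltr01 k1).
rewrite -integZ //; apply: integ_le; [exact: bmfZ | |].
  exact: (bmfM (bmf_comp (bmf_dist _ _) (measurable_moeb _)) bw).
move=> x Lx; have [a [ax aE]] := lim_disk_unique Lx.
rewrite /within /away aE; have [_|ca] := eqVneq (bar c) a.
  by rewrite mulr0 mulr_ge0 ?weight_ge0 ?ler0n.
have {}ca : a != bar c by rewrite eq_sym.
have -> : `|moeb (wmat (c :: v)) x - image_infty (wmat (c :: v))| <= tau / gap G.
  apply: le_trans (image_dist rv ca ax) _.
  rewrite invfM ler_pM2r ?invr_gt0 //.
  by rewrite -[leLHS]mul1r ler_pdivrMr.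
rewrite mulr1 mul1r; apply: (weight_lo delta01 rv ca ax).
  by rewrite divr_ge0 ?(ltW t0) // (le_trans _ k1).
by rewrite mulrAC ler_pdivrMr ?mul1r // (lt_le_trans ltr01 k1).
Qed.

(** Poles of the section are distributed like the density, down to scale tau. *)
Lemma pole_count tau (L : seq (seq G)) (y eta : R) : 0 < tau <= 1 -> 0 <= eta -> uniq L ->
  {in L, forall v, [/\ proper v, 1 <= tau * (wmat v 1 0) ^+ 2
    & tau * (wmat v 1 0) ^+ 2 <= kappa G]} ->
  (\sum_(w <- L) (within eta y (pole (wmat w)))%:R) * tau `^ delta <=
    count_cst * (eta + tau) `^ delta.
Proof.
move=> t01 eta0 uL HL; have [t0 t1] := andP t01.
have k0 := kappa_gt0; have m0 := mass_min_gt0 G; have l0 := lo_gt0 G.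
have c0 := csep_gt0 G.
have F0 : 0 <= frostman_cst by exact: le_trans frostman_cst_ge1.
set A := lo G / kappa G * mass_min G.
have A0 : 0 < A by rewrite mulr_gt0 // divr_gt0.
rewrite /count_cst -/A [leRHS]mulrAC ler_pdivlMr // [leLHS]mulrC mulrCA mulr_suml.
set N := 2 * (kappa G / csep G) / gap G + 1.
have N0 : 0 <= N.
  have kc : 0 < kappa G / csep G by exact: divr_gt0.
  by rewrite addr_ge0 // divr_ge0 ?(ltW g0) //; lra.
apply: (@le_trans _ _ (\sum_(w <- L) (within eta y (pole (wmat w)))%:R *
    E (fun x => (within (tau / gap G) (pole (wmat w)) x)%:R))).
  rewrite big_seq [leRHS]big_seq; apply: ler_sum => w wL.
  have [/properE[b [u [-> ru]]] h1 h2] := HL _ wL.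
  by apply: ler_wpM2l; [rewrite ler0n | exact: pole_mass].
under eq_bigr do rewrite -integZ //.
rewrite -integ_sum; last by move=> w; exact: bmfZ.
apply: (@le_trans _ _ (E (fun x => N * (within (eta + tau / gap G) y x)%:R))).
  apply: integ_le; [by apply: bmf_sum => w; exact: bmfZ | exact: bmfZ |].
  move=> x Lx; rewrite [in leRHS]/within; case: (leP `|x - y| _) => hx; last first.
    rewrite mulr0 big1 // => w _; rewrite /within.
    case: (leP `|pole _ - y| _) => h1; last by rewrite mul0r.
    case: (leP `|x - _| _) => h2; last by rewrite mulr0.
    have := ler_normD (x - pole (wmat w)) (pole (wmat w) - y).
    by rewrite addrA subrK => h3; exfalso; lra.
  rewrite mulr1; apply: (@le_trans _ _ (\sum_(w <- L) (within (tau / gap G) x (pole (wmat w)))%:R)).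
    apply: ler_sum => w _; rewrite /within [`|x - _|]distrC.
    by case: (`|_ - y| <= _); rewrite ?mul1r ?mul0r ?ler0n.
  apply: le_trans (count_near t01 uL x _ _) _.
  - by rewrite divr_ge0 // ltW.
  - by move=> w v; exact: pole_sep_section t01 HL w v.
  rewrite /N lerD2r le_eqVlt; apply/orP; left; apply/eqP; field.
  by rewrite !gt_eqF.
have -> : N * frostman_cst / gap G * (eta + tau) `^ delta =
  N * (frostman_cst * ((gap G)^-1 * (eta + tau) `^ delta)) by ring.
rewrite integZ // ler_wpM2l //.
have s0 : 0 < eta + tau / gap G by rewrite ltr_wpDl // divr_gt0.
apply: le_trans (frostman y s0) _; rewrite ler_wpM2l //.
apply: (@le_trans _ _ (((gap G)^-1 * (eta + tau)) `^ delta)).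
  apply: ge0_ler_powR => //; rewrite ?nnegrE ?(ltW s0) //.
    by rewrite mulr_ge0 ?invr_ge0 ?addr_ge0 // ltW.
  rewrite mulrDr [tau / _]mulrC lerD2r ler_peMl //.
  by rewrite invf_ge1.
by apply: powR_le_mul; rewrite ?invf_ge1 // addr_ge0 // ltW.
Qed.

End mass_bounds.

Arguments frostman_cst {R} G.
Arguments count_cst {R} G.

(** * Amplitudes *)

Section amplitudes.
Context {R : realType} {G : pingpong R} {delta : R}.
Hypothesis delta01 : 0 < delta < 1.
Implicit Types (b e : G) (u v w : seq G) (x y : R).

Lemma der_canon (f : R -> R) x a : is_derive x 1 f a ->
  is_derive x 1 f (derive1 f x) /\ derive1 f x = a.
Proof.
move=> df; have e : derive1 f x = a by rewrite derive1E; exact: derive_val.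
by split => //; rewrite e.
Qed.

Lemma der_affine (a b x : R) : is_derive x 1 (fun y => a * y + b) a.
Proof.
by apply: (der_eq (derD (derZ a (der_id x)) (der_cst b x))); rewrite mulr1 addr0.
Qed.

Lemma der_moeb (g : 'M[R]_2) x : \det g = 1 -> den g x != 0 ->
  is_derive x 1 (moeb g) (den g x ^- 2).
Proof.
rewrite det2E => dg d0.
apply: (der_eq (derM (der_affine (g 0 0) (g 0 1) x)
  (derV (f := den g) d0 (der_affine (g 1 0) (g 1 1) x)))).
rewrite -[RHS]mul1r -dg; rewrite /den in d0 *; field; exact: d0.
Qed.

Lemma der_sphder (g : 'M[R]_2) x : \det g = 1 ->
  is_derive x 1 (sphder g) (sphder g x * (2 * x / (1 + x ^+ 2) -
    2 * (num g x * g 0 0 + den g x * g 1 0) / (num g x ^+ 2 + den g x ^+ 2))).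
Proof.
move=> dg; have [Q0 _] := sphder_le x dg.
have dn := der_affine (g 0 0) (g 0 1) x; have dd := der_affine (g 1 0) (g 1 1) x.
have dQ : is_derive x 1 (fun y => num g y ^+ 2 + den g y ^+ 2)
    (2 * (num g x * g 0 0 + den g x * g 1 0)).
  by apply: (der_eq (derD (derM dn dn) (derM dd dd))); rewrite /num /den; ring.
have dx : is_derive x 1 (fun y : R => 1 + y ^+ 2) (2 * x).
  by apply: (der_eq (derD (der_cst 1 x) (derM (der_id x) (der_id x)))); ring.
apply: (der_eq (derM dx (derV (f := fun y => num g y ^+ 2 + den g y ^+ 2)
  (lt0r_neq0 Q0) dQ))).
have x0 : 1 + x ^+ 2 != 0 by rewrite lt0r_neq0 // ltr_pwDl ?sqr_ge0.
rewrite /sphder; have q0 := lt0r_neq0 Q0.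
move: x0 q0; set X := 1 + x ^+ 2; set Q := _ + den g x ^+ 2 => x0 q0.
by field; rewrite x0 q0.
Qed.

Definition dist_cst : R := 1 + 2 * (1 + bnd G) / gap G.

Let b1 := bnd_ge1 G.
Let g0 := gap_gt0 G.
Let g1 := gap_le1 G.

Lemma dist_cst_ge1 : 1 <= dist_cst.
Proof.
rewrite /dist_cst lerDl divr_ge0 ?(ltW g0) // mulr_ge0 // addr_ge0 //.
exact: le_trans b1.
Qed.

Let norm_2x x : `|2 * x / (1 + x ^+ 2)| <= 1.
Proof.
have x0 : 0 < 1 + x ^+ 2 by rewrite ltr_pwDl ?sqr_ge0.
rewrite normrM normfV (gtr0_norm x0) ler_pdivrMr // mul1r ler_norml.
have h1 := sqr_ge0 (x - 1); have h2 := sqr_ge0 (x + 1).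
by rewrite sqrrB in h1; rewrite sqrrD in h2; apply/andP; split; lra.
Qed.

(** Away from the pole the logarithmic derivative of the weight is bounded
    independently of the word. *)
Lemma weight_der b u e x : reduced (b :: u) -> e != bar b -> disk e x ->
  let f := weight delta (wmat (b :: u)) in
  is_derive x 1 f (derive1 f x) /\ `|derive1 f x| <= dist_cst * f x.
Proof.
move=> ru eb ex f; set g := wmat (b :: u).
have dg : \det g = 1 := det_wmat (b :: u).
have [c0 dq] := wmat_infty ru; have [d0 dm] := wmat_disk ru (disk_disjoint eb ex).
have /andP[p1 p2] := pole_dist ru eb ex.
rewrite -/g in c0 dq d0 dm p1 p2.
have /andP[s0 _] := sphder_bounds ru eb ex; rewrite -/g in s0.
have sp : 0 < sphder g x.
  by apply: lt_le_trans s0; rewrite divr_gt0 ?lo_gt0 // exprn_even_gt0.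
have [df de] := der_canon (der_comp (f := fun y => y `^ delta)
  (is_derive1_powR delta sp) (der_sphder x dg)).
split; [exact: df | rewrite de]; set E := 2 * x / _ - _.
have Eb : `|E| <= dist_cst.
  rewrite /E /dist_cst; apply: le_trans (ler_normB _ _) _; apply: lerD; first exact: norm_2x.
  rewrite -[2 * (_ + _) / _]mulrA -[2 * (1 + _) / _]mulrA.
  apply: ler_normM_bound; first by rewrite ger0_norm.
  set m := moeb g x.
  have nE : num g x = den g x * m by rewrite /m /moeb -/(num g x) -/(den g x) mulrCA divff ?mulr1.
  have aE : g 0 0 = g 1 0 * image_infty g by rewrite /image_infty mulrCA divff ?mulr1.
  have -> : (num g x * g 0 0 + den g x * g 1 0) / (num g x ^+ 2 + den g x ^+ 2) =
     (g 1 0 / den g x) * ((m * image_infty g + 1) / (1 + m ^+ 2)).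
    rewrite nE aE.
    have m0 : 1 + m ^+ 2 != 0 by rewrite lt0r_neq0 // ltr_pwDl ?sqr_ge0.
    have q0 : (den g x * m) ^+ 2 + den g x ^+ 2 != 0.
      by rewrite -nE lt0r_neq0 // (sphder_le x dg).1.
    by field; rewrite m0 d0.
  rewrite [leRHS]mulrC; apply: ler_normM_bound.
    rewrite den_pole // invfM mulrA divff // mul1r normfV lef_pV2 ?posrE //.
    exact: lt_le_trans p1.
  have m0 : 0 < 1 + m ^+ 2 by rewrite ltr_pwDl ?sqr_ge0.
  rewrite normrM normfV (gtr0_norm m0) ler_pdivrMr //.
  have hm : `|m| <= 1 + m ^+ 2.
    have h := sqr_ge0 (`|m| - 1); rewrite sqrrB real_normK ?num_real // in h.
    by have h' := sqr_ge0 m; lra.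
  have bb := disk_bnd dq.
  apply: le_trans (ler_normD _ _) _; rewrite normrM normr1 mulrDl mul1r addrC.
  apply: lerD; first by rewrite lerDl sqr_ge0.
  by rewrite mulrC; apply: ler_pM.
have [d0' d1] := andP delta01.
rewrite /f /weight; move: (sphder g x) sp => h sp.
rewrite /= !normrM (gtr0_norm d0') (ger0_norm (powR_ge0 _ _)) (gtr0_norm sp).
have -> : delta * h `^ (delta - 1) * (h * `|E|) = delta * `|E| * (h * h `^ (delta - 1)).
  by ring.
rewrite mulr_powRB1 ?(ltW sp) // ler_wpM2r ?powR_ge0 //.
by rewrite -[leRHS]mul1r; apply: ler_pM => //; exact: ltW.
Qed.

Variable tau : R.
Hypothesis tau01 : 0 < tau <= 1.
Let tau0 : 0 < tau. Proof. by case/andP: tau01. Qed.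

(** The amplitude produced by differentiating the phase, normalised to size
    tau^delta. *)
Definition weight_slope w x := weight delta (wmat w) x * (tau * den (wmat w) x ^+ 2)^-1.

Definition amp_cst : R := hi G * ((dist_cst + 2 / gap G) / gap G ^+ 2).

Lemma amp_cst_parts : [/\ hi G <= amp_cst, hi G * dist_cst <= amp_cst,
  hi G / gap G ^+ 2 <= amp_cst & 1 <= amp_cst].
Proof.
have h1 := hi_ge1 G; have d1 := dist_cst_ge1.
have h0 : 0 <= hi G := le_trans ler01 h1.
have g2 : 0 < gap G ^+ 2 by exact: exprn_gt0.
have gi : 1 <= (gap G ^+ 2)^-1 by rewrite invf_ge1 // expr_le1 // ltW.
have gg : 0 <= 2 / gap G by rewrite divr_ge0 // ltW.
have dd : dist_cst <= dist_cst + 2 / gap G by rewrite lerDl.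
have k1 : hi G * dist_cst <= amp_cst.
  rewrite /amp_cst ler_wpM2l // -[leLHS]mulr1; apply: ler_pM => //.
  exact: le_trans ler01 d1.
have k2 : hi G <= hi G * dist_cst by rewrite ler_peMr.
split => //; last by rewrite (le_trans h1) // (le_trans k2).
  exact: le_trans k2 k1.
rewrite /amp_cst ler_wpM2l // -[leLHS]mul1r ler_wpM2r ?invr_ge0 ?(ltW g2) //.
exact: le_trans d1 dd.
Qed.

Lemma amplitude_bounds b u e x : reduced (b :: u) -> e != bar b -> disk e x ->
  1 <= tau * (wmat (b :: u) 1 0) ^+ 2 ->
  let A := weight delta (wmat (b :: u)) in let B := weight_slope (b :: u) in
  [/\ is_derive x 1 A (derive1 A x), is_derive x 1 B (derive1 B x),
     `|A x| <= amp_cst * tau `^ delta /\ `|derive1 A x| <= amp_cst * tau `^ delta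
   & `|B x| <= amp_cst * tau `^ delta /\ `|derive1 B x| <= amp_cst * tau `^ delta].
Proof.
move=> ru eb ex tc A B; set g := wmat (b :: u).
have [k1 k2 k3 k4] := amp_cst_parts.
have [dA Ab] := weight_der ru eb ex; rewrite -/A in dA Ab.
have wh := weight_hi delta01 ru eb ex tau0 tc; rewrite -/(A x) in wh.
have A0 : 0 <= A x := powR_ge0 _ _.
have [c0 _] := wmat_infty ru; have [d0 _] := wmat_disk ru (disk_disjoint eb ex).
have /andP[p1 _] := pole_dist ru eb ex.
rewrite -/g in c0 d0 p1 tc.
have d1 : 0 <= dist_cst := le_trans ler01 dist_cst_ge1.
have tp : 0 <= tau `^ delta := powR_ge0 _ _.
have T0 : 0 < tau * den g x ^+ 2 by rewrite mulr_gt0 // exprn_even_gt0.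
have g2 : 0 < gap G ^+ 2 by exact: exprn_gt0.
have rb : (tau * den g x ^+ 2)^-1 <= (gap G ^+ 2)^-1.
  rewrite lef_pV2 ?posrE // den_pole // exprMn mulrA -[leLHS]mul1r.
  apply: ler_pM => //; rewrite ?(ltW g2) // -[leRHS]real_normK ?num_real //.
  by rewrite ler_pXn2r ?nnegrE ?(ltW g0).
have r0 : 0 <= (tau * den g x ^+ 2)^-1 by rewrite invr_ge0 ltW.
have dT : is_derive x 1 (fun y => tau * den g y ^+ 2) (2 * tau * den g x * g 1 0).
  have dd := der_affine (g 1 0) (g 1 1) x.
  by apply: (der_eq (derZ tau (derM dd dd))); rewrite /den; ring.
have [dB Be] := der_canon (derM dA (derV (f := fun y => tau * den g y ^+ 2) (lt0r_neq0 T0) dT)).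
have ch : `|g 1 0 / den g x| <= (gap G)^-1.
  rewrite den_pole // invfM mulrA divff // mul1r normfV lef_pV2 ?posrE //.
  exact: lt_le_trans p1.
split => //.
  split; first by rewrite ger0_norm // (le_trans wh) // ler_wpM2r.
  apply: (le_trans Ab); apply: (@le_trans _ _ (dist_cst * (hi G * tau `^ delta))).
    by rewrite ler_wpM2l.
  by rewrite mulrA [dist_cst * _]mulrC ler_wpM2r.
split.
  apply: (@le_trans _ _ (hi G * tau `^ delta / gap G ^+ 2)).
    by apply: ler_normM_bound; rewrite ger0_norm.
  by rewrite mulrAC ler_wpM2r.
rewrite Be.
have -> : derive1 A x * (tau * den g x ^+ 2)^-1 +
   A x * (- (2 * tau * den g x * g 1 0) / (tau * den g x ^+ 2) ^+ 2) =
   (derive1 A x + A x * (- 2 * (g 1 0 / den g x))) * (tau * den g x ^+ 2)^-1.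
  by field; rewrite d0 lt0r_neq0.
have -> : amp_cst * tau `^ delta =
   (dist_cst * (hi G * tau `^ delta) + (hi G * tau `^ delta) * (2 * (gap G)^-1)) * (gap G ^+ 2)^-1.
  by rewrite /amp_cst; ring.
apply: ler_normM_bound; last by rewrite ger0_norm.
apply: le_trans (ler_normD _ _) _; apply: lerD.
  by apply: (le_trans Ab); rewrite ler_wpM2l.
apply: ler_normM_bound; first by rewrite ger0_norm.
by apply: ler_normM_bound => //; rewrite normrN ger0_norm.
Qed.

(** A disk that contains no pole of a word lies on one side of the pole, so the
    affine function vanishing at the pole has a constant sign on it. *)
Lemma pole_side b u e : reduced (b :: u) -> e != bar b ->
  exists2 s : R, s = 1 \/ s = -1 & forall x, disk e x ->
    gap G <= s * (x - pole (wmat (b :: u))) <= 2 * bnd G.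
Proof.
move=> ru eb; set p := pole _.
have dp : disk (bar b) p := wmat_pole ru.
have np : ~~ disk e p by apply: disk_disjoint dp; rewrite eq_sym.
exists (if p <= ctr e then 1 else -1); first by case: ifP; [left | right].
move=> x ex; have := pole_dist ru eb ex; rewrite -/p.
move: np ex; rewrite /disk -ltNge => np.
rewrite ler_norml => /andP[x1 x2].
have [pc|pc] := leP p (ctr e).
  have : rad e < ctr e - p by move: np; rewrite ler0_norm ?opprB // subr_le0.
  by move=> h; rewrite mul1r ger0_norm //; lra.
have : rad e < p - ctr e by move: np; rewrite ger0_norm // subr_ge0 ltW.
by move=> h; rewrite mulN1r ler0_norm //; lra.
Qed.

End amplitudes.

Arguments dist_cst {R} G.
Arguments amp_cst {R} G.

(** * Riesz energy of the poles *)

Section riesz_energy.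
Context {R : realType}.

(** The last dyadic threshold not smaller than d alone gives the bound. *)
Lemma dyadic_cover (M d : R) K : d <= M -> M * 2^-1 ^+ K < d -> 0 < d ->
  (Num.sqrt d)^-1 <= \sum_(k < K)
    (Num.sqrt (M * 2^-1 ^+ k / 2))^-1 * (d <= M * 2^-1 ^+ k)%R%:R.
Proof.
move=> dM + d0; elim: K => [|K IH]; first by rewrite expr0 mulr1 ltNge dM.
move=> h; rewrite big_ord_recr /=.
have M0 : 0 < M := lt_le_trans d0 dM.
have r0 : 0 < M * 2^-1 ^+ K / 2 by rewrite divr_gt0 // mulr_gt0 // exprn_gt0 // invr_gt0.
have [dK|dK] := leP d (M * 2^-1 ^+ K).
  rewrite mulr1; apply: ler_wpDl.
    by apply: sumr_ge0 => k _; rewrite mulr_ge0 // invr_ge0 sqrtr_ge0.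
  rewrite lef_pV2 ?posrE ?sqrtr_gt0 // ler_wsqrtr //.
  by move: h; rewrite exprSr mulrA => /ltW.
by rewrite mulr0 addr0 IH.
Qed.

Lemma geometric_bound (q : R) K : 0 <= q < 1 -> \sum_(k < K) q ^+ k <= (1 - q)^-1.
Proof.
move=> /andP[q0 q1]; have q1' : 0 < 1 - q by rewrite subr_gt0.
rewrite -[leRHS]mul1r ler_pdivlMr // mulrC.
have := subrX1 q K; rewrite -opprB -[q - 1]opprB mulNr => /oppr_inj <-.
by rewrite lerBlDr lerDl exprn_ge0.
Qed.

Lemma exists_half_pow (M d : R) : 0 < M -> 0 < d -> exists K, M * 2^-1 ^+ K < d.
Proof.
move=> M0 d0; exists (Num.truncn (M / d)).+1.
have h : M / d < 2 ^+ (Num.truncn (M / d)).+1.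
  apply: lt_trans (truncnS_gt _) _.
  by rewrite -natrX ltr_nat ltn_expl.
rewrite exprVn ltr_pdivrMr ?exprn_gt0 // mulrC -ltr_pdivrMr //.
Qed.

End riesz_energy.

Section section_sums.
Context {R : realType} {G : pingpong R} {delta : R}.
Hypothesis delta01 : 0 < delta < 1.
Hypothesis delta12 : 1 / 2 < delta.
Variable D : conformal_density G delta.
Implicit Types (b e : G) (u v w : seq G) (x y : R).

Let b1 := bnd_ge1 G.
Let g0 := gap_gt0 G.

Definition ratio : R := 2^-1 `^ (delta - 1 / 2).

Lemma ratio_lt1 : 0 <= ratio < 1.
Proof.
rewrite powR_ge0 /ratio /=; have h := delta12.
rewrite /powR ifF ?expR_lt1; last by apply/negbTE; rewrite invr_eq0.
by rewrite pmulr_rlt0 ?ln_lt0 ?subr_gt0 // invr_gt0 ltr0n /= invf_lt1 // ltr1n.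
Qed.

Definition scale_cst : R := 1 + (csep G / kappa G)^-1.

Definition riesz_cst : R :=
  count_cst G * scale_cst * Num.sqrt 2 * (2 * bnd G) `^ (delta - 1 / 2) / (1 - ratio).

Variables (tau : R) (L : seq (seq G)).
Hypothesis tau01 : 0 < tau <= 1.
Hypothesis uL : uniq L.
Hypothesis HL : {in L, forall v, [/\ proper v, 1 <= tau * (wmat v 1 0) ^+ 2
  & tau * (wmat v 1 0) ^+ 2 <= kappa G]}.

Let tau0 : 0 < tau. Proof. by case/andP: tau01. Qed.
Let tp : 0 <= tau `^ delta. Proof. exact: powR_ge0. Qed.

Let sep0 : 0 < csep G / kappa G.
Proof. exact: divr_gt0 (csep_gt0 G) (kappa_gt0 (G := G)). Qed.

Lemma count_cst_ge0 : 0 <= count_cst G.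
Proof.
have k0 := kappa_gt0 (G := G); have m0 := mass_min_gt0 G; have l0 := lo_gt0 G.
have F0 := le_trans ler01 (frostman_cst_ge1 (G := G)).
have kc : 0 < kappa G / csep G := divr_gt0 k0 (csep_gt0 G).
rewrite /count_cst; apply: divr_ge0; last exact: ltW (mulr_gt0 (divr_gt0 l0 k0) m0).
apply: divr_ge0; last exact: ltW.
apply: mulr_ge0 => //; apply: addr_ge0 => //; apply: divr_ge0; last exact: ltW.
by apply: mulr_ge0 => //; exact: ltW.
Qed.

Lemma riesz_cst_ge0 : 0 <= riesz_cst.
Proof.
have /andP[_ q1] := ratio_lt1.
apply: divr_ge0; last by rewrite subr_ge0 ltW.
apply: mulr_ge0 (powR_ge0 _ _); apply: mulr_ge0 (sqrtr_ge0 _).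
by apply: mulr_ge0 count_cst_ge0 _; rewrite /scale_cst addr_ge0 // invr_ge0 ltW.
Qed.

Lemma word_dist w v : w \in L -> v \in L ->
  `|pole (wmat w) - pole (wmat v)| <= 2 * bnd G.
Proof.
move=> /HL[/properE[b [u [-> ru]]] _ _] /HL[/properE[c [u' [-> rv]]] _ _].
apply: le_trans (ler_normB _ _) _.
by have := disk_bnd (wmat_pole ru); have := disk_bnd (wmat_pole rv); lra.
Qed.

(** Since delta > 1/2, the discrete Riesz energy of order 1/2 of the poles is
    bounded: sum the pole count over dyadic distances. *)
Lemma riesz_sum w : w \in L ->
  \sum_(v <- L | v != w) tau `^ delta / Num.sqrt `|pole (wmat w) - pole (wmat v)| <= riesz_cst.
Proof.
move=> wL; set M := 2 * bnd G; set p := fun v => pole (wmat v).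
have M0 : 0 < M by rewrite mulr_gt0 // (lt_le_trans ltr01 b1).
set rho := csep G / kappa G * tau; have rho0 : 0 < rho by rewrite mulr_gt0.
have sep v : v \in L -> v != w -> rho <= `|p w - p v|.
  move=> vL vw; rewrite /rho mulrAC.
  by apply: (pole_sep_section tau01 HL wL vL); rewrite eq_sym.
have [K hK] := exists_half_pow M0 rho0.
pose r k := M * 2^-1 ^+ k : R.
have r0 k : 0 < r k by rewrite mulr_gt0 // exprn_gt0 // invr_gt0.
have scale_ge1 : 1 <= scale_cst by rewrite /scale_cst lerDl invr_ge0 ltW.
have C0 : 0 <= count_cst G * scale_cst.
  exact: mulr_ge0 count_cst_ge0 (le_trans ler01 scale_ge1).
have inner k : \sum_(v <- L | v != w) tau `^ delta * (`|p w - p v| <= r k)%R%:R <=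
    count_cst G * scale_cst * r k `^ delta.
  have [kr|kr] := ltP (r k) rho.
    rewrite big_seq_cond big1; first exact: mulr_ge0 C0 (powR_ge0 _ _).
    move=> v /andP[vL vw]; have h := sep v vL vw.
    by rewrite leNgt (lt_le_trans kr h) mulr0.
  apply: (@le_trans _ _ ((\sum_(v <- L) (within (r k) (p w) (p v))%:R) * tau `^ delta)).
    rewrite mulr_suml big_mkcond /=; apply: ler_sum => v _.
    rewrite /within distrC [leRHS]mulrC; case: ifP => // _.
    by rewrite mulr_ge0.
  apply: le_trans (pole_count delta01 D (p w) tau01 (ltW (r0 k)) uL HL) _.
  rewrite -mulrA; apply: (ler_wpM2l count_cst_ge0).
  apply: (@le_trans _ _ ((scale_cst * r k) `^ delta)).
    have [d0 _] := andP delta01.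
    apply: ge0_ler_powR; rewrite ?nnegrE ?(ltW d0) //.
    - by rewrite addr_ge0 // ltW.
    - by rewrite mulr_ge0 ?(le_trans ler01 scale_ge1) // ltW.
    rewrite /scale_cst mulrDl mul1r lerD2l mulrC ler_pdivlMr //.
    by rewrite mulrC.
  exact: (powR_le_mul delta01 scale_ge1 (ltW (r0 k))).
apply: (@le_trans _ _ (\sum_(v <- L | v != w) \sum_(k < K) (Num.sqrt (r k / 2))^-1 *
    (tau `^ delta * (`|p w - p v| <= r k)%R%:R))).
  rewrite big_seq_cond [leRHS]big_seq_cond; apply: ler_sum => v /andP[vL vw].
  under [leRHS]eq_bigr do rewrite mulrCA.
  rewrite -mulr_sumr ler_wpM2l //; apply: dyadic_cover.
  - exact: word_dist.
  - exact: lt_le_trans hK (sep v vL vw).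
  - exact: lt_le_trans rho0 (sep v vL vw).
rewrite exchange_big /=; under eq_bigr do rewrite -mulr_sumr.
apply: (@le_trans _ _ (\sum_(k < K) count_cst G * scale_cst * Num.sqrt 2 *
    M `^ (delta - 1 / 2) * ratio ^+ k)).
  apply: ler_sum => k _.
  apply: (@le_trans _ _ ((Num.sqrt (r k / 2))^-1 * (count_cst G * scale_cst * r k `^ delta))).
    by rewrite ler_wpM2l // invr_ge0 sqrtr_ge0.
  have e1 : r k `^ delta = Num.sqrt (r k) * r k `^ (delta - 1 / 2).
    rewrite -powR12_sqrt ?(ltW (r0 k)) // -powRD; last by apply/implyP => _; rewrite gt_eqF.
    by congr (_ `^ _); rewrite div1r addrC subrK.
  have e2 : r k `^ (delta - 1 / 2) = M `^ (delta - 1 / 2) * ratio ^+ k.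
    rewrite powRM ?(ltW M0) ?exprn_ge0 ?invr_ge0 //; congr (_ * _).
    by rewrite /ratio -(@powR_mulrn _ 2^-1 k) ?invr_ge0 // -powRrM mulrC powRrM powR_mulrn ?powR_ge0.
  rewrite e1 e2 sqrtrM ?(ltW (r0 k)) // sqrtrV //.
  have s2 : Num.sqrt (2 : R) != 0 by rewrite sqrtr_eq0 -ltNge.
  have sr : Num.sqrt (r k) != 0 by rewrite sqrtr_eq0 -ltNge.
  rewrite le_eqVlt; apply/orP; left; apply/eqP.
  by field; rewrite s2 sr.
rewrite -mulr_sumr /riesz_cst -/M ler_wpM2l ?geometric_bound ?ratio_lt1 //.
exact: mulr_ge0 (mulr_ge0 C0 (sqrtr_ge0 _)) (powR_ge0 _ _).
Qed.

Definition total_cst : R := count_cst G * (bnd G + 1).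

Lemma total_cst_ge0 : 0 <= total_cst.
Proof. by rewrite mulr_ge0 ?count_cst_ge0 // addr_ge0 // (le_trans ler01 b1). Qed.

Lemma total_count : \sum_(w <- L) tau `^ delta <= total_cst.
Proof.
have [_ t1] := andP tau01; have b0 := le_trans ler01 b1.
have [d0 d1] := andP delta01.
apply: (@le_trans _ _ (count_cst G * (bnd G + tau) `^ delta)).
  apply: le_trans (pole_count delta01 D 0 tau01 b0 uL HL).
  rewrite mulr_suml big_seq [leRHS]big_seq; apply: ler_sum => w /HL[/properE[b [u [-> ru]]] _ _].
  by rewrite /within subr0 (disk_bnd (wmat_pole ru)) mul1r.
apply: (ler_wpM2l count_cst_ge0); apply: (@le_trans _ _ ((bnd G + 1) `^ delta)).
  by apply: ge0_ler_powR; rewrite ?nnegrE ?(ltW d0) ?lerD2l ?addr_ge0 // ltW.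
by rewrite ler1_powR ?(ltW d1) // ler_wpDl.
Qed.

End section_sums.

Arguments riesz_cst {R} G delta.
Arguments total_cst {R} G.

(** * Lebesgue integral of the energy *)

Section energy_primitive.
Context {R : realType} {G : pingpong R} {delta : R}.
Hypothesis delta01 : 0 < delta < 1.
Hypothesis delta12 : 1 / 2 < delta.
Variable D : conformal_density G delta.
Implicit Types (b e : G) (u v w : seq G) (x y : R).

Let b1 := bnd_ge1 G.
Let g0 := gap_gt0 G.

Variables (tau : R) (L : seq (seq G)).
Hypothesis tau01 : 0 < tau <= 1.
Hypothesis uL : uniq L.
Hypothesis HL : {in L, forall v, [/\ proper v, 1 <= tau * (wmat v 1 0) ^+ 2
  & tau * (wmat v 1 0) ^+ 2 <= kappa G]}.

Let tau0 : 0 < tau. Proof. by case/andP: tau01. Qed.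

(** The words of the section that may be applied to the disk of [e]. *)
Definition composable e w := if w is b :: u then e != bar b else false.

Definition section_at e := [seq w <- L | composable e w].

Lemma section_atP e w : w \in section_at e ->
  exists b u, [/\ w = b :: u, reduced (b :: u), e != bar b,
    1 <= tau * (wmat w 1 0) ^+ 2 & tau * (wmat w 1 0) ^+ 2 <= kappa G].
Proof.
rewrite mem_filter => /andP[+ wL]; have [/properE[b [u [-> ru]]] h1 h2] := HL wL.
by exists b, u.
Qed.

Definition phase (omega : R) w x := omega * moeb (wmat w) x.

Lemma der_phase omega e w x : w \in section_at e -> disk e x ->
  is_derive x 1 (phase omega w) (omega * den (wmat w) x ^- 2).
Proof.
move=> /section_atP[b [u [-> ru eb _ _]]] ex; apply: derZ.
by apply: der_moeb; [exact: det_wmat | exact: (wmat_disk ru (disk_disjoint eb ex)).1].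
Qed.

Lemma diskE e x : disk e x = (ctr e - rad e <= x <= ctr e + rad e).
Proof. by rewrite /disk ler_distl. Qed.

(** Multiplied by tau, the squared denominators of the words of the section have
    the normal form of [pair_bound], with slopes between 1 and a constant. *)
Let word_scale e w : w \in section_at e -> exists k s : R,
  [/\ 1 <= k <= 1 + Num.sqrt (kappa G), s = 1 \/ s = -1,
    (forall x, disk e x -> gap G <= s * (x - pole (wmat w)) <= 2 * bnd G) &
    forall x, disk e x ->
      (k * (s * (x - pole (wmat w)))) ^+ 2 = tau * den (wmat w) x ^+ 2].
Proof.
move=> ws; have [b [u [ew ru eb h1 h2]]] := section_atP ws; rewrite ew in h1 h2 *.
have [c0 _] := wmat_infty ru; have [s hs Hs] := pole_side ru eb.
exists (Num.sqrt (tau * (wmat (b :: u) 1 0) ^+ 2)), s; split => //.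
  by rewrite -[X in X <= _ <= _]sqrtr1 ler_wsqrtr // ler_wpDl // ler_wsqrtr.
move=> x ex; rewrite !exprMn sqr_sqrtr; last exact: le_trans h1.
have -> : s ^+ 2 = 1 by case: hs => ->; rewrite ?sqrrN expr1n.
by rewrite den_pole //; ring.
Qed.

Definition vdc_cst : R := pair_cst (gap G) (2 * bnd G) (1 + Num.sqrt (kappa G)).

Definition energy_cst : R := 2 * amp_cst G ^+ 2 * total_cst G *
  (2 * bnd G + vdc_cst * riesz_cst G delta).

Variables (e : G) (al al' : seq G -> R -> R) (omega : R).
Hypothesis omega0 : 0 < omega.
Hypothesis alP : forall x, disk e x -> {in section_at e, forall w,
  [/\ is_derive x 1 (al w) (al' w x), `|al w x| <= amp_cst G * tau `^ delta
    & `|al' w x| <= amp_cst G * tau `^ delta]}.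

Local Notation u0 := (ctr e - rad e).
Local Notation v0 := (ctr e + rad e).
Local Notation s := (section_at e).
Let t := tau `^ delta.
Let m := 2 * (amp_cst G * t) ^+ 2.

Let rad0 : 0 < rad e. Proof. exact: lt_le_trans g0 (gap_rad e). Qed.
Let uv0 : u0 <= v0. Proof. by have := rad0; lra. Qed.
Let t0 : 0 <= t. Proof. exact: powR_ge0. Qed.
Let m0 : 0 <= m. Proof. by rewrite mulr_ge0 ?sqr_ge0. Qed.

Let pair w z x := al w x * al z x.
Let pair' w z x := al' w x * al z x + al w x * al' z x.
Let dph w z x := phase omega w x - phase omega z x.

Let pair_der w z x : w \in s -> z \in s -> disk e x ->
  [/\ is_derive x 1 (pair w z) (pair' w z x), `|pair w z x| <= m & `|pair' w z x| <= m].
Proof.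
move=> ws zs ex; have [d1 a1 a2] := alP ex ws; have [d2 a3 a4] := alP ex zs.
have p1 := ler_normM_bound a1 a3.
split; first exact: derM.
  by apply: (le_trans p1); rewrite /m -expr2 ler_peMl ?sqr_ge0 // ler1n.
have -> : m = amp_cst G * t * (amp_cst G * t) + amp_cst G * t * (amp_cst G * t).
  by rewrite /m; ring.
apply: le_trans (ler_normD _ _) _; apply: lerD; exact: ler_normM_bound.
Qed.

Let dph_der w z x : w \in s -> z \in s -> disk e x ->
  is_derive x 1 (dph w z) (omega * den (wmat w) x ^- 2 - omega * den (wmat z) x ^- 2).
Proof. by move=> ws zs ex; exact: derB (der_phase omega ws ex) (der_phase omega zs ex). Qed.

Let pair_primitive_le w z P : w \in s -> z \in s ->
  (forall x, disk e x -> is_derive x 1 P (pair w z x * cos (dph w z x))) ->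
  P v0 - P u0 <= if z == w then m * (2 * bnd G) else
    vdc_cst * m / Num.sqrt (omega * tau * `|pole (wmat w) - pole (wmat z)|).
Proof.
move=> ws zs dP; apply: le_trans (ler_norm _) _.
have J x : u0 <= x <= v0 -> disk e x by rewrite diskE.
have dP' x : u0 <= x <= v0 -> is_derive x 1 P (pair w z x * cos (dph w z x)).
  by move/J; exact: dP.
have [_|zw] := eqVneq z w.
  apply: le_trans (trivial_bound uv0 dP' (m := m) _) _.
    by move=> x /J ex; have [] := pair_der ws zs ex.
  rewrite ler_wpM2l //.
  have eu : disk e u0 by rewrite diskE lexx uv0.
  have ev : disk e v0 by rewrite diskE lexx uv0.
  apply: le_trans (ler_norm _) _; apply: le_trans (ler_normB _ _) _.
  by have := disk_bnd eu; have := disk_bnd ev; lra.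
have [k1 [s1 [k1b s1P D1 E1]]] := word_scale ws.
have [k2 [s2 [k2b s2P D2 E2]]] := word_scale zs.
have S1 : 1 <= 1 + Num.sqrt (kappa G) by rewrite lerDl sqrtr_ge0.
have M1 : 1 <= 2 * bnd G by have := b1; lra.
have wL : w \in L by move: ws; rewrite mem_filter => /andP[].
have zL : z \in L by move: zs; rewrite mem_filter => /andP[].
have pne : pole (wmat w) != pole (wmat z).
  rewrite -subr_eq0 -normr_gt0; apply: lt_le_trans (pole_sep_section tau01 HL wL zL _).
    exact: divr_gt0 (mulr_gt0 (csep_gt0 G) tau0) (kappa_gt0 (G := G)).
  by rewrite eq_sym.
apply: (pair_bound g0 M1 S1 uv0 (mulr_gt0 omega0 tau0) k1b k2b s1P s2P pne
  (word_dist HL wL zL) (fun x h => D1 x (J x h)) (fun x h => D2 x (J x h)) dP' (psi := dph w z) (B := pair w z) (B' := pair' w z)).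
- move=> x /J ex; apply: (der_eq (dph_der ws zs ex)).
  have d1 : den (wmat w) x != 0.
    have [b [u [ew ru eb _ _]]] := section_atP ws; rewrite ew.
    exact: (wmat_disk ru (disk_disjoint eb ex)).1.
  have d2 : den (wmat z) x != 0.
    have [b [u [ew ru eb _ _]]] := section_atP zs; rewrite ew.
    exact: (wmat_disk ru (disk_disjoint eb ex)).1.
  by rewrite E1 // E2 //; have tn := lt0r_neq0 tau0; field; rewrite d1 d2 tn.
- by move=> x /J ex; have [] := pair_der ws zs ex.
- by move=> x /J ex; have [] := pair_der ws zs ex.
Qed.

(** The integral over a disk of the energy of the sum over the section. The
    diagonal contributes (size L) tau^(2 delta), which is of order tau^delta; a pair
    of distinct words contributes tau^(2 delta) (omega tau d)^(-1/2), with d the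
    distance of the poles, and these are summed by [riesz_sum]. *)
Lemma energy_primitive : exists P : R -> R,
  (forall x, disk e x -> is_derive x 1 P (energy s al (phase omega) x)) /\
  P v0 - P u0 <= energy_cst * (t + (Num.sqrt (omega * tau))^-1).
Proof.
have J x : u0 <= x <= v0 -> disk e x by rewrite diskE.
have /choice[PP HPP] : forall wz : seq G * seq G, exists P : R -> R,
    wz.1 \in s -> wz.2 \in s -> forall x, disk e x ->
    is_derive x 1 P (pair wz.1 wz.2 x * cos (dph wz.1 wz.2 x)).
  move=> [w z] /=; have [ws|] := boolP (w \in s); last by exists (fun=> 0).
  have [zs|] := boolP (z \in s); last by exists (fun=> 0).
  have [|P HP] := @primitive_exists R (fun x => pair w z x * cos (dph w z x)) u0 v0 uv0.
    move=> x /J ex; have [d1 _ _] := pair_der ws zs ex.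
    exact: der_continuous (derM d1 (der_cos (dph_der ws zs ex))).
  by exists P => _ _ x ex; apply: HP; rewrite -diskE.
exists (fun x => \sum_(w <- s) \sum_(z <- s) PP (w, z) x); split.
  move=> x ex; rewrite energyE.
  apply: der_sum => w ws; apply: der_sum => z zs; exact: (HPP (w, z)).
rewrite -sumrB.
have vc0 : 0 <= vdc_cst.
  by apply: pair_cst_ge0 => //; [have := b1; lra | rewrite lerDl sqrtr_ge0].
have sW : 0 < Num.sqrt (omega * tau) by rewrite sqrtr_gt0 mulr_gt0.
pose T w z := if z == w then m * (2 * bnd G) else
    vdc_cst * m / Num.sqrt (omega * tau * `|pole (wmat w) - pole (wmat z)|).
have T0 w z : 0 <= T w z.
  rewrite /T; case: ifP => _; last by rewrite divr_ge0 ?sqrtr_ge0 // mulr_ge0.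
  by rewrite mulr_ge0 // mulr_ge0 // (le_trans ler01 b1).
apply: (@le_trans _ _ (\sum_(w <- L) \sum_(z <- L) T w z)).
  apply: (@le_trans _ _ (\sum_(w <- s) \sum_(z <- s) T w z)).
    rewrite big_seq [leRHS]big_seq; apply: ler_sum => w ws.
    rewrite -sumrB big_seq [leRHS]big_seq; apply: ler_sum => z zs.
    by apply: pair_primitive_le => // x ex; exact: (HPP (w, z)).
  rewrite big_filter big_mkcond /=; apply: ler_sum => w _.
  case: ifP => _; last exact: sumr_ge0.
  rewrite big_filter big_mkcond /=; apply: ler_sum => z _.
  by case: ifP.
set A := amp_cst G; set r := riesz_cst G delta.
apply: (@le_trans _ _ (\sum_(w <- L) t * (2 * A ^+ 2 *
   (2 * bnd G * t + vdc_cst * r / Num.sqrt (omega * tau))))).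
  rewrite big_seq [leRHS]big_seq; apply: ler_sum => w wL.
  rewrite (bigD1_seq w) //= {1}/T eqxx.
  have -> : t * (2 * A ^+ 2 * (2 * bnd G * t + vdc_cst * r / Num.sqrt (omega * tau))) =
    m * (2 * bnd G) + 2 * A ^+ 2 * t * vdc_cst / Num.sqrt (omega * tau) * r.
    by rewrite /m -/A; ring.
  rewrite lerD2l; apply: le_trans (ler_wpM2l _ (riesz_sum delta01 delta12 D tau01 uL HL wL)).
    rewrite mulr_sumr le_eqVlt; apply/orP; left; apply/eqP; apply: eq_bigr => z /negbTE zw.
    rewrite /T zw sqrtrM ?(mulr_ge0 (ltW omega0) (ltW tau0)) // invfM /m -/A -/t; ring.
  apply: divr_ge0; last exact: sqrtr_ge0.
  by apply: mulr_ge0 vc0; apply: mulr_ge0 t0; rewrite mulr_ge0 ?sqr_ge0.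
rewrite -mulr_suml; have tc := total_count delta01 D tau01 uL HL.
have r0 : 0 <= r := riesz_cst_ge0 delta12.
have A0 : 0 <= 2 * A ^+ 2 by rewrite mulr_ge0 ?sqr_ge0.
have bb : 0 <= 2 * bnd G by have := b1; lra.
have vr : 0 <= vdc_cst * r by exact: mulr_ge0.
have si : 0 <= (Num.sqrt (omega * tau))^-1 by rewrite invr_ge0 ltW.
apply: (@le_trans _ _ (total_cst G * (2 * A ^+ 2 *
    (2 * bnd G * t + vdc_cst * r / Num.sqrt (omega * tau))))).
  apply: ler_wpM2r tc; apply: mulr_ge0 => //.
  by apply: addr_ge0; exact: mulr_ge0.
have T1 : 0 <= total_cst G := total_cst_ge0.
set i := (Num.sqrt _)^-1 in si *; rewrite /energy_cst -/A -/r.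
have -> : 2 * A ^+ 2 * total_cst G * (2 * bnd G + vdc_cst * r) * (t + i) =
  total_cst G * (2 * A ^+ 2 * ((2 * bnd G + vdc_cst * r) * (t + i))) by ring.
apply: ler_wpM2l => //; apply: ler_wpM2l => //; rewrite [leRHS]mulrDl.
by apply: lerD; apply: ler_wpM2l; rewrite ?lerDl ?lerDr.
Qed.

End energy_primitive.

Arguments vdc_cst {R} G.
Arguments energy_cst {R} G delta.

(** * Decay for a conformal density *)

Section choice_of_scale.
Context {R : realType}.

Definition decay_exponent (delta : R) : R :=
  delta * (2 * delta - 1) / ((2 * delta + 1) * (3 - delta)).

Lemma decay_exponent_le (delta : R) : 1 / 2 < delta -> delta < 1 ->
  decay_exponent delta * 2 <= delta * (2 * delta - 1) * (2 * delta + 1)^-1.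
Proof.
move=> d12 d1.
have -> : decay_exponent delta * 2 =
  delta * (2 * delta - 1) * (2 * delta + 1)^-1 * (2 / (3 - delta)).
  by rewrite /decay_exponent; field; apply/andP; split; rewrite gt_eqF //; lra.
apply: ler_piMr; last by rewrite ler_pdivrMr; lra.
by apply: mulr_ge0; [apply: mulr_ge0; lra | rewrite invr_ge0; lra].
Qed.

(** The choice tau = X^(-1 / (2 delta + 1)) balances the diagonal against the
    oscillatory terms. It gives a decay of order delta (2 delta - 1) / (2 (2 delta + 1)),
    which is better than [decay_exponent] since 2 < 3 - delta. *)
Lemma choice_of_scale (delta c X : R) : 1 / 2 < delta -> delta < 1 -> 1 <= c -> 1 <= X ->
  exists tau, [/\ 0 < tau <= 1, 1 <= c * X * tau &
    (c * X * tau) `^ (1 - delta) * (tau `^ delta + (Num.sqrt (c * X * tau))^-1) <=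
    2 * c * (X `^ (- decay_exponent delta)) ^+ 2].
Proof.
move=> d12 d1 c1 X1.
have X0 : 0 < X := lt_le_trans ltr01 X1.
have c0 : 0 < c := lt_le_trans ltr01 c1.
have Xpow (a a' : R) : X `^ a * X `^ a' = X `^ (a + a').
  by rewrite powRD //; apply/implyP => _; rewrite gt_eqF.
have [k kE] : exists k : R, k = (2 * delta + 1)^-1 by eexists.
have k0 : 0 < k by rewrite kE invr_gt0; lra.
have kE' : k * (2 * delta + 1) = 1 by rewrite kE mulVf // gt_eqF //; lra.
have dk0 : 0 <= 2 * delta * k by apply: mulr_ge0; lra.
have [tau tE] : exists tau, tau = X `^ (- k) by eexists.
have [V VE] : exists V, V = X `^ (2 * delta * k) by eexists.
have t0 : 0 < tau by rewrite tE powR_gt0.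
have t1 : tau <= 1 by rewrite tE -(powRr0 X); apply: ler_powR X1 _ _ _; lra.
have V1 : 1 <= V by rewrite VE -{1}(powRr0 X); exact: ler_powR X1 _ _ dk0.
have V0 : 0 < V := lt_le_trans ltr01 V1.
have WV : c * X * tau = c * V.
  rewrite tE VE -mulrA -{1}(powRr1 (ltW X0)) Xpow; congr (_ * _ `^ _); lra.
exists tau; rewrite WV; split; first by rewrite t0 t1.
  by rewrite -[leLHS]mulr1; apply: ler_pM => //; exact: ler01.
have [v vE] : exists v, v = V `^ (- (1 / 2)) by eexists.
have [g gE] : exists g, g = V `^ (1 - delta) by eexists.
have v0 : 0 <= v by rewrite vE powR_ge0.
have tV : tau `^ delta = v.
  by rewrite vE tE VE -!powRrM; congr (_ `^ _); field.
have sV : (Num.sqrt (c * V))^-1 <= v.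
  have sV0 : 0 < Num.sqrt V by rewrite sqrtr_gt0.
  have scV0 : 0 < Num.sqrt (c * V) by rewrite sqrtr_gt0 mulr_gt0.
  rewrite vE powRN div1r powR12_sqrt ?(ltW V0) // lef_pV2 ?posrE //.
  by rewrite ler_wsqrtr // ler_peMl // ltW.
have wV : (c * V) `^ (1 - delta) <= c * g.
  rewrite powRM ?(ltW V0) ?(ltW c0) // -gE ler_wpM2r //; first by rewrite gE powR_ge0.
  by apply: ler1_powR => //; lra.
have gv : g * v <= (X `^ (- decay_exponent delta)) ^+ 2.
  rewrite gE vE VE -!powRrM Xpow -powR_mulrn ?powR_ge0 // -powRrM.
  apply: ler_powR X1 _ _ _.
  have -> : 2 * delta * k * (1 - delta) + 2 * delta * k * - (1 / 2) =
    - (delta * (2 * delta - 1) * k) by field.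
  by rewrite mulNr lerN2 kE decay_exponent_le.
have w0 : 0 <= (c * V) `^ (1 - delta) by exact: powR_ge0.
have s0 : 0 <= (Num.sqrt (c * V))^-1 by rewrite invr_ge0 sqrtr_ge0.
rewrite tV; apply: (@le_trans _ _ (c * g * (v + v))).
  by apply: ler_pM => //; [exact: addr_ge0 | rewrite lerD2l].
have -> : c * g * (v + v) = 2 * c * (g * v) by ring.
by apply: ler_wpM2l => //; apply: mulr_ge0 => //; exact: ltW.
Qed.

End choice_of_scale.


Section decay.
Context {R : realType} {G : pingpong R} {delta : R}.
Hypothesis delta01 : 0 < delta < 1.
Hypothesis delta12 : 1 / 2 < delta.
Variable D : conformal_density G delta.
Implicit Types (b e : G) (u v w : seq G) (x y : R).
Local Notation E := (integ D).

Let b1 := bnd_ge1 G.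
Let g0 := gap_gt0 G.

Definition sup_cst : R := amp_cst G * total_cst G.

Definition disk_cst : R := frostman_cst G *
  (energy_cst G delta * (3 + (2 * gap G)^-1) + 8 * sup_cst ^+ 2 * bnd G).

Lemma energy_cst_ge0 : 0 <= energy_cst G delta.
Proof.
have [_ _ _ a1] := amp_cst_parts (G := G).
apply: mulr_ge0.
  by apply: mulr_ge0; [rewrite mulr_ge0 ?sqr_ge0 | exact: total_cst_ge0].
apply: addr_ge0; first by rewrite mulr_ge0 // (le_trans ler01 b1).
apply: mulr_ge0; last exact: (riesz_cst_ge0 delta12).
by apply: pair_cst_ge0 => //; [have := b1; lra | rewrite lerDl sqrtr_ge0].
Qed.

Lemma disk_cst_ge0 : 0 <= disk_cst.
Proof.
have F0 := le_trans ler01 (frostman_cst_ge1 (G := G)).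
have bb := le_trans ler01 b1.
apply: mulr_ge0 => //; apply: addr_ge0; last first.
  by apply: mulr_ge0 => //; apply: mulr_ge0 => //; exact: sqr_ge0.
apply: mulr_ge0 energy_cst_ge0 _; apply: addr_ge0 => //.
by rewrite invr_ge0 mulr_ge0 // ltW.
Qed.

Section fixed_scale.
Variables (tau omega : R) (L : seq (seq G)).
Hypothesis tau01 : 0 < tau <= 1.
Hypothesis omega0 : 0 < omega.
Hypothesis W1 : 1 <= omega * tau.
Hypothesis uL : uniq L.
Hypothesis HL : {in L, forall v, [/\ proper v, 1 <= tau * (wmat v 1 0) ^+ 2
  & tau * (wmat v 1 0) ^+ 2 <= kappa G]}.

Local Notation W := (omega * tau).
Local Notation t := (tau `^ delta).
Local Notation amp := (fun w => weight delta (wmat w)).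
Let z := t + (Num.sqrt W)^-1.

Let tau0 : 0 < tau. Proof. by case/andP: tau01. Qed.
Let W0 : 0 < W. Proof. exact: lt_le_trans W1. Qed.

Let Wz_ge1 : 1 <= W * z.
Proof.
have s1 : 1 <= Num.sqrt W by rewrite -[leLHS]sqrtr1 ler_wsqrtr.
have s0 : 0 < Num.sqrt W := lt_le_trans ltr01 s1.
have -> : W * z = W * t + Num.sqrt W ^+ 2 / Num.sqrt W.
  by rewrite sqr_sqrtr ?(ltW W0) // /z mulrDr.
apply: ler_wpDl; first exact: mulr_ge0 (ltW W0) (powR_ge0 _ _).
by rewrite expr2 mulfK // gt_eqF.
Qed.

Let amp_sum e (al : seq G -> R -> R) x :
  {in section_at L e, forall w, `|al w x| <= amp_cst G * t} ->
  \sum_(w <- section_at L e) `|al w x| <= sup_cst.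
Proof.
have [_ _ _ a1] := amp_cst_parts (G := G).
have a0 : 0 <= amp_cst G := le_trans ler01 a1.
move=> h; apply: (@le_trans _ _ (\sum_(w <- L) amp_cst G * t)).
  rewrite big_seq; apply: (@le_trans _ _ (\sum_(w <- section_at L e) amp_cst G * t)).
    by rewrite [leRHS]big_seq; apply: ler_sum.
  rewrite big_filter big_mkcond /=; apply: ler_sum => w _.
  by case: ifP => // _; rewrite mulr_ge0 ?powR_ge0.
by rewrite -mulr_sumr /sup_cst; apply: ler_wpM2l => //; exact: (total_count delta01 D tau01 uL HL).
Qed.

Let en e x := energy (section_at L e) amp (phase omega) x.

Lemma bmf_energy e : bmf (en e).
Proof.
have ba w : bmf (weight delta (wmat w)) := bmf_weight delta01 (det_wmat w).
have Bc : bmf (csum (section_at L e) amp (phase omega)).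
  by apply: bmf_sum => w; exact: bmfM (ba w) (bmf_comp (bmf_cos omega) (measurable_moeb (wmat w))).
have Bs : bmf (ssum (section_at L e) amp (phase omega)).
  by apply: bmf_sum => w; exact: bmfM (ba w) (bmf_comp (bmf_sin omega) (measurable_moeb (wmat w))).
exact: bmfD (bmfM Bc Bc) (bmfM Bs Bs).
Qed.

Let bmf_within (r y : R) : bmf (fun x => (within r y x)%:R : R).
Proof. exact: bmf_ind (measurable_dist y r). Qed.

Let bmf_disk e : bmf (fun x => (disk e x)%:R : R).
Proof. exact: bmf_ind (measurable_disk e). Qed.

(** Replacing the density by Lebesgue measure at scale 1/W costs a factor
    W^(1 - delta); the Lebesgue integral is then the van der Corput bound. *)
Lemma disk_energy e :
  E (fun x => (disk e x)%:R * en e x) <= disk_cst * (W `^ (1 - delta) * z).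
Proof.
have [d0 d1] := andP delta01.
have sat x w : disk e x -> w \in section_at L e ->
    [/\ is_derive x 1 (amp w) (derive1 (amp w) x),
      is_derive x 1 (weight_slope (delta := delta) tau w) (derive1 (weight_slope (delta := delta) tau w) x),
     `|amp w x| <= amp_cst G * t /\ `|derive1 (amp w) x| <= amp_cst G * t
   & `|weight_slope (delta := delta) tau w x| <= amp_cst G * t /\
     `|derive1 (weight_slope (delta := delta) tau w) x| <= amp_cst G * t].
  move=> ex ws; have [b [u [ew ru eb h1 _]]] := section_atP HL ws; subst w.
  exact: (amplitude_bounds delta01 tau01 ru eb ex h1).
have [P [dP Pb]] := @energy_primitive R G delta delta01 delta12 D tau L tau01 uL HL e
  amp (fun w x => derive1 (amp w) x) omega omega0
  (fun x ex w ws => let: And4 a _ (conj b c) _ := sat x w ex ws in And3 a b c).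
have [Q [dQ Qb]] := @energy_primitive R G delta delta01 delta12 D tau L tau01 uL HL e
  (weight_slope (delta := delta) tau) (fun w x => derive1 (weight_slope (delta := delta) tau w) x) omega omega0
  (fun x ex w ws => let: And4 _ a _ (conj b c) := sat x w ex ws in And3 a b c).
set u0 := ctr e - rad e in Pb Qb; set v0 := ctr e + rad e in Pb Qb.
rewrite -/z in Pb Qb; set EC := energy_cst G delta in Pb Qb.
have r0 : 0 < rad e := lt_le_trans g0 (gap_rad e).
have len : v0 - u0 = 2 * rad e by rewrite /v0 /u0; ring.
have uv0 : u0 <= v0 by rewrite -subr_ge0 len mulr_ge0 // ltW.
have rb : rad e <= bnd G.
  have eu : disk e u0 by rewrite diskE lexx uv0.
  have ev : disk e v0 by rewrite diskE lexx uv0.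
  have := disk_bnd eu; have := disk_bnd ev; have := len.
  by rewrite !ler_norml => e1 /andP[_ e2] /andP[e3 _]; lra.
pose N := (Num.truncn (2 * rad e * W)).+1.
have N0 : 0 < N%:R :> R by rewrite ltr0n.
have NW : 2 * rad e * W < N%:R by exact: truncnS_gt.
have NW' : N%:R <= 2 * rad e * W + 1.
  by rewrite /N -natr1 lerD2r truncn_le mulr_ge0 ?(ltW W0) // mulr_ge0 // ltW.
pose h := 2 * rad e / N%:R.
have h0 : 0 < h by rewrite divr_gt0 // mulr_gt0.
have hW : h <= W^-1.
  by rewrite /h ler_pdivrMr // [leRHS]mulrC ler_pdivlMr // ltW.
have hi' : h^-1 <= W * (1 + (2 * gap G)^-1).
  have -> : h^-1 = N%:R / (2 * rad e) by rewrite /h invf_div.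
  rewrite ler_pdivrMr ?mulr_gt0 //; apply: (le_trans NW').
  have -> : W * (1 + (2 * gap G)^-1) * (2 * rad e) = 2 * rad e * W + W * (rad e / gap G).
    by field; rewrite gt_eqF.
  rewrite lerD2l -[leLHS]mulr1; apply: ler_pM => //.
  by rewrite ler_pdivlMr // mul1r; exact: gap_rad.
pose a (i : nat) := u0 + i%:R * h.
have aS i : a i.+1 = a i + h by rewrite /a -natr1 mulrDl mul1r addrA.
have aN : a N = v0 by rewrite /a /h mulrCA divff ?gt_eqF // mulr1 -len; ring.
have amono i j : (i <= j)%N -> a i <= a j.
  by move=> ij; rewrite /a lerD2l ler_wpM2r ?(ltW h0) // ler_nat.
have a0 : a 0%N = u0 by rewrite /a mul0r addr0.
pose S i := (P (a i.+1) - P (a i)) / h +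
  W * ((P (a i.+1) - P (a i)) + (Q (a i.+1) - Q (a i))) + 4 * sup_cst ^+ 2 * h.
have subd i x : (i < N)%N -> a i <= x <= a i.+1 -> disk e x.
  move=> iN /andP[x1 x2]; rewrite diskE -/u0 -/v0; apply/andP; split.
    by apply: le_trans x1; rewrite -a0 amono.
  by apply: le_trans x2 _; rewrite -aN amono.
have Sb i x : (i < N)%N -> a i <= x <= a i.+1 -> en e x <= S i.
  move=> iN xi; have SD y := @subd i y iN.
  have ai : a i < a i.+1 by rewrite aS ltrDl.
  have -> : S i = (P (a i.+1) - P (a i)) / (a i.+1 - a i) +
    W * ((P (a i.+1) - P (a i)) + (Q (a i.+1) - Q (a i))) + 4 * sup_cst ^+ 2 * (a i.+1 - a i).
    by have -> : a i.+1 - a i = h by rewrite aS addrC addKr.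
  apply: (@energy_sup R (seq G) (section_at L e) amp (fun w y => derive1 (amp w) y)
    (weight_slope (delta := delta) tau) (phase omega) (fun w y => omega * den (wmat w) y ^- 2)
    P Q W sup_cst (a i) (a i.+1) ai (ltW W0) _ _ _ _ _ _ _ x xi).
  - by move=> y /SD ey w ws; have [] := sat y w ey ws.
  - by move=> y /SD ey w ws; exact: (der_phase HL omega ws ey).
  - move=> y /SD ey w ws; have [b [u [ew ru eb _ _]]] := section_atP HL ws.
    have dn : den (wmat w) y != 0.
      by rewrite ew; exact: (wmat_disk ru (disk_disjoint eb ey)).1.
    rewrite /weight_slope; have tn := lt0r_neq0 tau0.
    by field; rewrite dn tn.
  - move=> y /SD ey; apply: (amp_sum (al := amp)) => w ws.
    by have [_ _ []] := sat y w ey ws.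
  - move=> y /SD ey; apply: (amp_sum (al := fun w => derive1 (amp w))) => w ws.
    by have [_ _ []] := sat y w ey ws.
  - by move=> y /SD; exact: dP.
  - by move=> y /SD; exact: dQ.
have S0 i : (i < N)%N -> 0 <= S i.
  move=> iN; apply: le_trans (Sb i (a i) iN _); first exact: energy_ge0.
  by rewrite lexx amono.
apply: (@le_trans _ _ (E (fun x => \sum_(i < N) S i * (within (h / 2) (a i + h / 2) x)%:R))).
  apply: integ_le.
  - exact: bmfM (bmf_disk e) (bmf_energy e).
  - by apply: bmf_sum => i; exact: bmfZ.
  move=> x _; have [ex|_] := boolP (disk e x); last first.
    by rewrite mul0r; apply: sumr_ge0 => i _; rewrite mulr_ge0 ?S0 ?ler0n.
  have [i iN xi] : exists2 i, (i < N)%N & a i <= x <= a i.+1.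
    move: (ex); rewrite diskE -/u0 -/v0 => /andP[ux xv].
    have q0 : 0 <= (x - u0) / h by rewrite divr_ge0 ?subr_ge0 // ltW.
    have /andP[k1 k2] := truncn_itv q0; set k := Num.truncn _ in k1 k2.
    rewrite ler_pdivlMr // in k1; rewrite ltr_pdivrMr // in k2.
    have ka : a k <= x by rewrite /a; lra.
    have ka' : x <= a k.+1 by rewrite /a; lra.
    have [kN|kN] := ltnP k N; first by exists k => //; rewrite ka.
    exists N.-1 => //; rewrite prednK // aN xv andbT.
    by apply: le_trans ka; apply: amono; apply: leq_trans (leq_pred _) kN.
  rewrite mul1r (bigD1 (Ordinal iN)) //= ler_wpDr //.
    by apply: sumr_ge0 => j _; rewrite mulr_ge0 ?S0 ?ler0n.
  have -> : within (h / 2) (a i + h / 2) x.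
    rewrite /within ler_distl addrK; move: xi; rewrite aS => /andP[-> x2] /=.
    by apply: le_trans x2 _; lra.
  by rewrite mulr1 Sb.
rewrite integ_sum; last by move=> i; exact: bmfZ.
have CF1 := frostman_cst_ge1 (G := G).
have CF0 : 0 <= frostman_cst G := le_trans ler01 CF1.
have hd : (h / 2) `^ delta <= W `^ (- delta).
  have -> : W `^ (- delta) = W^-1 `^ delta.
    by rewrite -[in RHS]powR_inv1 ?(ltW W0) // -powRrM mulN1r.
  apply: ge0_ler_powR; rewrite ?nnegrE ?(ltW d0) ?invr_ge0 ?(ltW W0) //.
    by rewrite divr_ge0 // ltW.
  by apply: le_trans hW; lra.
apply: (@le_trans _ _ (\sum_(i < N) S i * (frostman_cst G * W `^ (- delta)))).
  apply: ler_sum => i _; rewrite integZ // ler_wpM2l ?S0 //.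
  apply: le_trans (frostman delta01 D _ _) _; first by rewrite divr_gt0.
  by rewrite ler_wpM2l.
rewrite -mulr_suml.
have sumS : \sum_(i < N) S i = (P v0 - P u0) / h +
    W * ((P v0 - P u0) + (Q v0 - Q u0)) + 4 * sup_cst ^+ 2 * (2 * rad e).
  have tel (F : R -> R) : F v0 - F u0 = \sum_(i < N) (F (a i.+1) - F (a i)).
    by rewrite -(big_mkord xpredT (fun i => F (a i.+1) - F (a i))) telescope_sumr // aN a0.
  have -> : 4 * sup_cst ^+ 2 * (2 * rad e) = \sum_(i < N) 4 * sup_cst ^+ 2 * h.
    by rewrite sumr_const card_ord -mulr_natl /h; field; rewrite gt_eqF.
  by rewrite !tel -big_split /= mulr_suml mulr_sumr -!big_split.
have ECz : 0 <= EC * z.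
  have EC0 : 0 <= EC := energy_cst_ge0.
  by apply: mulr_ge0 => //; apply: addr_ge0; [exact: powR_ge0 | rewrite invr_ge0 sqrtr_ge0].
have SB : \sum_(i < N) S i <=
    W * z * (EC * (3 + (2 * gap G)^-1) + 8 * sup_cst ^+ 2 * bnd G).
  rewrite sumS.
  have p1 : (P v0 - P u0) / h <= W * (1 + (2 * gap G)^-1) * (EC * z).
    apply: (@le_trans _ _ (EC * z / h)); first by rewrite ler_wpM2r // invr_ge0 ltW.
    by rewrite mulrC ler_wpM2r.
  have p2 : W * ((P v0 - P u0) + (Q v0 - Q u0)) <= W * (EC * z + EC * z).
    by rewrite ler_wpM2l ?(ltW W0) // lerD.
  have p3 : 4 * sup_cst ^+ 2 * (2 * rad e) <= W * z * (8 * sup_cst ^+ 2 * bnd G).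
    have x2 : 0 <= 8 * sup_cst ^+ 2 by rewrite mulr_ge0 ?sqr_ge0.
    have -> : 4 * sup_cst ^+ 2 * (2 * rad e) = 8 * sup_cst ^+ 2 * rad e by ring.
    rewrite -[leLHS]mul1r; apply: ler_pM => //; first by rewrite mulr_ge0 // ltW.
    by rewrite ler_wpM2l.
  have -> : W * z * (EC * (3 + (2 * gap G)^-1) + 8 * sup_cst ^+ 2 * bnd G) =
    W * (1 + (2 * gap G)^-1) * (EC * z) + W * (EC * z + EC * z) +
    W * z * (8 * sup_cst ^+ 2 * bnd G) by ring.
  by apply: lerD => //; apply: lerD.
apply: le_trans (ler_wpM2r _ SB) _; first by rewrite mulr_ge0 ?powR_ge0.
have eW : W `^ (1 - delta) = W * W `^ (- delta).
  by rewrite powRD ?powRr1 ?(ltW W0) //; apply/implyP => _; rewrite gt_eqF.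
by rewrite /disk_cst -/EC eW le_eqVlt; apply/orP; left; apply/eqP; ring.
Qed.

Let away_composable x e w : w \in L -> disk e x -> (forall c, disk c x = (c == e)) ->
  away w x = composable e w.
Proof.
move=> /HL[/properE[b [u [-> ru]]] _ _] ex cE.
by rewrite /away cE /= eq_sym.
Qed.

(** Cauchy-Schwarz in the form f <= Z / 2 + f^2 / (2 Z), applied on every disk to
    the sum over the words of the section composable with it; the square of the
    real sum is at most the energy. *)
Lemma wave_bound (p q Z : R) : p ^+ 2 + q ^+ 2 <= 1 -> 0 < Z ->
  (forall Phi : seq G -> R, tree_additive Phi ->
    \sum_a Phi [:: a] = \sum_(v <- L) Phi v) ->
  E (fun y => p * cos (omega * y) + q * sin (omega * y)) <=
    Z / 2 + #|G|%:R * (disk_cst * (W `^ (1 - delta) * z)) / (2 * Z).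
Proof.
move=> pq Z0 aL.
have bf : bmf (fun y => p * cos (omega * y) + q * sin (omega * y)).
  by apply: bmfD; apply: bmfZ; [exact: bmf_cos | exact: bmf_sin].
rewrite (integ_section delta01 D aL bf).
have ba w : bmf (fun x => (away w x)%:R : R) := bmf_ind (measurable_away w).
have bw w : bmf (weight delta (wmat w)) := bmf_weight delta01 (det_wmat w).
have bt w : bmf (fun x => (p * cos (omega * moeb (wmat w) x) +
    q * sin (omega * moeb (wmat w) x)) * (away w x)%:R * weight delta (wmat w) x).
  exact: bmfM (bmfM (bmf_comp bf (measurable_moeb (wmat w))) (ba w)) (bw w).
rewrite -integ_sum //.
have bE e : bmf (fun x => Z / 2 * (disk e x)%:R + (2 * Z)^-1 * ((disk e x)%:R * en e x)).
  exact: bmfD (bmfZ _ (bmf_disk e)) (bmfZ _ (bmfM (bmf_disk e) (bmf_energy e))).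
apply: (@le_trans _ _ (E (fun x => \sum_(e : G)
    (Z / 2 * (disk e x)%:R + (2 * Z)^-1 * ((disk e x)%:R * en e x))))).
  apply: integ_le; [exact: bmf_sum | exact: bmf_sum |].
  move=> x Lx; have [e [ex cE]] := lim_disk_unique Lx.
  rewrite [leRHS](bigD1 e) //= [X in _ <= _ + X]big1 ?addr0; last first.
    by move=> c /negbTE ce; rewrite cE ce mul0r !mulr0 addr0.
  rewrite ex mul1r mulr1.
  have -> : \sum_(w <- L) (p * cos (omega * moeb (wmat w) x) +
      q * sin (omega * moeb (wmat w) x)) * (away w x)%:R * weight delta (wmat w) x =
    p * csum (section_at L e) amp (phase omega) x +
    q * ssum (section_at L e) amp (phase omega) x.
    rewrite /csum /ssum !big_filter !mulr_sumr -big_split /= [RHS]big_mkcond /=.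
    rewrite big_seq [RHS]big_seq; apply: eq_bigr => w wL.
    rewrite (away_composable wL ex cE); case: (composable e w); last by rewrite mulr0 mul0r.
    by rewrite /phase mulr1; ring.
  rewrite /en /energy; set c := csum _ _ _ _; set s := ssum _ _ _ _.
  have h1 : 0 <= (p * s - q * c) ^+ 2 by exact: sqr_ge0.
  have h2 : (p * c + q * s) ^+ 2 <= c * c + s * s.
    have -> : (p * c + q * s) ^+ 2 = (p ^+ 2 + q ^+ 2) * (c * c + s * s) - (p * s - q * c) ^+ 2.
      by ring.
    apply: (@le_trans _ _ ((p ^+ 2 + q ^+ 2) * (c * c + s * s))); first by rewrite gerBl.
    by rewrite ler_piMl // addr_ge0 // -expr2 sqr_ge0.
  have h3 : 0 <= (p * c + q * s - Z) ^+ 2 by exact: sqr_ge0.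
  have -> : Z / 2 + (2 * Z)^-1 * (c * c + s * s) = (Z ^+ 2 + (c * c + s * s)) / (2 * Z).
    by field; rewrite gt_eqF.
  rewrite ler_pdivlMr ?mulr_gt0 //.
  move: h3; rewrite sqrrB => h3; have : (p * c + q * s) * (2 * Z) = (p * c + q * s) * Z *+ 2.
    by rewrite mulr2n; ring.
  by move=> ->; lra.
rewrite integ_sum //.
have -> : \sum_(e : G) E (fun x => Z / 2 * (disk e x)%:R + (2 * Z)^-1 * ((disk e x)%:R * en e x)) =
  Z / 2 * E (fun x => \sum_(e : G) (disk e x)%:R) +
  (2 * Z)^-1 * \sum_(e : G) E (fun x => (disk e x)%:R * en e x).
  rewrite integ_sum // !mulr_sumr -big_split /=; apply: eq_bigr => e _.
  have b2 := bmfM (bmf_disk e) (bmf_energy e).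
  by rewrite integD ?integZ //; exact: bmfZ.
apply: lerD.
  rewrite ger_pMr ?divr_gt0 //; apply: integ_le_cst; first exact: bmf_sum.
  move=> x Lx; have [e [ex cE]] := lim_disk_unique Lx.
  by rewrite (bigD1 e) //= ex big1 ?addr0 // => c /negbTE ce; rewrite cE ce.
rewrite mulrC ler_pM2r ?invr_gt0 ?mulr_gt0 //.
apply: (@le_trans _ _ (\sum_(e : G) disk_cst * (W `^ (1 - delta) * z))).
  by apply: ler_sum => e _; exact: disk_energy.
by rewrite sumr_const -[leLHS]mulr_natl.
Qed.

End fixed_scale.

(** Made of the ping-pong data and delta only, so that the decay is uniform over
    all conformal densities. *)
Definition decay_cst (c : R) : R := 2^-1 + #|G|%:R * (disk_cst * (2 * c)) / 2.

Lemma wave_decay (c X p q : R) : 1 <= c -> 1 <= X -> p ^+ 2 + q ^+ 2 <= 1 ->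
  E (fun y => p * cos (c * X * y) + q * sin (c * X * y)) <=
  decay_cst c * X `^ (- decay_exponent delta).
Proof.
move=> c1 X1 pq; have [d0 d1] := andP delta01.
have [tau [t01 W1 key]] := choice_of_scale delta12 d1 c1 X1.
have o0 : 0 < c * X by rewrite mulr_gt0 // (lt_le_trans ltr01).
have [L [uL HL aL]] := stopping_section G t01.
have Z0 : 0 < X `^ (- decay_exponent delta) by rewrite powR_gt0 // (lt_le_trans ltr01).
apply: le_trans (wave_bound t01 o0 W1 uL HL pq Z0 aL) _.
move: (X `^ _) Z0 key => Z Z0 key.
have -> : decay_cst c * Z = Z / 2 + #|G|%:R * (disk_cst * (2 * c * Z ^+ 2)) / (2 * Z).
  by rewrite /decay_cst; field; rewrite gt_eqF.
rewrite lerD2l; apply: ler_wpM2r; first by rewrite invr_ge0 mulr_ge0 // ltW.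
by apply: ler_wpM2l; [rewrite ler0n | apply: ler_wpM2l key; exact: disk_cst_ge0].
Qed.

Lemma decay_cst_gt0 (c : R) : 0 <= c -> 0 < decay_cst c.
Proof.
move=> c0; rewrite /decay_cst ltr_pwDl ?invr_gt0 // divr_ge0 // mulr_ge0 //.
by rewrite mulr_ge0 ?disk_cst_ge0 // mulr_ge0.
Qed.

End decay.

Arguments disk_cst {R} G delta.

(** * The action on the projective line *)

Section extended_moebius.
Context {F : fieldType}.
Implicit Types (g h : 'M[F]_2) (z : option F).

Lemma num_neq0 g x : \det g = 1 -> den g x = 0 -> num g x != 0.
Proof.
rewrite det2E => dg d0; apply/eqP => n0.
have : g 0 0 * den g x - g 1 0 * num g x = 1 by rewrite -dg /den /num; ring.
by rewrite d0 n0 !mulr0 subrr => /esym/eqP; rewrite oner_eq0.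
Qed.

Lemma upper_left_neq0 g : \det g = 1 -> g 1 0 = 0 -> g 0 0 != 0.
Proof.
rewrite det2E => dg c0; apply/eqP => a0; move: dg.
by rewrite c0 a0 mul0r mulr0 subrr => /esym/eqP; rewrite oner_eq0.
Qed.

Lemma moeb_ext_Some g x : den g x != 0 -> moeb_ext g (Some x) = Some (moeb g x).
Proof. by rewrite /moeb_ext -/(den g x) => /negbTE ->. Qed.

Lemma moeb_ext_pole g x : den g x = 0 -> moeb_ext g (Some x) = None.
Proof. by rewrite /moeb_ext -/(den g x) => ->; rewrite eqxx. Qed.

Lemma moeb_ext_None g : g 1 0 != 0 -> moeb_ext g None = Some (image_infty g).
Proof. by rewrite /moeb_ext => /negbTE ->. Qed.

Lemma moeb_ext_None0 g : g 1 0 = 0 -> moeb_ext g None = None.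
Proof. by rewrite /moeb_ext => ->; rewrite eqxx. Qed.

Lemma moeb_ext_mul g h z : \det h = 1 ->
  moeb_ext (g *m h) z = moeb_ext g (moeb_ext h z).
Proof.
move=> dh; case: z => [x|].
  have [d0|d0] := eqVneq (den h x) 0.
    rewrite (moeb_ext_pole d0); have n0 := num_neq0 dh d0.
    have dE : den (g *m h) x = g 1 0 * num h x.
      by rewrite -[RHS]addr0 -(mulr0 (g 1 1)) -d0 /den /num !mul2E; ring.
    have nE : num (g *m h) x = g 0 0 * num h x.
      by rewrite -[RHS]addr0 -(mulr0 (g 0 1)) -d0 /den /num !mul2E; ring.
    have [c0|c0] := eqVneq (g 1 0) 0.
      by rewrite moeb_ext_None0 // moeb_ext_pole // dE c0 mul0r.
    rewrite moeb_ext_None // moeb_ext_Some ?dE ?mulf_neq0 //.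
    congr Some; rewrite /moeb -/(num _ x) -/(den _ x) dE nE /image_infty.
    by rewrite -mulf_div divff ?mulr1.
  rewrite (moeb_ext_Some d0); have [d1|d1] := eqVneq (den g (moeb h x)) 0.
    by rewrite !moeb_ext_pole // den_mul // d1 mul0r.
  by rewrite !moeb_ext_Some ?moeb_mul // den_mul // mulf_neq0.
have [c0|c0] := eqVneq (h 1 0) 0.
  rewrite (moeb_ext_None0 c0); have a0 := upper_left_neq0 dh c0.
  have e1 : (g *m h) 1 0 = g 1 0 * h 0 0 by rewrite mul2E c0 mulr0 addr0.
  have e0 : (g *m h) 0 0 = g 0 0 * h 0 0 by rewrite mul2E c0 mulr0 addr0.
  have [c1|c1] := eqVneq (g 1 0) 0.
    by rewrite !moeb_ext_None0 // e1 c1 mul0r.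
  rewrite !moeb_ext_None ?e1 ?mulf_neq0 //; congr Some.
  by rewrite /image_infty e1 e0 -mulf_div divff ?mulr1.
rewrite (moeb_ext_None c0); have [d1|d1] := eqVneq (den g (image_infty h)) 0.
  by rewrite moeb_ext_pole // moeb_ext_None0 // lower_left_mul // d1 mulr0.
rewrite moeb_ext_Some // moeb_ext_None; first by rewrite image_infty_mul.
by rewrite lower_left_mul // mulf_neq0.
Qed.

Lemma moeb_ext1 z : moeb_ext 1%:M z = z.
Proof.
case: z => [x|]; first by rewrite moeb_ext_Some ?den1 ?oner_neq0 // moeb1.
by rewrite moeb_ext_None0 // mxE.
Qed.

Lemma moeb_extK g z : \det g = 1 -> moeb_ext (invmx g) (moeb_ext g z) = z.
Proof. by move=> dg; rewrite -moeb_ext_mul // mulVmx ?unit_det1 // moeb_ext1. Qed.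

Lemma moeb_extKV g z : \det g = 1 -> moeb_ext g (moeb_ext (invmx g) z) = z.
Proof.
by move=> dg; rewrite -moeb_ext_mul ?invmx_det1 // mulmxV ?unit_det1 // moeb_ext1.
Qed.

End extended_moebius.

Lemma moeb_ext_map (F K : fieldType) (f : {rmorphism F -> K}) (g : 'M[F]_2) z :
  moeb_ext (map_mx f g) (omap f z) = omap f (moeb_ext g z).
Proof.
case: z => [x|] /=; rewrite !mxE.
  rewrite -rmorphM -rmorphD fmorph_eq0; case: ifP => // _ /=.
  by rewrite /moeb !mxE fmorph_div !rmorphD !rmorphM.
by rewrite fmorph_eq0; case: ifP => // _ /=; rewrite fmorph_div.
Qed.

Section closed_preimage.
Context {R : realType}.
Variables (h : 'M[R]_2) (c r : R).
Hypotheses (dh : \det h = 1) (r0 : 0 < r).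

Definition in_disk_ext (z : option R) := if z is Some y then `|y - c| <= r else false.

(* [q x <= 0] says that the image of x is in the disk, without denominators, so
   it also makes sense at the pole *)
Let q x := (num h x - c * den h x) ^+ 2 - r ^+ 2 * den h x ^+ 2.

Let in_diskE x : in_disk_ext (moeb_ext h (Some x)) = (q x <= 0).
Proof.
have [d0|d0] := eqVneq (den h x) 0.
  rewrite moeb_ext_pole // /q d0 expr0n mulr0 !subr0 mulr0 subr0.
  apply/esym/negbTE; rewrite -ltNge exprn_even_gt0 //=; exact: num_neq0 dh d0.
rewrite moeb_ext_Some //= /q subr_le0 -exprMn.
have -> : moeb h x - c = (num h x - c * den h x) / den h x.
  by rewrite /moeb -/(num h x) -/(den h x); field.
rewrite normrM normfV ler_pdivrMr ?normr_gt0 //.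
have -> : r * `|den h x| = `|r * den h x| by rewrite normrM (gtr0_norm r0).
by rewrite -[LHS](@ler_pXn2r _ 2) ?nnegrE // !real_normK ?num_real.
Qed.

Let alpha := (h 0 0 - c * h 1 0) ^+ 2 - r ^+ 2 * h 1 0 ^+ 2.
Let beta := 2 * ((h 0 0 - c * h 1 0) * (h 0 1 - c * h 1 1) - r ^+ 2 * h 1 0 * h 1 1).
Let eps0 := (h 0 1 - c * h 1 1) ^+ 2 - r ^+ 2 * h 1 1 ^+ 2.

Let qE x : q x = alpha * x ^+ 2 + beta * x + eps0.
Proof. by rewrite /q /alpha /beta /eps0 /num /den; ring. Qed.

Let alpha_gt0 : ~~ in_disk_ext (moeb_ext h None) -> 0 < alpha.
Proof.
rewrite /alpha; have [c0|c0] := eqVneq (h 1 0) 0.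
  rewrite c0 expr0n !mulr0 !subr0 => _.
  by rewrite exprn_even_gt0 //= upper_left_neq0.
rewrite moeb_ext_None //= -ltNge subr_gt0 -exprMn => hr.
have -> : h 0 0 - c * h 1 0 = (image_infty h - c) * h 1 0 by rewrite /image_infty; field.
rewrite !exprMn ltr_pM2r ?exprn_even_gt0 //.
by rewrite -[ltRHS]real_normK ?num_real // ltr_pXn2r ?nnegrE ?(ltW r0).
Qed.

Let q_pos_far : 0 < alpha -> exists M, forall x, M < `|x| -> 0 < q x.
Proof.
move=> a0; exists ((`|beta| + `|eps0|) / alpha + 1) => x hx; rewrite qE.
have x1 : 1 <= `|x|.
  apply: le_trans (ltW hx); rewrite lerDr.
  by apply: divr_ge0; [exact: addr_ge0 | exact: ltW].
have hb : `|beta| + `|eps0| < alpha * `|x|.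
  by rewrite -ltr_pdivrMl // mulrC; apply: lt_trans hx; rewrite ltrDl.
have h1 : - (`|beta| * `|x|) <= beta * x.
  by rewrite -normrM; have := ler_norm (- (beta * x)); rewrite normrN; lra.
have h2 : - (`|eps0| * `|x|) <= eps0.
  have := ler_norm (- eps0); rewrite normrN; have : `|eps0| <= `|eps0| * `|x| by exact: (ler_peMr (normr_ge0 _) x1).
  lra.
have h3 : (`|beta| + `|eps0|) * `|x| < alpha * `|x| * `|x|.
  by rewrite ltr_pM2r // (lt_le_trans ltr01).
have e : x ^+ 2 = `|x| * `|x| by rewrite -expr2 real_normK ?num_real.
rewrite e; lra.
Qed.

Let q_cont : continuous q.
Proof.
move=> x; rewrite (_ : q = fun y => alpha * y ^+ 2 + beta * y + eps0); last exact/funext/qE.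
apply: (der_continuous (a := alpha * (1 * x + x * 1) + beta * 1 + 0)).
exact: derD (derD (derZ _ (derM (der_id x) (der_id x))) (derZ _ (der_id x))) (der_cst _ x).
Qed.

(** On the line the preimage is the sublevel set of a quadratic polynomial; if it
    avoids infinity, the leading coefficient is positive and the sublevel set is
    bounded. *)
Lemma closed_disk_preimage :
  closed [set z : one_point_compactification R | in_disk_ext (moeb_ext h z)].
Proof.
rewrite -[X in closed X]setCK; apply: open_closedC; rewrite openE => z /= /negP hz.
have qo : open [set x | 0 < q x].
  by apply: open_comp (@open_gt R 0) => x _; exact: q_cont.
case: z hz => [x|] hz.
  move: hz; rewrite in_diskE -ltNge => hx.
  change (nbhs x (Some @^-1` (~` [set z | in_disk_ext (moeb_ext h z)]))).
  apply: (@filterS _ _ _ [set x | 0 < q x]) => [y /= qy|].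
    by apply/negP; rewrite in_diskE -ltNge.
  exact: open_nbhs_nbhs.
have [M HM] := q_pos_far (alpha_gt0 hz).
exists `[-M, M]%classic.
  split; first exact: segment_compact.
  exact: interval_closed.
move=> _ [[y /= hy <-]|->]; last exact/negP.
apply/negP; rewrite in_diskE -ltNge; apply: HM.
rewrite ltNge ler_norml; apply/negP => hM; apply: hy.
by rewrite in_itv.
Qed.

End closed_preimage.

(** * Ping-pong for a Schottky group *)

Section schottky_real.
Context {R : realType} {r : nat}.
Variables (x rho : 'I_(r + r) -> R) (gamma : 'I_(r + r) -> 'M[R]_2) (Gamma : set 'M[R]_2).
Local Notation letter := 'I_(r + r).
Local Notation bl := (@bar_letter r).
Hypothesis r2 : (2 <= r)%N.
Hypothesis rho0 : forall a, 0 < rho a.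
Hypothesis disj : trivIset setT (fun a => half_disk (x a) (rho a)).
Hypothesis pingp : forall a, [/\ \det (gamma a) = 1,
  moebC (gamma a) @`
    (@closed_H2 R `\` interior_H2 (half_disk (x (bl a)) (rho (bl a))))
    = half_disk (x a) (rho a)
  & gamma (bl a) = invmx (gamma a)].
Hypothesis GammaE : Gamma = smallest (@subgroup_closed R)
  [set gamma (lshift r i) | i in [set: 'I_r]].

Let bar_lshift (i : 'I_r) : bl (lshift r i) = rshift r i.
Proof. by rewrite /bar_letter (unsplitK (inl i)). Qed.

Let bar_rshift (i : 'I_r) : bl (rshift r i) = lshift r i.
Proof. by rewrite /bar_letter (unsplitK (inr i)). Qed.

Let letter_cases (a : letter) : (exists i, a = lshift r i) \/ (exists i, a = rshift r i).
Proof.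
by rewrite -(splitK a); case: (fintype.split a) => i; [left | right]; exists i.
Qed.

Let bar_invol : involutive bl.
Proof.
by move=> a; case: (letter_cases a) => -[i ->];
  rewrite ?bar_lshift ?bar_rshift ?bar_lshift.
Qed.

Let bar_neq a : a != bl a.
Proof.
by case: (letter_cases a) => -[i ->];
  rewrite ?bar_lshift ?bar_rshift; apply/eqP => /(congr1 val) /=;
  have := ltn_ord i; lia.
Qed.

Let third (a b : letter) : exists c : letter, c != a /\ c != b.
Proof.
have h : (#|[set a; b]%SET| < #|[set: letter]%SET|)%N.
  rewrite cardsT card_ord cards2; case: (a != b) => /=; lia.
have /fintype.subsetPn[c _] : ~~ ([set: letter] \subset [set a; b])%SET.
  by apply/negP => /subset_leq_card; rewrite leqNgt h.
by rewrite !inE negb_or => /andP[]; exists c.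
Qed.

Let dmem a (y : R) : half_disk (x a) (rho a) (Some (real_complex R y)) <-> `|y - x a| <= rho a.
Proof.
rewrite /half_disk /= -rmorphB normc_def /= expr0n addr0 sqrtr_sqr lecR.
by split => [[]|].
Qed.

(* the point that divides the segment between the centres in the ratio of the
   radii would be common to both disks *)
Let sep_pos a b : a != b -> 0 < `|x a - x b| - rho a - rho b.
Proof.
move=> ab; rewrite ltNge; apply/negP => h.
have ra := rho0 a; have rb := rho0 b; have s0 : 0 < rho a + rho b by exact: addr_gt0.
pose y := (x a * rho b + x b * rho a) / (rho a + rho b).
have hk : `|x a - x b| / (rho a + rho b) <= 1 by rewrite ler_pdivrMr //; lra.
have ya : `|y - x a| <= rho a.
  have -> : y - x a = - (rho a * ((x a - x b) / (rho a + rho b))).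
    by rewrite /y; field; rewrite gt_eqF.
  rewrite normrN normrM (gtr0_norm ra) ler_piMr ?(ltW ra) //.
  by rewrite normrM normfV (gtr0_norm s0).
have yb : `|y - x b| <= rho b.
  have -> : y - x b = rho b * ((x a - x b) / (rho a + rho b)).
    by rewrite /y; field; rewrite gt_eqF.
  rewrite normrM (gtr0_norm rb) ler_piMr ?(ltW rb) //.
  by rewrite normrM normfV (gtr0_norm s0).
move: ab => /eqP; apply; apply: (disj I I).
by exists (Some (real_complex R y)); split; exact/dmem.
Qed.

(* The gap must be at most each of finitely many positive numbers: the radii and
   the distances between disks. The inverse of 1 plus the sum of the inverses
   is a uniform choice. *)
Let F (ab : letter * letter) := if ab.1 == ab.2 then rho ab.1
  else `|x ab.1 - x ab.2| - rho ab.1 - rho ab.2.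

Let F0 ab : 0 < F ab.
Proof. by rewrite /F; case: eqVneq => [_|/sep_pos]. Qed.

Let gp := (1 + \sum_ab (F ab)^-1)^-1.

Let sumF_ge0 : 0 <= \sum_ab (F ab)^-1.
Proof. by apply: sumr_ge0 => ab _; rewrite invr_ge0 ltW. Qed.

Let gp0 : 0 < gp.
Proof. by rewrite invr_gt0 ltr_pwDl. Qed.

Let gp1 : gp <= 1.
Proof. by rewrite invf_le1 ?lerDl // ltr_pwDl. Qed.

Let gpF ab : gp <= F ab.
Proof.
rewrite /gp -[leRHS]invrK lef_pV2 ?posrE ?ltr_pwDl ?invr_gt0 //.
rewrite (bigD1 ab) //= addrCA lerDl addr_ge0 //.
by apply: sumr_ge0 => cd _; rewrite invr_ge0 ltW.
Qed.

Let bd := 1 + \sum_a (`|x a| + rho a).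

Let bd1 : 1 <= bd.
Proof. by rewrite lerDl; apply: sumr_ge0 => a _; rewrite addr_ge0 // ltW. Qed.

Let bdP a y : `|y - x a| <= rho a -> `|y| <= bd.
Proof.
move=> h; have -> : y = (y - x a) + x a by rewrite subrK.
apply: le_trans (ler_normD _ _) _; rewrite /bd (bigD1 a) //=.
have : 0 <= \sum_(i | i != a) (`|x i| + rho i).
  by apply: sumr_ge0 => i _; rewrite addr_ge0 // ltW.
by lra.
Qed.

Let gapP a b y y' : a != b -> `|y - x a| <= rho a -> `|y' - x b| <= rho b -> gp <= `|y - y'|.
Proof.
move=> ab ya yb; apply: le_trans (gpF (a, b)) _; rewrite /F /= (negbTE ab).
have := ler_normD (x a - y + (y - y')) (y' - x b).
have := ler_normD (x a - y) (y - y').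
have -> : x a - y + (y - y') + (y' - x b) = x a - x b by ring.
rewrite [`|x a - y|]distrC; lra.
Qed.

Let ext_disk a (z : option R) : ~~ in_disk_ext (x (bl a)) (rho (bl a)) z ->
  in_disk_ext (x a) (rho a) (moeb_ext (gamma a) z).
Proof.
move=> nz; have [_ im _] := pingp a.
have cz : @closed_H2 R (omap (real_complex R) z).
  by case: (z) => [y|] //; rewrite /closed_H2 /=.
have nd : ~ half_disk (x (bl a)) (rho (bl a)) (omap (real_complex R) z).
  by case: (z) nz => [y /negP nz /dmem|_ []] //.
have : half_disk (x a) (rho a) (moebC (gamma a) (omap (real_complex R) z)).
  rewrite -im; exists (omap (real_complex R) z) => //; split => //.
  by move=> /interior_subset.
rewrite /moebC moeb_ext_map; case: (moeb_ext _ z) => [y /dmem|[]] //.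
Qed.

Let g_infty a : gamma a 1 0 != 0 /\ `|image_infty (gamma a) - x a| <= rho a.
Proof.
have := @ext_disk a None isT; have [c0|c0] := eqVneq (gamma a 1 0) 0.
  by rewrite moeb_ext_None0.
by rewrite moeb_ext_None.
Qed.

Let g_disk a y : ~~ (`|y - x (bl a)| <= rho (bl a)) ->
  den (gamma a) y != 0 /\ `|moeb (gamma a) y - x a| <= rho a.
Proof.
move=> ny; have := @ext_disk a (Some y) ny; have [d0|d0] := eqVneq (den (gamma a) y) 0.
  by rewrite moeb_ext_pole.
by rewrite moeb_ext_Some.
Qed.

(** Only the real line enters here: the half-plane hypothesis is used at real
    points and at infinity, where the action on the sphere restricts to the one
    on the projective line. *)
Definition schottky_pingpong : pingpong R := @PingPong R letter bl x rho gamma gp bd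
  (lshift r (Ordinal (leq_trans (isT : 0 < 2)%N r2))) bar_invol third
  (fun a => let: And3 d _ _ := pingp a in d)
  (fun a => let: And3 _ _ e := pingp a in e)
  gp0 gp1 (fun a => eq_ind_r (fun t => is_true (gp <= t)) (gpF (a, a)) (esym (ifT _ _ (eqxx a)))) bd1 gapP bdP g_infty g_disk.

Local Notation G := schottky_pingpong.
Local Notation D a := (in_disk_ext (x a) (rho a)).

Let det_gamma a : \det (gamma a) = 1. Proof. by case: (pingp a). Qed.

Let gamma_bar a : gamma (bl a) = invmx (gamma a). Proof. by case: (pingp a). Qed.

Lemma Gamma_subgroup : subgroup_closed Gamma.
Proof.
rewrite GammaE; split; first by move=> M [[]].
- move=> g h Gg Gh M MP; case: (MP) => -[_ mM _] _.
  by apply: mM; [exact: Gg | exact: Gh].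
- by move=> g Gg M MP; case: (MP) => -[_ _ iM] _; apply: iM; exact: Gg.
Qed.

Let Gamma_gamma a : Gamma (gamma a).
Proof.
have L i : Gamma (gamma (lshift r i)).
  by rewrite GammaE; apply: sub_gen_smallest; exists i.
case: (letter_cases a) => -[i ->] //.
by rewrite -bar_lshift gamma_bar; case: Gamma_subgroup => _ _; apply.
Qed.

Lemma Gamma_wmat (w : seq G) : Gamma (wmat w).
Proof.
elim: w => [|b u IH] /=; first by case: Gamma_subgroup.
by case: Gamma_subgroup => _ mG _; apply: mG => //; exact: Gamma_gamma.
Qed.

(** Points with an infinite itinerary through the disks. They form an invariant set,
    which makes the closed invariant set [inv_region] below non-empty. *)
Let coded (z : option R) := exists (s : nat -> letter) (zs : nat -> option R),
  zs 0%N = z /\ forall n, [/\ D (s n) (zs n), s n.+1 != bl (s n)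
    & zs n.+1 = moeb_ext (gamma (bl (s n))) (zs n)].

Let D_disjoint a b z : a != b -> D a z -> ~~ D b z.
Proof.
case: z => // y ab /= ya; apply/negP => yb.
by have := gapP ab ya yb; rewrite subrr normr0 leNgt gp0.
Qed.

Let coded_gamma b z : coded z -> coded (moeb_ext (gamma b) z).
Proof.
move=> [s [zs [z0 H]]]; have [e|e] := eqVneq b (bl (s 0%N)).
  exists (fun n => s n.+1), (fun n => zs n.+1); split => [|n]; last exact: H.
  by have [_ _ ->] := H 0%N; rewrite z0 e.
exists (fun n => if n is k.+1 then s k else b),
  (fun n => if n is k.+1 then zs k else moeb_ext (gamma b) z).
split => // -[|n]; last exact: H.
have [d0 _ _] := H 0%N; split.
- apply: ext_disk; rewrite -z0; apply: D_disjoint d0.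
  by apply: contra_neq e => ->; rewrite bar_invol.
- by apply: contra_neq e => ->; rewrite bar_invol.
- by rewrite gamma_bar moeb_extK.
Qed.

Let coded_Gamma g z : Gamma g -> coded z -> coded (moeb_ext g z).
Proof.
move=> Gg; suff : [set g | [/\ \det g = 1, forall z, coded z -> coded (moeb_ext g z)
    & forall z, coded z -> coded (moeb_ext (invmx g) z)]] g by case=> _ + _; apply.
move: Gg; rewrite GammaE; apply: smallest_sub.
  split => /=.
  - split; first exact: det1.
      by move=> y; rewrite moeb_ext1.
    by move=> y; rewrite invmx1 moeb_ext1.
  - move=> g1 g2 [d1 a1 i1] [d2 a2 i2]; split.
    + by rewrite det_mulmx d1 d2 mulr1.
    + by move=> y yc; rewrite moeb_ext_mul //; exact/a1/a2.
    + by move=> y yc; rewrite invmxM // moeb_ext_mul ?invmx_det1 //; exact/i2/i1.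
  - by move=> g1 [d1 a1 i1]; split => //; [exact: invmx_det1 | move=> y; rewrite invmxK; exact: a1].
move=> _ [i _ <-] /=; split => //; first exact: coded_gamma.
by move=> y yc; rewrite -gamma_bar; exact: coded_gamma.
Qed.

Let coded_step z : coded z -> exists a b, b != bl a /\ D b (moeb_ext (gamma (bl a)) z).
Proof.
move=> [s [zs [z0 H]]]; exists (s 0%N), (s 1%N).
have [_ ne e] := H 0%N; have [d1 _ _] := H 1%N.
by rewrite -z0 -e.
Qed.

(* the fixed point of a generator in its disk, from the intermediate value
   theorem, has a constant itinerary *)
Let coded_nonempty : exists z, coded z.
Proof.
pose a : letter := some_letter G.
have ra := rho0 a; set u := x a - rho a; set v := x a + rho a.
have uv : u <= v by rewrite /u /v; lra.
have J y : u <= y <= v -> `|y - x a| <= rho a by rewrite ler_distl.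
have nb y : u <= y <= v -> ~~ (`|y - x (bl a)| <= rho (bl a)).
  by move=> /J h; have := @D_disjoint a (bl a) (Some y) (bar_neq a) h.
pose f y := moeb (gamma a) y - y.
have df y : u <= y <= v -> is_derive y 1 f (den (gamma a) y ^- 2 - 1).
  move=> yuv; apply: derB (der_id y); apply: der_moeb => //.
  exact: (g_disk (nb y yuv)).1.
have mf y : u <= y <= v -> u <= moeb (gamma a) y <= v.
  by move=> yuv; rewrite -ler_distl; exact: (g_disk (nb y yuv)).2.
have uu : u <= u <= v by rewrite lexx. have vv : u <= v <= v by rewrite lexx uv.
have fu : 0 <= f u by rewrite subr_ge0; case/andP: (mf u uu).
have fv : f v <= 0 by rewrite subr_le0; case/andP: (mf v vv).
have [|c cI fc] := IVT (v := 0) uv (der_within df).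
  by rewrite ge_min fv orbT le_max fu.
have {}cI : u <= c <= v by move: cI; rewrite in_itv.
have mc : moeb (gamma a) c = c by apply/eqP; rewrite -subr_eq0 -/(f c) fc.
have ec : moeb_ext (gamma a) (Some c) = Some c.
  by rewrite moeb_ext_Some ?mc //; exact: (g_disk (nb c cI)).1.
exists (Some c), (fun=> a), (fun=> Some c); split => // _; split.
- exact: J.
- exact: bar_neq.
- by rewrite -{2}ec gamma_bar moeb_extK.
Qed.

(** The points all of whose translates have a reduced itinerary of length two. This
    is closed and invariant by construction and contains the coded points, hence
    it contains the limit set by minimality. *)
Let inv_region : set (one_point_compactification R) :=
  \bigcap_(g in Gamma) \bigcup_(ab in [set ab : letter * letter | ab.2 != bl ab.1])
    [set z | in_disk_ext (x ab.2) (rho ab.2) (moeb_ext (gamma (bl ab.1) *m g) z)].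

Let Gamma_det g : Gamma g -> \det g = 1.
Proof.
rewrite GammaE; move: g; apply: smallest_sub => [|_ [i _ <-] /=]; last exact: det_gamma.
split => /=; first exact: det1.
  by move=> g h /= dg dh; rewrite det_mulmx dg dh mulr1.
by move=> g /=; exact: invmx_det1.
Qed.

Let limit_set_sub : limit_set Gamma `<=` inv_region.
Proof.
apply: bigcap_inf; split.
- have [z cz] := coded_nonempty; exists z => g Gg.
  have [a [b [ba h]]] := coded_step (coded_Gamma Gg cz).
  by exists (a, b) => //=; rewrite moeb_ext_mul ?Gamma_det.
- apply: closed_bigI => g Gg; apply: closed_bigcup => [|ab _].
    exact: finite_finset.
  apply: closed_disk_preimage => //.
  by rewrite det_mulmx det_gamma Gamma_det ?mul1r.
move=> g Gg _ [z zK <-] h Gh.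
have Ghg : Gamma (h *m g) by case: Gamma_subgroup => _ mG _; exact: mG.
have [ab /= ab1 zab] := zK _ Ghg; exists ab => //=.
by rewrite -moeb_ext_mul ?Gamma_det // -mulmxA.
Qed.

Let limit_set_inv g z : Gamma g -> limit_set Gamma z -> limit_set Gamma (moeb_ext g z).
Proof.
move=> Gg Lz K KP; case: (KP) => _ _ inv; apply: (inv g Gg).
by exists z => //; exact: Lz.
Qed.

Let limit_set_step z : limit_set Gamma z ->
  exists a b, [/\ b != bl a, D a z & D b (moeb_ext (gamma (bl a)) z)].
Proof.
move=> /limit_set_sub /(_ 1%:M); case: Gamma_subgroup => G1 _ _ /(_ G1) [[a b] /= ba].
rewrite mulmx1 => h; exists a, b; split => //.
have := ext_disk (D_disjoint ba h).
by rewrite gamma_bar moeb_extKV.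
Qed.

Lemma limit_setR_disk y : limit_setR Gamma y -> exists a : G, disk a y.
Proof. by move=> /limit_set_step [a [b [_ h _]]]; exists a. Qed.

Lemma limit_setR_inv g y : Gamma g -> limit_setR Gamma y ->
  den g y != 0 /\ limit_setR Gamma (moeb g y).
Proof.
move=> Gg Ly; have := limit_set_inv Gg Ly.
have [d0|d0] := eqVneq (den g y) 0.
  by rewrite moeb_ext_pole // => /limit_set_step [a [b []]].
by rewrite moeb_ext_Some.
Qed.

Lemma limit_setR_back y (a : G) : limit_setR Gamma y -> disk a y ->
  ~~ disk (bar a) (moeb (gen (bar a)) y).
Proof.
move=> Ly ya; have [a' [b [ba h1 h2]]] := limit_set_step Ly.
have aa : a' = a.
  apply/eqP; apply: contraT => ne; have := D_disjoint ne h1.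
  by rewrite /= => /negP; case.
subst a'; move: h2; rewrite moeb_ext_Some; last exact: (limit_setR_inv (Gamma_gamma _) Ly).1.
by move=> h2; have := D_disjoint ba h2.
Qed.

End schottky_real.

(** * The Patterson-Sullivan measure as a conformal density *)

Section support.
Context {R : realType}.
Variable mu : probability (measurableTypeR R) R.

Lemma not_support x : ~ measure_support mu x ->
  exists U : set R, [/\ open U, U x & mu U = 0%E].
Proof.
move=> /existsNP[U /not_implyP[oU /not_implyP[Ux nU]]]; exists U; split => //.
apply/eqP; rewrite eq_le measure_ge0 andbT leNgt; exact/negP.
Qed.

Lemma closed_support : closed (measure_support mu).
Proof.
rewrite -[X in closed X]setCK; apply: open_closedC; rewrite openE => x /not_support[U [oU Ux U0]].
apply: (@filterS _ _ _ U); last exact: open_nbhs_nbhs.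
by move=> y Uy h; have : (0 < mu U)%E := h U oU Uy; rewrite U0 ltxx.
Qed.

Lemma measurable_support : measurable (measure_support mu : set (measurableTypeR R)).
Proof. exact: (closed_measurable closed_support). Qed.

(** The line has a countable base of intervals with rational end points, so the
    complement of the support is a countable union of null sets. *)
Lemma support_null : mu (~` measure_support mu) = 0%E.
Proof.
have mS := measurable_support.
pose J (pq : rat * rat) := `]ratr pq.1, ratr pq.2[%classic : set R.
pose N n : set R := if unpickle n is Some pq then
  if `[< mu (J pq) = 0%E >] then J pq else set0 else set0.
have N0 n : mu.-negligible (N n).
  rewrite /N; case: (unpickle n) => [pq|]; last exact: negligible_set0.
  case: asboolP => [h|_]; last exact: negligible_set0.
  by exists (J pq); split => //; exact: measurable_itv.
apply: measure_negligible; first exact: measurableC.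
apply: negligibleS (negligible_bigcup N0) => x /not_support[U [oU Ux U0]].
have [e /= e0 eU] : nbhs x U by exact: open_nbhs_nbhs.
have [p] := @rat_in_itvoo R (x - e) x ltac:(by rewrite gtrBl).
have [q] := @rat_in_itvoo R x (x + e) ltac:(by rewrite ltrDl).
rewrite !in_itv /= => /andP[q1 q2] /andP[p1 p2].
exists (pickle (p, q)); [exact: I | rewrite /N pickleK].
have sub : J (p, q) `<=` U.
  move=> y; rewrite /J /= in_itv /= => /andP[y1 y2]; apply: eU => /=.
  by rewrite /ball /= ltr_distlC; apply/andP; split; lra.
case: asboolP => [_|]; first by rewrite /J /= in_itv /= p2 q1.
case; apply/eqP; rewrite eq_le measure_ge0 andbT -U0.
apply: le_measure => //; rewrite ?inE; first exact: measurable_itv.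
exact: open_measurable.
Qed.

End support.

Section density_of_measure.
Context {R : realType} {G : pingpong R} {delta : R}.
Hypothesis delta01 : 0 < delta < 1.
Variables (Gamma : set 'M[R]_2) (mu : probability (measurableTypeR R) R).
Hypothesis PS : patterson_sullivan Gamma delta mu.
Hypothesis Gamma_wmat : forall w : seq G, Gamma (wmat w).
Local Notation Lam := (limit_setR Gamma).
Hypothesis Lam_disk : forall x, Lam x -> exists a : G, disk a x.
Hypothesis Lam_back : forall x (a : G), Lam x -> disk a x ->
  ~~ disk (bar a) (moeb (gen (bar a)) x).
Hypothesis Lam_inv : forall g x, Gamma g -> Lam x -> den g x != 0 /\ Lam (moeb g x).

Let mL : measurable (Lam : set (measurableTypeR R)).
Proof. by case: PS => <- _; exact: measurable_support. Qed.

Let LC0 : mu (~` Lam) = 0%E.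
Proof. by case: PS => <- _; exact: support_null. Qed.

Lemma bmf_integrable (A : set (measurableTypeR R)) f : measurable A -> bmf f ->
  mu.-integrable A (EFin \o f).
Proof.
move=> mA [mf [M fM]]; apply: measurable_bounded_integrable => //.
- by apply: le_lt_trans (probability_le1 mu mA) _; rewrite ltry.
- exact: measurable_funS mf.
exists M; split; first exact: num_real.
by move=> y My x _; apply: le_trans (fM x) (ltW My).
Qed.

Definition lim_integral (f : R -> R) : R := \int[mu]_(x in Lam) f x.

Let lin k f g : bmf f -> bmf g ->
  lim_integral (fun x => k * f x + g x) = k * lim_integral f + lim_integral g.
Proof.
move=> bf bg; rewrite /lim_integral RintegralD //; try exact: bmf_integrable.
  by rewrite RintegralZl //; exact: bmf_integrable.
exact: (bmf_integrable mL (bmfZ k bf)).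
Qed.

Let mono f g : bmf f -> bmf g -> (forall x, Lam x -> f x <= g x) ->
  lim_integral f <= lim_integral g.
Proof. by move=> bf bg fg; apply: le_Rintegral => //; exact: bmf_integrable. Qed.

Lemma Rintegral_limit_set f : bmf f -> \int[mu]_x f x = lim_integral f.
Proof.
move=> bf; rewrite /lim_integral /Rintegral; congr fine.
have mN : measurable (~` Lam : set (measurableTypeR R)) by exact: measurableC.
rewrite (negligible_integral mN (@measurableT _ _) (bmf_integrable (@measurableT _ _) bf) LC0).
by rewrite setTD setCK.
Qed.

Let unit : lim_integral (fun=> 1) = 1.
Proof.
rewrite -Rintegral_limit_set; last exact: bmf_cst.
rewrite (Rintegral_cst mu (@measurableT _ _)).
by rewrite mul1r; exact: (congr1 fine (@probability_setT _ _ _ mu)).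
Qed.

Let conformal (w : seq G) f : bmf f ->
  lim_integral f = lim_integral (fun x => f (moeb (wmat w) x) * weight delta (wmat w) x).
Proof.
move=> [mf bf]; rewrite /lim_integral /Rintegral; congr fine.
have [_ H] := PS; rewrite (H f mf bf _ (Gamma_wmat w)).
apply: eq_integral => x; rewrite inE => Lx; congr (_%:E); congr (_ * _ `^ _).
have [d0 _] := Lam_inv (Gamma_wmat w) Lx.
have dm := der_moeb (det_wmat w) d0.
have [_ e] := der_canon dm.
rewrite /circle_derivative e sphderE // ger0_norm ?invr_ge0 ?sqr_ge0 //.
have m0 : 1 + moeb (wmat w) x ^+ 2 != 0 by rewrite lt0r_neq0 // ltr_pwDl ?sqr_ge0.
by field; rewrite d0 m0.
Qed.

Definition density_of_measure : conformal_density G delta :=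
  ConformalDensity Lam_disk Lam_back (fun w x Lx => Lam_inv (Gamma_wmat w) Lx)
    lin mono unit conformal.

End density_of_measure.

(** * The Fourier transform *)

Section fourier_modulus.
Context {R : realType} {delta : R}.
Variables (Gamma : set 'M[R]_2) (mu : probability (measurableTypeR R) R).
Hypothesis PS : patterson_sullivan Gamma delta mu.

(** The modulus of a complex integral is attained by a real wave: rotate the
    integrand by the conjugate phase of the integral. *)
Lemma complex_modulus_le (s B : R) : 0 <= B ->
  (forall p q, p ^+ 2 + q ^+ 2 <= 1 ->
    lim_integral Gamma mu (fun x => p * cos (`|s| * x) + q * sin (`|s| * x)) <= B) ->
  `|complex_integral mu (fun x => expi (- (s * x)))| <= B%:C.
Proof.
move=> B0 H; rewrite /complex_integral /expi /= normc_def /= lecR.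
have mT : measurable [set: measurableTypeR R] by exact: measurableT.
have bc := bmf_cos (- s); have bs := bmf_sin (- s).
set a := Rintegral _ _ _; set b := Rintegral _ _ _.
have aE : a = \int[mu]_x cos (- s * x) by rewrite /a; congr Rintegral; apply/funext => y; rewrite mulNr.
have bE : b = \int[mu]_x sin (- s * x) by rewrite /b; congr Rintegral; apply/funext => y; rewrite mulNr.
set n := Num.sqrt _.
have n2 : n ^+ 2 = a ^+ 2 + b ^+ 2 by rewrite sqr_sqrtr // addr_ge0 ?sqr_ge0.
have [n0|n0] := leP n 0; first exact: le_trans B0.
have key p q : \int[mu]_x (p * cos (- s * x) + q * sin (- s * x)) = p * a + q * b.
  rewrite RintegralD //; try exact: (bmf_integrable _ mT (bmfZ _ _)).
  by rewrite !RintegralZl // -?aE -?bE //; exact: bmf_integrable.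
have -> : n = a / n * a + b / n * b.
  have -> : a / n * a + b / n * b = (a ^+ 2 + b ^+ 2) / n by ring.
  by rewrite -n2; field; rewrite gt_eqF.
have pq : (a / n) ^+ 2 + (b / n) ^+ 2 <= 1.
  have -> : (a / n) ^+ 2 + (b / n) ^+ 2 = (a ^+ 2 + b ^+ 2) / n ^+ 2 by field; rewrite gt_eqF.
  by rewrite -n2 divff // expf_neq0 // gt_eqF.
move: (a / n) (b / n) pq => p q pq; rewrite -key.
rewrite (Rintegral_limit_set PS); last exact: (bmfD (bmfZ _ bc) (bmfZ _ bs)).
have [s0|s0] := leP 0 s.
  have pq' : p ^+ 2 + (- q) ^+ 2 <= 1 by rewrite sqrrN.
  have := H p (- q) pq'; rewrite ger0_norm //.
  by under eq_fun do rewrite mulNr -mulrN -sinN -mulNr -(cosN (s * _)) -mulNr.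
by have := H p q pq; rewrite ltr0_norm.
Qed.

End fourier_modulus.

Unset Implicit Arguments.
Set Strict Implicit.

Theorem theorem1 (R : realType) (Gamma : set 'M[R]_2)
    (hGamma : schottky_group Gamma)
    (delta : R) (hdelta01 : 0 < delta < 1)
    (hdim : hausdorff_dim (limit_setR Gamma) = delta%:E)
    (hdelta : 1 / 2 < delta) :
  exists C : R, 0 < C /\
    forall mu : probability (measurableTypeR R) R,
      patterson_sullivan Gamma delta mu ->
      forall xi : R, 1 <= `|xi| ->
        `|fourier_transform mu xi| <=
          (C * `|xi| `^ (- (delta * (2 * delta - 1)
                            / ((2 * delta + 1) * (3 - delta)))))%:C.
Proof.
have [r [x [rho [gamma [r2 rho0 disj pingp GammaE]]]]] := hGamma.
pose G := schottky_pingpong r2 rho0 disj pingp.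
have c1 : 1 <= 2 * pi :> R.
  apply: (@le_trans _ _ 2); first by rewrite ler1n.
  by rewrite ler_peMr // (le_trans _ (pi_ge2 R)) // ler1n.
have delta12 : 1 / 2 < delta := hdelta.
exists (@decay_cst R G delta (2 * pi)); split.
  by apply: decay_cst_gt0 => //; exact: le_trans ler01 c1.
move=> mu PS xi xi1.
pose D : conformal_density G delta := density_of_measure PS (Gamma_wmat GammaE)
  (limit_setR_disk r2 rho0 disj pingp GammaE) (limit_setR_back GammaE)
  (limit_setR_inv r2 rho0 disj pingp GammaE).
rewrite /fourier_transform.
have nE : `|2 * pi * xi| = 2 * pi * `|xi| by rewrite normrM ger0_norm // (le_trans ler01 c1).
move: (2 * pi) c1 nE => c c1 nE.
apply: (complex_modulus_le PS) => [|p q pq].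
  apply: mulr_ge0; last exact: powR_ge0.
  by apply: ltW; apply: decay_cst_gt0 => //; exact: le_trans ler01 c1.
by rewrite nE; exact: (wave_decay hdelta01 delta12 D c1 xi1 pq).
Qed.
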